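(* Let $p$ be a prime, let $\pi$ be a supersingular representation of $G=\mathrm{GL}_2(\mathbb{Q}_p)$ over $\overline{\mathbb{F}}_p$, and let $M\subseteq\pi$ be the $\overline{\mathbb{F}}_p$-subspace spanned by the vectors $gv$ with $v\in\pi^{I_1}$ and $g\in\left\{\begin{pmatrix}p^n&b\\0&1\end{pmatrix}: n\ge 0,\ b\in\mathbb{Z}_p\right\}$. Then $M$ is stable under $I$, and the map $(v,w)\mapsto v-w$ induces an exact sequence of $I$-representations $$0\rightarrow \pi^{I_1}\rightarrow M\oplus \Pi\cdot M\rightarrow \pi\rightarrow 0,$$ where $\Pi=\begin{pmatrix}0&1\\ p&0\end{pmatrix}$ and the first map is $v\mapsto(v,v)$.
   Context: $I=\begin{pmatrix}\mathbb{Z}_p^\times&\mathbb{Z}_p\\ p\mathbb{Z}_p&\mathbb{Z}_p^\times\end{pmatrix}$, $I_1=\begin{pmatrix}1+p\mathbb{Z}_p&\mathbb{Z}_p\\ p\mathbb{Z}_p&1+p\mathbb{Z}_p\end{pmatrix}$. Definition of supersingular. Let $K=\mathrm{GL}_2(\mathbb{Z}_p)$, $Z$ the centre of $G$, $t=\begin{pmatrix}p&0\\0&1\end{pmatrix}$, and let $[\lambda]\in\mathbb{Z}_p$ be the Teichmüller lift of $\lambda\in\mathbb{F}_p$. For $0\le r\le p-1$, $\mathrm{Sym}^r\overline{\mathbb{F}}_p^2$ is the space of homogeneous polynomials of degree $r$ in $\overline{\mathbb{F}}_p[x,y]$ with $\begin{pmatrix}a&b\\c&d\end{pmatrix}\cdot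 P(x,y)=P(ax+cy,bx+dy)$, viewed as a representation of $KZ$ via $K\to\mathrm{GL}_2(\mathbb{F}_p)$ and with $p\in Z$ acting trivially. Let $\mathrm{c\text{-}Ind}_{KZ}^G$ denote smooth compact induction (functions $f$ on $G$ with $f(kg)=k f(g)$ for $k\in KZ$, compactly supported modulo $Z$, $G$ acting by right translation). Let $\varphi\in\mathrm{c\text{-}Ind}_{KZ}^G\mathrm{Sym}^r\overline{\mathbb{F}}_p^2$ have support $KZ$ and $\varphi(1)=x^r$; it generates the compact induction. Let $T$ be the $G$-endomorphism determined by $T\varphi=\sum_{\lambda\in\mathbb{F}_p}\begin{pmatrix}1&[\lambda]\\0&1\end{pmatrix}t\varphi$ if $r\ge1$, and $T\varphi=\Pi\varphi+\sum_{\lambda\in\mathbb{F}_p}\begin{pmatrix}1&[\lambda]\\0&1\end{pmatrix}t\varphi$ if $r=0$. For a smooth character $\eta:\mathbb{Q}_p^\times\to\overline{\mathbb{F}}_p^\times$ put $\pi(r,0,\eta)=\mathrm{coker}(T)\otimes\eta\circ\det$. A representation is supersingular if it is isomorphic to $\pi(r,0,\eta)$ for some $0\le r\le p-1$ and some smooth $\eta$ (these are irreducible). *)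

(* Defs.v *)
From HB Require Import structures.
From mathcomp Require Import all_boot all_order all_algebra.
From mathcomp Require Import boolp classical_sets functions.
From mathcomp Require Import mpoly.
From mathcomp Require Import topology.

Set Implicit Arguments.
Unset Strict Implicit.
Unset Printing Implicit Defensive.

Import Order.TTheory GRing.Theory Num.Theory.
Local Open Scope classical_set_scope.
Local Open Scope ring_scope.

(* Z_p as the inverse limit of the rings Z/p^n, each class being given by   *)
(* its representative in [0, p^n). The primality proof is a parameter of    *)
(* the type so that the integral domain structure can be canonical.         *)

Record padic_int (p : nat) (p_pr : prime p) := PadicInt {
  residue :> nat -> int;
  residueP : forall n, residue n = (residue n.+1 %% (p ^ n)%N%:Z)%Z }.

Section PadicIntegers.
Variables (p : nat) (p_pr : prime p).
Local Notation Zp := (padic_int p_pr).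
Local Notation P n := ((p ^ n)%N%:Z).
Implicit Types x y z : Zp.

Lemma ppow_gt0 n : 0 < P n.
Proof. by rewrite ltz_nat expn_gt0 prime_gt0. Qed.

Lemma ppow_neq0 n : P n != 0.
Proof. by rewrite gt_eqF ?ppow_gt0. Qed.

Lemma ppowD m n : P (m + n) = P m * P n.
Proof. by rewrite expnD PoszM. Qed.

Lemma padicP x y : (forall n, x n = y n) -> x = y.
Proof.
case: x y => [f fP] [g gP] /= /funext efg; case: _ / efg gP => gP.
by congr PadicInt; apply: Prop_irrelevance.
Qed.


Lemma dvdz_ppow m n : (m <= n)%N -> (P m %| P n)%Z.
Proof. by move=> lemn; rewrite dvdzE !absz_nat dvdn_exp2l. Qed.

Lemma modz_ppow (a : int) m n : (m <= n)%N -> ((a %% P n)%Z = a %[mod P m])%Z.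
Proof.
move=> lemn; apply/eqP; rewrite eqz_mod_dvd.
apply: (dvdz_trans (dvdz_ppow lemn)).
by rewrite -eqz_mod_dvd modz_mod.
Qed.

Lemma residue_small x n : (x n %% P n)%Z = x n.
Proof. by rewrite [x n]residueP modz_mod. Qed.

Lemma residue_mod x m n : (m <= n)%N -> (x n %% P m)%Z = x m.
Proof.
elim: n => [|n IHn]; first by rewrite leqn0 => /eqP ->; rewrite residue_small.
rewrite leq_eqVlt => /orP[/eqP->|]; first by rewrite residue_small.
by rewrite ltnS => lemn; rewrite -[RHS]IHn // (residueP x n) modz_ppow.
Qed.

Lemma residueE x y n : x n = y n <-> (x n = y n %[mod P n])%Z.
Proof. by rewrite !residue_small. Qed.

Section MkPadic.
Variable f : nat -> int.
Hypothesis fP : forall n, (f n.+1 = f n %[mod P n])%Z.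

Lemma mk_padic_subproof n :
  (f n %% P n)%Z = ((f n.+1 %% P n.+1)%Z %% P n)%Z.
Proof. by rewrite modz_ppow ?fP. Qed.

Definition mk_padic : Zp := PadicInt p_pr mk_padic_subproof.

Lemma mk_padicE n : mk_padic n = (f n %% P n)%Z. Proof. by []. Qed.
End MkPadic.

Lemma residue_step x n : (x n.+1 = x n %[mod P n])%Z.
Proof. by rewrite residue_mod // residue_small. Qed.

Lemma add_subproof x y n : (x n.+1 + y n.+1 = x n + y n %[mod P n])%Z.
Proof. by rewrite -modzDm !residue_step modzDm. Qed.

Lemma mul_subproof x y n : (x n.+1 * y n.+1 = x n * y n %[mod P n])%Z.
Proof. by rewrite -modzMm !residue_step modzMm. Qed.

Lemma opp_subproof x n : (- x n.+1 = - x n %[mod P n])%Z.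
Proof. by rewrite -modzNm residue_step modzNm. Qed.

Definition padic_of_int (a : int) : Zp := mk_padic (fun n => erefl (a %% P n)%Z).
Definition padic_add x y : Zp := mk_padic (add_subproof x y).
Definition padic_mul x y : Zp := mk_padic (mul_subproof x y).
Definition padic_opp x : Zp := mk_padic (opp_subproof x).

HB.instance Definition _ := gen_eqMixin Zp.
HB.instance Definition _ := gen_choiceMixin Zp.

Lemma padic_addA : associative padic_add.
Proof. by move=> x y z; apply: padicP => n /=; rewrite modzDml modzDmr addrA. Qed.

Lemma padic_addC : commutative padic_add.
Proof. by move=> x y; apply: padicP => n /=; rewrite addrC. Qed.

Lemma padic_add0 : left_id (padic_of_int 0) padic_add.
Proof. by move=> x; apply: padicP => n /=; rewrite modzDml add0r residue_small. Qed.

Lemma padic_addN : left_inverse (padic_of_int 0) padic_opp padic_add.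
Proof. by move=> x; apply: padicP => n /=; rewrite modzDml addNr. Qed.

HB.instance Definition _ := GRing.isZmodule.Build Zp
  padic_addA padic_addC padic_add0 padic_addN.

Lemma padic_mulA : associative padic_mul.
Proof. by move=> x y z; apply: padicP => n /=; rewrite modzMml modzMmr mulrA. Qed.

Lemma padic_mulC : commutative padic_mul.
Proof. by move=> x y; apply: padicP => n /=; rewrite mulrC. Qed.

Lemma padic_mul1 : left_id (padic_of_int 1) padic_mul.
Proof. by move=> x; apply: padicP => n /=; rewrite modzMml mul1r residue_small. Qed.

Lemma padic_mulDl : left_distributive padic_mul +%R.
Proof.
move=> x y z; apply: padicP => n /=.
by rewrite modzMml modzDml modzDmr mulrDl.
Qed.

Lemma padic_oner_neq0 : padic_of_int 1 != 0.
Proof.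
apply/eqP => /(congr1 (fun x : Zp => x 1%N)) /=.
rewrite mod0z expn1 modz_small //=; exact: prime_gt1.
Qed.

HB.instance Definition _ := GRing.Zmodule_isComNzRing.Build Zp
  padic_mulA padic_mulC padic_mul1 padic_mulDl padic_oner_neq0.

Definition padic_unit : {pred Zp} := [pred x | `[< exists y : Zp, y * x = 1 >]].
Definition padic_inv x : Zp := xget x [set y : Zp | y * x = 1].

Lemma padic_mulV : {in padic_unit, left_inverse 1 padic_inv *%R}.
Proof.
move=> x xu; have /asboolP[y yx1] : padic_unit x := xu.
exact: (@xgetI _ x [set y : Zp | y * x = 1] y yx1).
Qed.

Lemma padic_unitPl x y : y * x = 1 -> padic_unit x.
Proof. by move=> yx1; apply/asboolP; exists y. Qed.

Lemma padic_inv_out : {in [predC padic_unit], padic_inv =1 id}.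
Proof.
move=> x xN; have /negP xNu : ~~ padic_unit x := xN.
by apply: xgetPN => y yx1; case: xNu; apply: padic_unitPl yx1.
Qed.

HB.instance Definition _ := GRing.ComNzRing_hasMulInverse.Build Zp
  padic_mulV padic_unitPl padic_inv_out.

Lemma residueD x y n : (x + y) n = ((x n + y n) %% P n)%Z. Proof. by []. Qed.
Lemma residueM x y n : (x * y) n = ((x n * y n) %% P n)%Z. Proof. by []. Qed.
Lemma residueN x n : (- x) n = (- x n %% P n)%Z. Proof. by []. Qed.
Lemma residue0 n : (0 : Zp) n = 0. Proof. exact: mod0z. Qed.
Lemma residue1 n : (1 : Zp) n = (1 %% P n)%Z. Proof. by []. Qed.

Lemma residue_nat (m n : nat) : (m%:R : Zp) n = (m%:Z %% P n)%Z.
Proof.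
elim: m => [|m IHm]; first by rewrite residue0 mod0z.
by rewrite -addn1 natrD residueD IHm residue1 modzDml modzDmr -PoszD.
Qed.

Lemma residue_eq0 x n : (x n == 0) = (P n %| x n)%Z.
Proof. by rewrite -{1}[x n]residue_small; apply/eqP/dvdz_mod0P. Qed.

Lemma residue_dvd x m n : (m <= n)%N -> (P m %| x n)%Z = (x m == 0).
Proof. by move=> le_mn; rewrite -(residue_mod x le_mn); apply/dvdz_mod0P/eqP. Qed.

Lemma padic_neq0 x : x != 0 -> exists n, x n != 0.
Proof.
move=> x_neq0; apply: contrapT => /forallNP x0; case/eqP: x_neq0.
by apply: padicP => n; rewrite residue0; apply: contrapT => /eqP /x0.
Qed.

Lemma padic_mulf_eq0 : GRing.integral_domain_axiom Zp.
Proof.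
move=> x y /eqP; apply: contraTT; rewrite negb_or.
move=> /andP[/padic_neq0[m xm] /padic_neq0[n yn]].
apply/negP => /eqP /(congr1 (fun z : Zp => z (m + n)%N)).
rewrite residueM residue0 => /dvdz_mod0P.
move: xm yn; rewrite -(residue_dvd x (leq_addr n m)) -(residue_dvd y (leq_addl m n)).
move: (x _) (y _) => a b; rewrite !dvdzE !absz_nat abszM.
case: (posnP `|a|%N) => [->|a0]; first by rewrite dvdn0.
case: (posnP `|b|%N) => [->|b0]; first by rewrite dvdn0.
rewrite !pfactor_dvdn ?muln_gt0 ?a0 // lognM // -!ltnNge => am bn.
by rewrite leqNgt -addnS leq_add // ltnW.
Qed.

HB.instance Definition _ :=
  GRing.ComUnitRing_isIntegral.Build Zp padic_mulf_eq0.

Lemma padic_one1 : (1 : Zp) 1%N != 0.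
Proof. by rewrite residue1 expn1 modz_small // ltz_nat prime_gt1. Qed.

Lemma padic_dvdP x k : x k = 0 -> exists y, x = p%:R ^+ k * y.
Proof.
move=> xk0; have dvd_x n : (P k %| x (n + k)%N)%Z.
  by rewrite residue_dvd ?leq_addl // xk0.
pose f n := (x (n + k)%N %/ P k)%Z.
have fE n : x (n + k)%N = f n * P k by rewrite /f divzK.
have fP n : (f n.+1 = f n %[mod P n])%Z.
  apply/eqP; rewrite eqz_mod_dvd -(@dvdz_mul2r (P k)) ?ppow_neq0 //.
  by rewrite mulrBl -!fE -ppowD -eqz_mod_dvd; apply/eqP/residue_step.
exists (mk_padic fP); apply: padicP => n.
have le_n : (n <= n + k)%N by apply: leq_addr.
rewrite residueM -natrX residue_nat modzMmr modzMml.
by rewrite -(residue_mod x le_n) fE mulrC.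
Qed.

Lemma padic_unitE x : (x \is a GRing.unit) = (x 1%N != 0).
Proof.
apply/unitrPr/idP => [[y xy1]|x1].
  apply/eqP => x1; have := congr1 (fun z : Zp => z 1%N) xy1.
  by move/eqP; rewrite residueM x1 mul0r mod0z eq_sym (negPf padic_one1).
have inv n : exists w, (x n * w = 1 %[mod P n])%Z.
  have [u [v Duv]] := Bezoutz (x n) (P n); exists u.
  suff -> : 1 = u * x n + v * P n by rewrite addrC modzMDl mulrC.
  rewrite Duv; apply/esym/eqP; rewrite -[_ == 1]/(coprimez (x n) (P n)).
  case: n {u v Duv} => [|n]; first by rewrite expn0 /coprimez gcdz1.
  rewrite coprimezE absz_nat coprime_pexpr // coprime_sym prime_coprime //.
  move: x1; rewrite -(residue_dvd x (ltn0Sn n)) dvdzE absz_nat expn1.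
  by [].
have [w wP] := choice inv.
have wS n : (w n.+1 = w n %[mod P n])%Z.
  have e1 : (x n * w n.+1 = 1 %[mod P n])%Z.
    rewrite -modzMml -residue_step modzMml.
    by rewrite -(modz_ppow _ (leqnSn n)) wP modz_ppow.
  rewrite -[w n.+1]mul1r -modzMml -(wP n) modzMml mulrAC -modzMml e1 modzMml.
  by rewrite mul1r.
exists (mk_padic wS); apply: padicP => n.
by rewrite residueM /= modzMmr wP.
Qed.

Lemma padic_factor x : x != 0 ->
  exists k (u : Zp), u \is a GRing.unit /\ x = p%:R ^+ k * u.
Proof.
move=> /padic_neq0 ex; case: (ex_minnP ex) => -[|k].
  by rewrite -(residue_small x) expn0 modz1.
move=> xk min; have xk0 : x k = 0.
  by apply: contrapT => /eqP /min; rewrite ltnn.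
have [u xE] := padic_dvdP xk0; exists k, u; split=> //.
rewrite padic_unitE; apply: contraNN xk => /eqP u1.
have [v uE] := padic_dvdP u1.
by rewrite xE uE mulrA -exprSr residueM -natrX residue_nat modzz mul0r mod0z.
Qed.

Definition padic_red x : 'F_p := (x 1%N)%:~R.

Lemma intr_modp (a : int) : ((a %% P 1)%Z)%:~R = a%:~R :> 'F_p.
Proof.
have := divz_eq a (P 1); move: (_ %/ _)%Z (_ %% _)%Z => q r ->.
by rewrite intrD intrM expn1 -[p%:~R]/(p%:R) (pcharf0 (pchar_Fp p_pr)) mulr0 add0r.
Qed.

Lemma padic_red_is_zmod_morphism : zmod_morphism padic_red.
Proof.
move=> x y; rewrite /padic_red residueD residueN modzDmr intr_modp.
by rewrite intrB.
Qed.

Lemma padic_red_is_monoid_morphism : monoid_morphism padic_red.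
Proof.
split=> [|x y]; first by rewrite /padic_red residue1 intr_modp.
by rewrite /padic_red residueM intr_modp intrM.
Qed.

HB.instance Definition _ := GRing.isZmodMorphism.Build Zp 'F_p padic_red
  padic_red_is_zmod_morphism.
HB.instance Definition _ := GRing.isMonoidMorphism.Build Zp 'F_p padic_red
  padic_red_is_monoid_morphism.

Lemma dvdz_expp (a b : int) n :
  (P n.+1 %| a - b)%Z -> (P n.+2 %| a ^+ p - b ^+ p)%Z.
Proof.
move=> ab; rewrite subrXX -addn1 ppowD expn1 dvdz_mul //.
have eab : a%:~R = b%:~R :> 'F_p.
  apply/eqP; rewrite -subr_eq0 -intrB -(dvdz_pcharf (pchar_Fp p_pr)).
  by rewrite -[p]expn1 (dvdz_trans _ ab) // dvdz_ppow.
rewrite (dvdz_pcharf (pchar_Fp p_pr)) rmorph_sum /=.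
under eq_bigr => i _ do rewrite rmorphM !rmorphXn /= eab -exprD.
rewrite (eq_bigr (fun=> (b%:~R : 'F_p) ^+ p.-1)) => [|i _]; last first.
  by rewrite subnK // -ltnS prednK ?prime_gt0.
by rewrite sumr_const card_ord -mulr_natr (pcharf0 (pchar_Fp p_pr)) mulr0.
Qed.

Lemma teich_subproof (l n : nat) :
  (l%:Z ^+ (p ^ n.+1) = l%:Z ^+ (p ^ n) %[mod P n])%Z.
Proof.
apply/eqP; rewrite eqz_mod_dvd.
apply: (dvdz_trans (dvdz_ppow (leqnSn n))).
elim: n => [|n IHn]; last first.
  by have := dvdz_expp IHn; rewrite -!exprM -!expnSr.
rewrite expn0 expr1 !expn1 -eqz_mod_dvd -!natz -natrX !natz !modz_nat.
by rewrite fermat_little.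
Qed.

(* The limit of the l ^ (p ^ n), for l any integer above the given class. *)
Definition teichmuller (l : 'F_p) : Zp := mk_padic (teich_subproof l).

End PadicIntegers.

Notation padic p_pr := {fraction (padic_int p_pr)}.
Notation "x %:F" := (@FracField.tofrac _ x) : ring_scope.

Lemma padic_bounded (p : nat) (p_pr : prime p) (a : padic p_pr) :
  exists m (z : padic_int p_pr), p%:R ^+ m * a = z%:F.
Proof.
have [x [y [y0 ->]]] : exists x y : padic_int p_pr, y != 0 /\ a = x%:F / y%:F.
  elim/quotW: a => r; exists (\n_r), (\d_r); rewrite denom_ratioP; split=> //.
  have dF0 : (\d_r)%:F != 0 :> padic p_pr by rewrite tofrac_eq0 denom_ratioP.
  apply: (canRL (mulfK dF0)).
  unlock FracField.tofrac; rewrite -[LHS]FracField.pi_mul.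
  apply/eqmodP; rewrite /= FracField.equivfE /FracField.mulf.
  by rewrite !numden_Ratio ?mulf_neq0 ?denom_ratioP ?oner_eq0 // !mulr1 mulrC.
have [k [u [uU yE]]] := padic_factor y0.
exists k, (x / u); apply: (@mulIf _ (y%:F)); first by rewrite tofrac_eq0.
rewrite mulrA mulfVK ?tofrac_eq0 // yE -tofracM.
by rewrite [_ * u]mulrC mulrA mulrVK // tofracM tofracXn rmorph_nat mulrC.
Qed.


Definition GL2 (R : comUnitRingType) := {A : 'M[R]_2 | A \in unitmx}.

Section GL2Group.
Variable R : comUnitRingType.
Implicit Types g h : GL2 R.

HB.instance Definition _ := SubChoice.on (GL2 R).

Lemma GL2_mul_subproof g h : val g *m val h \in unitmx.
Proof. by rewrite unitmx_mul (valP g) (valP h). Qed.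

Lemma GL2_inv_subproof g : invmx (val g) \in unitmx.
Proof. by rewrite unitmx_inv (valP g). Qed.

Definition GL2_one : GL2 R := exist _ 1%:M (unitmx1 _ _).
Definition GL2_mul g h : GL2 R := exist _ (val g *m val h) (GL2_mul_subproof g h).
Definition GL2_inv g : GL2 R := exist _ (invmx (val g)) (GL2_inv_subproof g).

Lemma GL2_mulA : associative GL2_mul.
Proof. by move=> f g h; apply: val_inj; rewrite /= mulmxA. Qed.
Lemma GL2_mul1 : left_id GL2_one GL2_mul.
Proof. by move=> g; apply: val_inj; rewrite /= mul1mx. Qed.
Lemma GL2_1mul : right_id GL2_one GL2_mul.
Proof. by move=> g; apply: val_inj; rewrite /= mulmx1. Qed.
Lemma GL2_mulV : left_inverse GL2_one GL2_inv GL2_mul.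
Proof. by move=> g; apply: val_inj; rewrite /= mulVmx ?(valP g). Qed.
Lemma GL2_Vmul : right_inverse GL2_one GL2_inv GL2_mul.
Proof. by move=> g; apply: val_inj; rewrite /= mulmxV ?(valP g). Qed.

HB.instance Definition _ := isGroup.Build (GL2 R)
  GL2_mulA GL2_mul1 GL2_1mul GL2_mulV GL2_Vmul.

Lemma GL2_valM g h : val (g * h)%g = val g *m val h. Proof. by []. Qed.

Definition mx2 (a b c d : R) : 'M[R]_2 :=
  \matrix_(i, j) if i == 0 then (if j == 0 then a else b)
                 else (if j == 0 then c else d).

Lemma det_mx2 a b c d : \det (mx2 a b c d) = a * d - b * c.
Proof. rewrite (expand_det_row _ ord0) !big_ord_recl big_ord0 /cofactor !det_mx11 !mxE /=.
by rewrite expr0 expr1 mul1r mulN1r mulrN addr0. Qed.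

(* The matrix with rows (a, b) and (c, d); it is meant for a * d - b * c     *)
(* invertible, and is 1 otherwise.                                           *)
Definition gl2 (a b c d : R) : GL2 R := insubd (1%g : GL2 R) (mx2 a b c d).

Lemma val_gl2 a b c d :
  a * d - b * c \is a GRing.unit -> val (gl2 a b c d) = mx2 a b c d.
Proof. by move=> u; rewrite insubdK // -topredE /= unitmxE det_mx2. Qed.

End GL2Group.

Lemma GL2_map_subproof (R S : comUnitRingType) (f : {rmorphism R -> S})
  (g : GL2 R) : map_mx f (val g) \in unitmx.
Proof.
by have := valP g; rewrite !unitmxE det_map_mx; apply: rmorph_unit.
Qed.

Definition GL2_map (R S : comUnitRingType) (f : {rmorphism R -> S})
  (g : GL2 R) : GL2 S := exist _ (map_mx f (val g)) (GL2_map_subproof f g).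

Section PadicGroup.
Variables (p : nat) (p_pr : prime p).
Local Notation Zp := (padic_int p_pr).
Local Notation Qp := (padic p_pr).
Local Notation G := (GL2 Qp).
Implicit Types (g h : G) (U : set G).

(* The topology of GL_2(Q_p) induced by the p-adic topology on matrices.    *)
Definition padic_near n g : set G :=
  [set h | exists X : 'M[Zp]_2,
    val h = val g + p%:R ^+ n *: map_mx (@FracField.tofrac _) X].

Definition padic_open : set (set G) :=
  [set U | forall g, U g -> exists n, padic_near n g `<=` U].

Lemma padic_near_le m n g : (m <= n)%N -> padic_near n g `<=` padic_near m g.
Proof.
move=> /subnKC <- h [X hE]; exists (p%:R ^+ (n - m) *: X).
by rewrite hE map_mxZ rmorphXn rmorph_nat scalerA -exprD.
Qed.

Lemma padic_near_refl n g : padic_near n g g.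
Proof. by exists 0; rewrite map_mx0 scaler0 addr0. Qed.

Lemma padic_near_trans n g h i :
  padic_near n g h -> padic_near n h i -> padic_near n g i.
Proof.
by move=> [X hE] [Y iE]; exists (X + Y); rewrite iE hE map_mxD scalerDr addrA.
Qed.

Lemma padic_openT : padic_open setT.
Proof. by move=> g _; exists 0%N. Qed.

Lemma padic_openI : setI_closed padic_open.
Proof.
move=> U V Uo Vo g [/Uo[m mU] /Vo[n nV]]; exists (maxn m n) => h gh.
split; [apply: mU|apply: nV]; apply: padic_near_le gh.
  exact: leq_maxl.
exact: leq_maxr.
Qed.

Lemma padic_open_bigU (I : Type) (F : I -> set G) :
  (forall i, padic_open (F i)) -> padic_open (\bigcup_i F i).
Proof.
move=> Fo g [i _ /Fo[n nF]]; exists n => h /nF Fh; by exists i.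
Qed.

HB.instance Definition _ := isOpenTopological.Build G
  padic_openT padic_openI padic_open_bigU.

Lemma padic_near_open n g : open (padic_near n g).
Proof. by move=> h gh; exists n => i; apply: padic_near_trans. Qed.

Lemma padic_nbhsP g U : nbhs g U <-> exists n, padic_near n g `<=` U.
Proof.
split=> [[V [Vo Vg VU]]|[n nU]].
  by have [n nV] := Vo g Vg; exists n => h /nV /VU.
exists (padic_near n g); split=> //; first exact: padic_near_open.
exact: padic_near_refl.
Qed.

Lemma GL2_bounded g :
  exists m (X : 'M[Zp]_2), p%:R ^+ m *: val g = map_mx (@FracField.tofrac _) X.
Proof.
pose Q (ij : 'I_2 * 'I_2) m :=
  exists z : Zp, p%:R ^+ m * val g ij.1 ij.2 = z%:F.
have QS ij m n : (m <= n)%N -> Q ij m -> Q ij n.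
  move=> /subnKC <- [z zE]; exists (p%:R ^+ (n - m) * z).
  by rewrite addnC exprD -mulrA zE tofracM tofracXn rmorph_nat.
have Qex ij : exists m, Q ij m by apply: padic_bounded.
have [f fP] := choice Qex.
pose m := \max_ij f ij; exists m.
have Qm ij : Q ij m by apply: QS (fP ij); apply: leq_bigmax.
have [Z ZE] := choice Qm.
exists (\matrix_(i, j) Z (i, j)); apply/matrixP => i j; rewrite !mxE.
exact: (ZE (i, j)).
Qed.

Lemma GL2_mulr_continuous h : continuous (fun g => (g * h)%g).
Proof.
move=> g U /padic_nbhsP[n nU]; apply/padic_nbhsP.
have [m [Y YE]] := GL2_bounded h; exists (n + m)%N => i [X iE].
apply: nU; exists (X *m Y).
rewrite !GL2_valM iE mulmxDl; congr (_ + _).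
by rewrite map_mxM -YE -scalemxAl -scalemxAr scalerA -exprD.
Qed.

Lemma GL2_mull_continuous h : continuous (fun g => (h * g)%g).
Proof.
move=> g U /padic_nbhsP[n nU]; apply/padic_nbhsP.
have [m [Y YE]] := GL2_bounded h; exists (n + m)%N => i [X iE].
apply: nU; exists (Y *m X).
rewrite !GL2_valM iE mulmxDr; congr (_ + _).
by rewrite map_mxM -YE -scalemxAl -scalemxAr scalerA -exprD.
Qed.

End PadicGroup.


Record representation (G : groupType) (k : fieldType) (V : lmodType k) :=
  Representation {
    rep_act :> G -> V -> V;
    rep_linear : forall g, linear (rep_act g);
    rep_act1 : forall v, rep_act 1%g v = v;
    rep_actM : forall g h v, rep_act (g * h)%g v = rep_act g (rep_act h v) }.

Record rep_hom (G : groupType) (k : fieldType) (V W : lmodType k)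
    (rho : representation G V) (sigma : representation G W) := RepHom {
  rep_hom_fun :> {linear V -> W};
  rep_homP : forall g v, rep_hom_fun (rho g v) = sigma g (rep_hom_fun v) }.

Definition rep_isomorphic (G : groupType) (k : fieldType) (V W : lmodType k)
    (rho : representation G V) (sigma : representation G W) : Prop :=
  exists f : rep_hom rho sigma, bijective f.

Section LinearAct.
Variables (G : groupType) (k : fieldType) (V : lmodType k).
Variable rho : representation G V.

HB.instance Definition _ g :=
  GRing.isLinear.Build k V V *:%R (rho g) (rep_linear rho g).

End LinearAct.

Section RepSum.
Variables (G : groupType) (k : fieldType) (V W : lmodType k).
Variables (rho : representation G V) (sigma : representation G W).

Definition rep_sum_act (g : G) (vw : V * W) : V * W :=
  (rho g vw.1, sigma g vw.2).

Lemma rep_sum_linear g : linear (rep_sum_act g).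
Proof. by move=> a u v; rewrite /rep_sum_act /= !linearP. Qed.
Lemma rep_sum1 v : rep_sum_act 1%g v = v.
Proof. by case: v => v w; rewrite /rep_sum_act /= !rep_act1. Qed.
Lemma rep_sumM g h v : rep_sum_act (g * h)%g v = rep_sum_act g (rep_sum_act h v).
Proof. by rewrite /rep_sum_act /= !rep_actM. Qed.

Definition rep_sum : representation G (V * W)%type :=
  Representation rep_sum_linear rep_sum1 rep_sumM.
End RepSum.


Section Cokernel.
Variables (k : fieldType) (V W : lmodType k).

Definition linear_image (T : {linear V -> W}) : {pred W} :=
  [pred w | `[< exists v, w = T v >]].

Lemma linear_imageP (T : {linear V -> W}) w : reflect (exists v, w = T v) (w \in linear_image T).
Proof. exact: asboolP. Qed.

Lemma linear_image_submod (T : {linear V -> W}) : submod_closed (linear_image T).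
Proof.
split; first by apply/linear_imageP; exists 0; rewrite linear0.
move=> a _ _ /linear_imageP[u ->] /linear_imageP[v ->].
by apply/linear_imageP; exists (a *: u + v); rewrite linearP.
Qed.

HB.instance Definition _ T := GRing.isSubmodClosed.Build k W (linear_image T)
  (linear_image_submod T).

Variable T : {linear V -> W}.

Local Notation quot := (ring_quotient.Quotient.quot (linear_image T)).

(* The library only provides the additive group structure on this quotient. *)
Definition coker : Type := quot.
HB.instance Definition _ := GRing.Zmodule.on coker.

Definition coker_proj (w : W) : coker := \pi_quot%qT w.
Definition coker_repr (x : coker) : W := repr (x : quot).

Lemma coker_reprK : cancel coker_repr coker_proj.
Proof. by move=> x; apply: reprK. Qed.

Lemma coker_projP u v : coker_proj u = coker_proj v <-> exists w, u - v = T w.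
Proof.
have E : (u - v \in linear_image T) = (coker_proj u == coker_proj v).
  exact: ring_quotient.Quotient.idealrBE.
split=> [/eqP|/linear_imageP]; first by rewrite -E => /linear_imageP.
by rewrite E => /eqP.
Qed.

Lemma coker_proj_surj x : exists w, x = coker_proj w.
Proof. by exists (coker_repr x); rewrite coker_reprK. Qed.

Lemma coker_projD u v : coker_proj (u + v) = coker_proj u + coker_proj v.
Proof. exact: ring_quotient.Quotient.pi_add. Qed.

Definition coker_scale (a : k) (x : coker) : coker :=
  coker_proj (a *: coker_repr x).

Lemma coker_scaleE a w : coker_scale a (coker_proj w) = coker_proj (a *: w).
Proof.
apply/coker_projP.
have /coker_projP[v vE] := coker_reprK (coker_proj w).
by exists (a *: v); rewrite -scalerBr vE [RHS]linearZ.
Qed.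

Lemma coker_scaleA a b x :
  coker_scale a (coker_scale b x) = coker_scale (a * b) x.
Proof. by have [w ->] := coker_proj_surj x; rewrite !coker_scaleE scalerA. Qed.
Lemma coker_scale1 : left_id 1 coker_scale.
Proof.
by move=> x; have [w ->] := coker_proj_surj x; rewrite coker_scaleE scale1r.
Qed.
Lemma coker_scaleDr : right_distributive coker_scale +%R.
Proof.
move=> a x y; have [u ->] := coker_proj_surj x.
have [v ->] := coker_proj_surj y.
by rewrite -coker_projD !coker_scaleE -coker_projD scalerDr.
Qed.
Lemma coker_scaleDl x : {morph coker_scale^~ x : a b / a + b}.
Proof.
move=> a b; have [u ->] := coker_proj_surj x.
by rewrite !coker_scaleE -coker_projD scalerDl.
Qed.

HB.instance Definition _ := GRing.Zmodule_isLmodule.Build k coker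
  coker_scaleA coker_scale1 coker_scaleDr coker_scaleDl.

Lemma coker_proj_linear : linear coker_proj.
Proof. by move=> a u v; rewrite coker_projD -coker_scaleE. Qed.

HB.instance Definition _ :=
  GRing.isLinear.Build k W coker *:%R coker_proj coker_proj_linear.

End Cokernel.

Section CokernelRep.
Variables (G : groupType) (k : fieldType) (V W : lmodType k).
Variables (rho : representation G V) (sigma : representation G W).
Variable T : rep_hom rho sigma.

Definition coker_act (g : G) (x : coker T) : coker T :=
  coker_proj T (sigma g (coker_repr x)).

Lemma coker_actE g w : coker_act g (coker_proj T w) = coker_proj T (sigma g w).
Proof.
apply/coker_projP.
have /coker_projP[v vE] := coker_reprK (coker_proj T w).
by exists (rho g v); rewrite rep_homP -vE linearB.
Qed.

Lemma coker_act_linear g : linear (coker_act g).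
Proof.
move=> a x y; have [u ->] := coker_proj_surj x.
have [v ->] := coker_proj_surj y.
by rewrite -linearP !coker_actE -linearP -linearP.
Qed.
Lemma coker_act1 x : coker_act 1%g x = x.
Proof. by have [u ->] := coker_proj_surj x; rewrite coker_actE rep_act1. Qed.
Lemma coker_actM g h x : coker_act (g * h)%g x = coker_act g (coker_act h x).
Proof. by have [u ->] := coker_proj_surj x; rewrite !coker_actE rep_actM. Qed.

Definition coker_rep : representation G (coker T) :=
  Representation coker_act_linear coker_act1 coker_actM.
End CokernelRep.


Section Sym.
Variables (k : fieldType) (r : nat).
Local Notation Sym := (dhomog 2 k r).

(* ('X_0, 'X_1) = (x, y), so for A = [[a, b], [c, d]] this is               *)
(* (a x + c y, b x + d y).                                                  *)
Definition lin_subst (A : 'M[k]_2) : 2.-tuple {mpoly k[2]} :=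
  [tuple \sum_i A i j *: 'X_i | j < 2].

Lemma lin_subst_homog A i : tnth (lin_subst A) i \is 1.-homog.
Proof.
rewrite tnth_mktuple rpred_sum // => j _; rewrite rpredZ //.
by rewrite dhomogX /= mdeg1.
Qed.

Lemma sym_act_homog A (P : Sym) :
  (mpoly_of_dhomog P \mPo lin_subst A) \is r.-homog.
Proof.
rewrite comp_mpolyE big_seq rpred_sum // => m mP; rewrite rpredZ //.
have <- : mdeg m = r by apply: (dhomog_mf (dhomog_is_dhomog P)).
rewrite mdegE !big_ord_recl !big_ord0.
have hom i : tnth (lin_subst A) i ^+ m i \is (m i).-homog.
  by rewrite -[X in X.-homog]mul1n; apply: dhomogMn; apply: lin_subst_homog.
by rewrite mulr1 addn0; apply: dhomogM; apply: hom.
Qed.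

Definition sym_act (g : GL2 k) (P : Sym) : Sym :=
  DHomog (sym_act_homog (val g) P).

Lemma sym_act_linear g : linear (sym_act g).
Proof. by move=> a P Q; apply: val_inj; rewrite /= comp_mpolyD comp_mpolyZ. Qed.

Lemma sym_act1 P : sym_act 1%g P = P.
Proof.
apply: val_inj => /=; rewrite -[RHS]comp_mpoly_id; congr (_ \mPo _).
apply: eq_from_tnth => j; rewrite !tnth_mktuple (bigD1 j) //= mxE eqxx scale1r.
rewrite big1 ?addr0 // => i ij; by rewrite mxE (negPf ij) scale0r.
Qed.

Lemma comp_lin_subst (A B : 'M[k]_2) (P : {mpoly k[2]}) :
  (P \mPo lin_subst B) \mPo lin_subst A = P \mPo lin_subst (A *m B).
Proof.
rewrite (comp_mpolyEX P (lin_subst B)) (comp_mpolyEX P (lin_subst (A *m B))).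
rewrite raddf_sum /=; apply: eq_bigr => m _.
rewrite !comp_mpolyZ !comp_mpolyX; congr (_ *: _).
rewrite rmorph_prod /=.
apply: eq_bigr => j _; rewrite rmorphXn /= !tnth_mktuple raddf_sum /=.
congr (_ ^+ _); under eq_bigr => i _.
  rewrite comp_mpolyZ comp_mpolyXU -tnth_nth tnth_mktuple scaler_sumr. over.
rewrite exchange_big /=; apply: eq_bigr => l _; rewrite mxE scaler_suml.
by apply: eq_bigr => i _; rewrite scalerA mulrC.
Qed.

Lemma sym_actM g h P : sym_act (g * h)%g P = sym_act g (sym_act h P).
Proof. by apply: val_inj; rewrite /= comp_lin_subst. Qed.

Definition sym_rep : representation (GL2 k) Sym :=
  Representation sym_act_linear sym_act1 sym_actM.

Lemma sym_xr_homog : ('X_ord0 ^+ r : {mpoly k[2]}) \is r.-homog.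
Proof.
by rewrite -[X in X.-homog]mul1n; apply: dhomogMn; rewrite dhomogX /= mdeg1.
Qed.

Definition sym_xr : Sym := DHomog sym_xr_homog.

End Sym.


Record smooth_character (p : nat) (p_pr : prime p) (k : fieldType) :=
  SmoothCharacter {
    char_fun :> padic p_pr -> k;
    char1 : char_fun 1 = 1;
    charM : forall a b, a != 0 -> b != 0 ->
      char_fun (a * b) = char_fun a * char_fun b;
    char_smooth : exists n, forall x : padic_int p_pr,
      char_fun (1 + p%:R ^+ n.+1 * x%:F) = 1 }.

Section DetTwist.
Variables (p : nat) (p_pr : prime p) (k : fieldType) (V : lmodType k).
Local Notation G := (GL2 (padic p_pr)).
Variables (rho : representation G V) (eta : smooth_character p_pr k).

Definition det_twist_act (g : G) (v : V) : V := eta (\det (val g)) *: rho g v.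

Lemma det_twist_linear g : linear (det_twist_act g).
Proof.
by move=> a u v; rewrite /det_twist_act linearP scalerDr !scalerA mulrC.
Qed.
Lemma det_twist1 v : det_twist_act 1%g v = v.
Proof. by rewrite /det_twist_act det1 char1 scale1r rep_act1. Qed.
Lemma det_twistM g h v :
  det_twist_act (g * h)%g v = det_twist_act g (det_twist_act h v).
Proof.
have det_neq0 (i : G) : \det (val i) != 0.
  by have := valP i; rewrite unitmxE unitfE.
rewrite /det_twist_act GL2_valM det_mulmx charM ?det_neq0 // rep_actM.
by rewrite linearZ scalerA.
Qed.

Definition det_twist : representation G V :=
  Representation det_twist_linear det_twist1 det_twistM.
End DetTwist.


Section SpecialMatrices.
Variables (p : nat) (p_pr : prime p).
Local Notation Zp := (padic_int p_pr).
Local Notation Qp := (padic p_pr).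
Local Notation G := (GL2 Qp).

Definition mx_t : G := gl2 p%:R 0 0 1.
Definition mx_Pi : G := gl2 0 1 p%:R 0.
Definition mx_unip (b : Zp) : G := gl2 1 b%:F 0 1.
Definition mx_ppow (n : int) : G := gl2 (p%:R ^ n) 0 0 (p%:R ^ n).

Lemma padic_p_neq0 : p%:R != 0 :> Qp.
Proof.
rewrite -(rmorph_nat (@FracField.tofrac _)) tofrac_eq0.
apply/eqP => /(congr1 (fun x : Zp => x 2%N)); rewrite residue_nat residue0.
rewrite modz_small ?lez_nat ?ltz_nat //=; last first.
  by rewrite -{1}[p]expn1 ltn_exp2l ?prime_gt1.
by move=> [p0]; move: p_pr; rewrite p0.
Qed.

Lemma val_mx_t : val mx_t = mx2 p%:R 0 0 1.
Proof. by rewrite val_gl2 // mulr1 mulr0 subr0 unitfE padic_p_neq0. Qed.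

Lemma val_mx_Pi : val mx_Pi = mx2 0 1 p%:R 0.
Proof. by rewrite val_gl2 // mulr0 mul1r sub0r unitrN unitfE padic_p_neq0. Qed.

Lemma val_mx_unip b : val (mx_unip b) = mx2 1 b%:F 0 1.
Proof. by rewrite val_gl2 // mulr1 mulr0 subr0 unitr1. Qed.

Lemma val_mx_ppow n : val (mx_ppow n) = mx2 (p%:R ^ n) 0 0 (p%:R ^ n).
Proof.
by rewrite val_gl2 // mulr0 subr0 unitfE mulf_neq0 // expfz_neq0 // padic_p_neq0.
Qed.

End SpecialMatrices.

Section CompactInduction.
Variables (p : nat) (p_pr : prime p) (k : fieldType).
Variables (iota : {rmorphism 'F_p -> k}) (r : nat).
Local Notation Zp := (padic_int p_pr).
Local Notation G := (GL2 (padic p_pr)).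
Local Notation Sym := (dhomog 2 k r).

Definition GL2_Zp_incl : GL2 Zp -> G := GL2_map (@FracField.tofrac _).
Definition GL2_Zp_red : GL2 Zp -> GL2 k := GL2_map (iota \o @padic_red p p_pr).

Definition GL2_center : set G := [set z | forall g : G, (z * g = g * z)%g].

Definition KZ : set G :=
  [set g | exists (A : GL2 Zp) z, GL2_center z /\ g = (GL2_Zp_incl A * z)%g].

(* As Z = p^Z * Z_p^*, the elements of KZ are the p^n A with n in Z and A in *)
(* K; such an element acts on Sym^r through the reduction of A.             *)
Definition KZ_equivariant (f : G -> Sym) : Prop :=
  forall (n : int) (A : GL2 Zp) (g : G),
    f (mx_ppow p_pr n * GL2_Zp_incl A * g)%g =
    sym_rep k r (GL2_Zp_red A) (f g).

Definition right_smooth (f : G -> Sym) : Prop :=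
  nbhs (1%g : G) [set u | forall g, f (g * u)%g = f g].

Definition compact_mod_center (f : G -> Sym) : Prop :=
  exists2 C : set G, compact C &
    forall g, f g != 0 -> exists c z, [/\ C c, GL2_center z & g = (z * c)%g].

Definition cInd_pred : {pred G -> Sym} :=
  [pred f : G -> Sym |
    `[< [/\ KZ_equivariant f, right_smooth f & compact_mod_center f] >]].

Lemma cInd_predP f :
  reflect [/\ KZ_equivariant f, right_smooth f & compact_mod_center f]
          (f \in cInd_pred).
Proof. exact: asboolP. Qed.

Lemma cInd_submod : submod_closed cInd_pred.
Proof.
split.
  apply/cInd_predP; split.
  - by move=> n A g; rewrite [RHS](linear0 (sym_rep k r _)).
  - by apply: filterE => u g.
  - exists set0; first exact: compact0.
    by move=> g; rewrite eqxx.
move=> a f1 f2 /cInd_predP[eq1 sm1 [C1 cp1 sup1]].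
move=> /cInd_predP[eq2 sm2 [C2 cp2 sup2]]; have fE g : (a *: f1 + f2) g = a *: f1 g + f2 g by [].
apply/cInd_predP; split.
- by move=> n A g; rewrite !fE eq1 eq2 rep_linear.
- apply: filterS (filterI sm1 sm2) => u [u1 u2] g.
  by rewrite !fE u1 u2.
- exists (C1 `|` C2); first exact: compactU.
  move=> g; rewrite fE => fg; have [f1g|f1g] := eqVneq (f1 g) 0; last first.
    by have [c [z [Cc Zz ->]]] := sup1 g f1g; exists c, z; split=> //; left.
  have f2g : f2 g != 0.
    by apply: contraNneq fg => f2g; rewrite f1g f2g scaler0 addr0.
  by have [c [z [Cc Zz ->]]] := sup2 g f2g; exists c, z; split=> //; right.
Qed.

HB.instance Definition _ :=
  GRing.isSubmodClosed.Build k (G -> Sym) cInd_pred cInd_submod.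

Record cInd := CInd { cInd_fun :> G -> Sym; _ : cInd_fun \in cInd_pred }.

HB.instance Definition _ := [isSub for cInd_fun].
HB.instance Definition _ := [Choice of cInd by <:].
HB.instance Definition _ := [SubChoice_isSubLmodule of cInd by <:].

Lemma rtrans_subproof (h : G) (f : cInd) : (fun g => f (g * h)%g) \in cInd_pred.
Proof.
have /cInd_predP[eqf smf [C cpC supf]] := valP f; apply/cInd_predP; split.
- by move=> n A g; rewrite -mulgA eqf.
- have conj1 : (h^-1 * (1 * h))%g = 1%g by rewrite mul1g mulVg.
  have S1 : nbhs (h^-1 * (1 * h))%g [set u | forall g, f (g * u)%g = f g].
    by rewrite conj1.
  have S2 := @GL2_mull_continuous p p_pr (h^-1)%g (1 * h)%g _ S1.
  have S3 := @GL2_mulr_continuous p p_pr h 1%g _ S2.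
  rewrite /right_smooth; apply: (@filterS _ (nbhs (1%g : G)) _ _ _ _ S3) => u /= uS g.
  by rewrite -(uS (g * h)%g) !mulgA mulgK.
- exists [set (c * h^-1)%g | c in C].
    apply: continuous_compact cpC; apply: continuous_subspaceT.
    exact: GL2_mulr_continuous.
  move=> g /supf[c [z [Cc Zz ghE]]]; exists (c * h^-1)%g, z; split=> //.
    by exists c.
  by rewrite mulgA -ghE mulgK.
Qed.

Definition cInd_act (h : G) (f : cInd) : cInd := CInd (rtrans_subproof h f).

Lemma cInd_act_linear h : linear (cInd_act h).
Proof. by move=> a f1 f2; apply: val_inj. Qed.
Lemma cInd_act1 f : cInd_act 1%g f = f.
Proof. by apply: val_inj; apply: funext => g /=; rewrite mulg1. Qed.
Lemma cInd_actM g h f : cInd_act (g * h)%g f = cInd_act g (cInd_act h f).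
Proof. by apply: val_inj; apply: funext => i /=; rewrite mulgA. Qed.

Definition cInd_rep : representation G cInd :=
  Representation cInd_act_linear cInd_act1 cInd_actM.

Definition is_generator (phi : cInd) : Prop :=
  [set g | phi g != 0] = KZ /\ phi 1%g = sym_xr k r.

Definition is_hecke (phi : cInd) (T : rep_hom cInd_rep cInd_rep) : Prop :=
  T phi = (if r == 0%N then cInd_rep (mx_Pi p_pr) phi else 0) +
    \sum_(l : 'F_p) cInd_rep (mx_unip (teichmuller p_pr l) * mx_t p_pr)%g phi.

Definition pi0_rep (T : rep_hom cInd_rep cInd_rep)
    (eta : smooth_character p_pr k) : representation G (coker T) :=
  det_twist (coker_rep T) eta.


End CompactInduction.

(* [phi] is determined by [is_generator], and then [T] by [is_hecke] since   *)
(* [phi] generates the compact induction.                                   *)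
Definition supersingular (p : nat) (p_pr : prime p) (k : fieldType)
    (iota : {rmorphism 'F_p -> k}) (V : lmodType k)
    (rho : representation (GL2 (padic p_pr)) V) : Prop :=
  exists r (phi : cInd p_pr iota r)
    (T : rep_hom (cInd_rep p_pr iota r) (cInd_rep p_pr iota r))
    (eta : smooth_character p_pr k),
  [/\ (r <= p.-1)%N, is_generator phi, is_hecke phi T &
      rep_isomorphic rho (pi0_rep T eta)].


Section Iwahori.
Variables (p : nat) (p_pr : prime p).
Local Notation Zp := (padic_int p_pr).
Local Notation G := (GL2 (padic p_pr)).

Definition iwahori : set G :=
  [set g | exists a b c d : Zp, [/\ a \is a GRing.unit, d \is a GRing.unit &
    val g = mx2 a%:F b%:F (p%:R * c)%:F d%:F]].

Definition pro_p_iwahori : set G :=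
  [set g | exists a b c d : Zp,
    val g = mx2 (1 + p%:R * a)%:F b%:F (p%:R * c)%:F (1 + p%:R * d)%:F].

Definition pos_monoid : set G :=
  [set g | exists (n : nat) (b : Zp), val g = mx2 (p%:R ^+ n) b%:F 0 1].

End Iwahori.

Arguments iwahori {p} p_pr _.
Arguments pro_p_iwahori {p} p_pr _.
Arguments pos_monoid {p} p_pr _.

Section SubRep.
Variables (G : groupType) (k : fieldType).
Implicit Types (U V W : lmodType k) (H : set G).

Definition rep_invariants V (rho : representation G V) H : set V :=
  [set v | forall h, H h -> rho h v = v].

Definition lin_span V (X : set V) : set V :=
  [set v | exists n (c : 'I_n -> k) (x : 'I_n -> V),
    (forall i, X (x i)) /\ v = \sum_i c i *: x i].

Definition rep_stable V (rho : representation G V) H (A : set V) : Prop :=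
  forall h v, H h -> A v -> A (rho h v).

Definition is_subrep V (rho : representation G V) H (A : set V) : Prop :=
  [/\ A 0, forall (a : k) u v, A u -> A v -> A (a *: u + v) &
      rep_stable rho H A].

Definition is_rep_morphism V W (rho : representation G V)
    (sigma : representation G W) H (A : set V) (B : set W) (f : V -> W) : Prop :=
  [/\ forall v, A v -> B (f v),
      forall (a : k) u v, A u -> A v -> f (a *: u + v) = a *: f u + f v &
      forall h v, H h -> A v -> f (rho h v) = sigma h (f v)].

(* Exactness of 0 -> A -> B -> C -> 0, where A, B and C are subspaces of the *)
(* spaces of [rho], [sigma] and [tau] stable under the subgroup [H].        *)
Definition short_exact U V W (rho : representation G U)
    (sigma : representation G V) (tau : representation G W) H
    (A : set U) (B : set V) (C : set W) (f : U -> V) (g : V -> W) : Prop :=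
  [/\ [/\ is_subrep rho H A, is_subrep sigma H B & is_subrep tau H C],
      is_rep_morphism rho sigma H A B f /\ is_rep_morphism sigma tau H B C g,
      set_inj A f,
      [set f u | u in A] = [set v | B v /\ g v = 0] &
      [set g v | v in B] = C].

End SubRep.

(* Main.v *)
From HB Require Import structures.
Require Import Defs.
From mathcomp Require Import all_boot all_order all_algebra.
From mathcomp Require Import boolp classical_sets functions mpoly topology.
From mathcomp Require Import zify ring.

Set Implicit Arguments.
Unset Strict Implicit.
Unset Printing Implicit Defensive.

Import Order.TTheory GRing.Theory Num.Theory.
Local Open Scope classical_set_scope.
Local Open Scope ring_scope.

(** A supersingular representation is a twist of the cokernel of the Hecke
    operator [T] on the compact induction of [Sym^r], and a twist changes
    neither the invariants of the pro-p Iwahori subgroup nor the span [M]. The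
    compact induction is a space of functions on the vertices of the tree of
    [GL_2(Q_p)]. Removing the edge stabilised by the Iwahori subgroup and by
    [Pi] cuts the tree into two halves exchanged by [Pi]; the half containing
    the base vertex consists of the vertices [(p^n, b; 0, 1)]. So a function is
    uniquely [a + Pi a'] with [a] and [a'] supported on that half
    ([tree_split], [half_Pi_eq0]).

    The operator [T] moves supports outwards injectively ([level_T]), and it
    leaves a half only across the removed edge, along [Pi phi], where [phi] is
    the generator ([T_half]). Cutting a relation [a - Pi a' = T f] along that
    edge shows that the images in the cokernel of the two halves meet exactly in
    the span [soc] of the classes of [phi] and [Pi phi] ([half_inter],
    [half_image_inter]). Both classes are fixed by the pro-p Iwahori subgroup,
    and the image of the half is the span of their translates by the matrices
    [(p^n, b; 0, 1)], because [(p^(n+1), b; 0, 1) Pi phi] takes the value [y^r]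
    at the vertex [(p^n, b; 0, 1)] and the unipotent translates of [y^r] span
    [Sym^r] ([span_half_image]). The half being stable under the Iwahori
    subgroup, everything follows once the invariants are known to be no larger
    than [soc].

    For this, let [u = (1, 1; 0, 1)] and let [u'] be its conjugate
    [(1, 0; p, 1)] by [Pi]. A class of the half fixed by [u] lies in [soc]
    ([fixed_half]): on the functions supported at distance [n] from the base
    vertex, [u] acts as one Jordan block, and an induction on [n] uses [T] to
    lower the support. Given an invariant [a + Pi a'], the elements
    [(u - 1) a] and [(u - 1) a'] lie in [soc] modulo [T], so [a] and [a'] are
    known up to [soc] and up to explicit preimages under [u - 1] of the two
    generators of [soc] ([second_layer_even], [second_layer_odd]). The action of
    [u'] on these preimages is computed, and invariance under [u] and [u'] is a
    linear system that kills their coefficients ([unipotent_invariants]).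

    The argument on the tree is carried out for an abstract group acting
    through the rules collected in [tree_action]; the compact induction is an
    instance of it. *)

(** * Forward differences below the characteristic *)

Section ForwardDifference.
Variables (k : fieldType) (p : nat).
Hypothesis char_p : p \in [pchar k].
Implicit Types (q h : {poly k}) (P : {poly k} -> Prop).

Lemma natr_neq0_lt_char n : (0 < n < p)%N -> n%:R != 0 :> k.
Proof.
by case/andP=> n0 np; rewrite -(dvdn_pcharf char_p) gtnNdvd.
Qed.

Lemma natr_inj_lt_char i j : (i < p)%N -> (j < p)%N -> i%:R = j%:R :> k -> i = j.
Proof.
wlog ij : i j / (i <= j)%N.
  by move=> H ip jp e; case/orP: (leq_total i j) => ij; [|apply/esym]; apply: H.
move=> ip jp /esym/eqP; rewrite -subr_eq0 -natrB // => /eqP e.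
apply/eqP; rewrite eqn_leq ij /= -subn_eq0; apply: contraTT isT => ji.
by have := @natr_neq0_lt_char (j - i)%N; rewrite e eqxx; lia.
Qed.

Definition pdiff q : {poly k} := q \Po ('X + 1) - q.

Lemma pdiff_linear : linear pdiff.
Proof.
by move=> a q h; rewrite /pdiff comp_polyD comp_polyZ scalerBr opprD addrACA.
Qed.

HB.instance Definition _ :=
  GRing.isLinear.Build k {poly k} {poly k} *:%R pdiff pdiff_linear.

Lemma horner_pdiff q z : (pdiff q).[z] = q.[z + 1] - q.[z].
Proof. by rewrite /pdiff !hornerE horner_comp !hornerE. Qed.

Lemma pdiffXn n : pdiff 'X^n = \poly_(i < n) 'C(n, i)%:R.
Proof.
rewrite /pdiff comp_Xn_poly exprD1n big_ord_recr /= binn mulr1n addrK.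
by rewrite poly_def; apply: eq_bigr => i _; rewrite scaler_nat.
Qed.

Lemma coef_pdiff q n :
  (pdiff q)`_n = \sum_(i < size q | (n < i)%N) q`_i * 'C(i, n)%:R.
Proof.
rewrite -{1}[q]coefK poly_def linear_sum coef_sum [RHS]big_mkcond /=.
apply: eq_bigr => i _; rewrite linearZ /= coefZ pdiffXn coef_poly.
by case: ifP => _ //; rewrite mulr0.
Qed.

Lemma size_pdiff q n : (size q <= n.+1)%N -> (size (pdiff q) <= n)%N.
Proof.
move=> qn; apply/leq_sizeP => j nj; rewrite coef_pdiff big1 // => i ji.
have := leq_trans (ltn_ord i) qn; rewrite ltnS => /leq_trans/(_ nj).
by rewrite leqNgt ji.
Qed.

Lemma coef_pdiff_top q n :
  (size q <= n.+2)%N -> (pdiff q)`_n = n.+1%:R * q`_n.+1.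
Proof.
move=> qn; rewrite coef_pdiff; have [qs|qs] := ltnP n.+1 (size q).
  rewrite (bigD1 (Ordinal qs)) //= binSn big1 ?addr0 1?mulrC // => i.
  rewrite -val_eqE /= => /andP[ni neq]; have := leq_trans (ltn_ord i) qn.
  by rewrite ltnS leq_eqVlt (negPf neq) ltnS leqNgt ni.
rewrite (nth_default 0 qs) mulr0 big1 // => i ni.
by have := leq_trans (ltn_ord i) qs; rewrite ltnS leqNgt ni.
Qed.

(** The leading coefficient of the difference of [X^(n+1)] is [n+1], which is
    invertible below the characteristic; this solves [pdiff q = h] one degree
    at a time. *)
Lemma pdiff_surj n h : (n < p)%N -> (size h <= n)%N ->
  exists q, (size q <= n.+1)%N /\ pdiff q = h.
Proof.
elim: n h => [|n IHn] h np hn.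
  exists 0; rewrite linear0 size_poly0; split=> //.
  by apply/esym/eqP; rewrite -size_poly_leq0.
have n1 : n.+1%:R != 0 :> k by rewrite natr_neq0_lt_char.
pose c := h`_n / n.+1%:R.
have sX : (size (c *: 'X^(n.+1) : {poly k}) <= n.+2)%N.
  by rewrite (leq_trans (size_scale_leq _ _)) // size_polyXn.
have [|q [qn qE]] := IHn (h - pdiff (c *: 'X^(n.+1))) (ltnW np).
  apply/leq_sizeP => j; rewrite leq_eqVlt => /orP[/eqP<-|nj].
    rewrite coefB (coef_pdiff_top sX) coefZ coefXn eqxx mulr1 /c.
    by rewrite mulrC mulfVK // subrr.
  rewrite coefB (leq_sizeP _ _ hn) // (leq_sizeP _ _ (size_pdiff sX)) //.
  by rewrite subr0.
exists (q + c *: 'X^(n.+1)); rewrite linearD /= qE subrK; split=> //.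
by rewrite (leq_trans (size_polyD _ _)) // geq_max sX ltnW.
Qed.

(** Iterated differences of [X^r] stay in the span of the translates and have
    every degree up to [r], because [r] is below the characteristic. *)
Lemma translates_span r P : (r < p)%N ->
    (forall a q h, P q -> P h -> P (a *: q + h)) ->
    (forall l : nat, P (('X + l%:R) ^+ r)) ->
  forall h, (size h <= r.+1)%N -> P h.
Proof.
move=> rp Plin PX.
have P0 : P 0.
  by rewrite -(addNr (('X + 0%:R) ^+ r)) -scaleN1r; apply: Plin.
have diffs j : (j <= r)%N -> exists q, size q = (r - j).+1 /\
    forall l : nat, P (q \Po ('X + l%:R)).
  elim: j => [|j IHj] jr.
    exists 'X^r; rewrite subn0 size_polyXn; split=> // l.
    by rewrite comp_Xn_poly.
  have [q [qs Pq]] := IHj (ltnW jr); exists (pdiff q); split.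
    have sq : (size q <= (r - j.+1).+2)%N by rewrite qs; lia.
    apply/eqP; rewrite eqn_leq size_pdiff //= ltnNge; apply/negP => /leq_sizeP.
    move=> /(_ _ (leqnn _))/eqP; rewrite coef_pdiff_top // mulf_eq0.
    rewrite (negPf (@natr_neq0_lt_char _ _)) /=; last by lia.
    have -> : (r - j.+1).+1 = (size q).-1 by rewrite qs; lia.
    by rewrite lead_coef_eq0 -size_poly_eq0 qs.
  move=> l; rewrite /pdiff comp_polyB -comp_polyA comp_polyD comp_polyX.
  rewrite -{2}polyC1 comp_polyC polyC1 -addrA -(natrD _ l 1) -scaleN1r.
  by rewrite [X in P X]addrC; apply: Plin.
have main n : (n <= r.+1)%N -> forall h, (size h <= n)%N -> P h.
  elim: n => [|n IHn] nr h hn.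
    by move: hn; rewrite size_poly_leq0 => /eqP ->.
  have [|q [qs /(_ 0%N)]] := diffs (r - n)%N; first by lia.
  rewrite addr0 comp_polyXr => Pq.
  have {}qs : size q = n.+1 by rewrite qs; lia.
  have qn : q`_n != 0.
    by rewrite -[n]/(n.+1.-1) -qs -/(lead_coef q) lead_coef_eq0 -size_poly_eq0 qs.
  rewrite -(subrK ((h`_n / q`_n) *: q) h) addrC; apply: Plin => //.
  apply: IHn; first exact: ltnW.
  apply/leq_sizeP => j; rewrite leq_eqVlt => /orP[/eqP<-|nj].
    by rewrite coefB coefZ divfK // subrr.
  rewrite coefB coefZ (leq_sizeP _ _ hn j) // (@nth_default _ 0 q j) ?qs //.
  by rewrite mulr0 subr0.
by move=> h hr; apply: (main r.+1).
Qed.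

Lemma eq_poly_on_nat q h : (size q <= p)%N -> (size h <= p)%N ->
  (forall l : nat, q.[l%:R] = h.[l%:R]) -> q = h.
Proof.
move=> qp hp qh; apply/eqP; rewrite -subr_eq0; apply/eqP.
apply: (@roots_geq_poly_eq0 _ _ [seq l%:R | l <- iota 0 p]).
- by apply/allP => _ /mapP[l _ ->]; rewrite /root !hornerE qh subrr.
- rewrite map_inj_in_uniq ?iota_uniq // => i j; rewrite !mem_iota !add0n /=.
  exact: natr_inj_lt_char.
- by rewrite size_map size_iota (leq_trans (size_polyD _ _)) // size_polyN geq_max qp.
Qed.

End ForwardDifference.

(** * Binary forms of degree below the characteristic *)

Section SymmetricPower.
Variables (k : fieldType) (r : nat).
Local Notation Sym := (dhomog 2 k r).
Implicit Types (u v : Sym) (h : {poly k}) (s x y : k).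

Definition heval x y u : k :=
  (mpoly_of_dhomog u).@[fun i => if i == 0 then x else y].

Lemma heval_linear x y : linear_for *%R (heval x y).
Proof. by move=> a u v; rewrite /heval linearP. Qed.

HB.instance Definition _ x y :=
  GRing.isLinear.Build k Sym k *%R (heval x y) (heval_linear x y).

Lemma heval_act x y (g : GL2 k) u :
  heval x y (sym_act g u) =
  heval (x * val g 0 0 + y * val g 1 0) (x * val g 0 1 + y * val g 1 1) u.
Proof.
rewrite /heval /= comp_mpoly_meval; apply: meval_eq => j.
rewrite tnth_mktuple raddf_sum /= !big_ord_recl big_ord0 !mevalZ !mevalXU /=.
have -> : lift ord0 ord0 = 1 :> 'I_2 by apply: val_inj.
case: j => -[|[|//]] j2 /=; rewrite addr0 mulrC [_ * y]mulrC;
  by congr (_ * val g _ _ + _ * val g _ _); apply: val_inj.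
Qed.

Lemma heval_xr x y : heval x y (sym_xr k r) = x ^+ r.
Proof. by rewrite /heval /= rmorphXn /= mevalXU. Qed.

Definition sym_mnm (i : nat) : 'X_{1..2} :=
  [multinom if j == ord0 then (r - i)%N else i | j < 2].

Lemma mdeg_sym_mnm i : (i <= r)%N -> mdeg (sym_mnm i) = r.
Proof.
by move=> ir; rewrite mdegE !big_ord_recl big_ord0 !mnmE /= addn0 subnK.
Qed.

(** Homogenisation in degree [r], with [x] as the new variable; the
    coefficients beyond degree [r] are dropped. *)
Definition hsym h : Sym :=
  indhomog r (\sum_(i < r.+1) h`_i *: 'X_[sym_mnm i]).

Lemma val_hsym h :
  mpoly_of_dhomog (hsym h) = \sum_(i < r.+1) h`_i *: 'X_[sym_mnm i].
Proof.
rewrite /hsym /indhomog insubdK // rpred_sum // => i _; rewrite rpredZ //.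
by rewrite dhomogX /= mdeg_sym_mnm // -ltnS.
Qed.

Lemma heval_hsym x y h :
  heval x y (hsym h) = \sum_(i < r.+1) h`_i * (x ^+ (r - i) * y ^+ i).
Proof.
rewrite /heval val_hsym raddf_sum /=; apply: eq_bigr => i _.
by rewrite mevalZ mevalX !big_ord_recl big_ord0 !mnmE /= mulr1.
Qed.

Lemma heval1_hsym z h : (size h <= r.+1)%N -> heval 1 z (hsym h) = h.[z].
Proof.
move=> hr; rewrite heval_hsym (horner_coef_wide _ hr).
by apply: eq_bigr => i _; rewrite expr1n mul1r.
Qed.

Lemma heval01_hsym h : heval 0 1 (hsym h) = h`_r.
Proof.
rewrite heval_hsym big_ord_recr /= subnn expr1n !mulr1 big1 ?add0r // => i _.
by rewrite expr0n subn_eq0 leqNgt ltn_ord mul0r mulr0.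
Qed.

Definition dehom u : {poly k} := \poly_(i < r.+1) (mpoly_of_dhomog u)@_(sym_mnm i).

Lemma dehomK : cancel dehom hsym.
Proof.
move=> u; apply: val_inj => /=; rewrite val_hsym; apply/mpolyP => m.
rewrite raddf_sum /=.
under eq_bigr => i _ do rewrite mcoeffZ mcoeffX coef_poly ltn_ord.
have [mr|mr] := eqVneq (mdeg m) r; last first.
  rewrite (dhomog_nemf_coeff (dhomog_is_dhomog u) mr) big1 // => i _.
  case: eqP => [im|_]; last by rewrite mulr0.
  by move: mr; rewrite -im mdeg_sym_mnm ?eqxx // -ltnS.
have mE : m = sym_mnm (m 1).
  apply/mnmP => j; move: mr; rewrite mdegE !big_ord_recl big_ord0 mnmE addn0.
  have -> : lift ord0 ord0 = 1 :> 'I_2 by apply: val_inj.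
  case: j => -[|[|//]] j2 /= => [<-|_]; last by congr (m _); apply: val_inj.
  by rewrite addnK; congr (m _); apply: val_inj.
have m1r : (m 1%R < r.+1)%N.
  rewrite ltnS -mr mdegE (bigD1 (1 : 'I_2)) //=; exact: leq_addr.
rewrite (bigD1 (Ordinal m1r)) //= -mE eqxx mulr1 big1 ?addr0 // => i.
rewrite -val_eqE /= => im; case: eqP => [e|_]; last by rewrite mulr0.
by move: im; rewrite -e mnmE /= eqxx.
Qed.

Lemma size_dehom u : (size (dehom u) <= r.+1)%N. Proof. exact: size_poly. Qed.

Lemma heval1E z u : heval 1 z u = (dehom u).[z].
Proof. by rewrite -{1}[u]dehomK heval1_hsym // size_dehom. Qed.

Lemma heval01E u : heval 0 1 u = (dehom u)`_r.
Proof. by rewrite -{1}[u]dehomK heval01_hsym. Qed.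

HB.instance Definition _ (g : GL2 k) :=
  GRing.isLinear.Build k Sym Sym *:%R (sym_act g) (sym_act_linear g).

Definition unip s : GL2 k := gl2 1 s 0 1.

Lemma val_unip s : val (unip s) = mx2 1 s 0 1.
Proof. by rewrite val_gl2 // mulr1 mulr0 subr0 unitr1. Qed.

Lemma heval_unip x y s u : heval x y (sym_act (unip s) u) = heval x (x * s + y) u.
Proof. by rewrite heval_act val_unip !mxE /= mulr1 mulr0 addr0 mulr1. Qed.

Definition swap : GL2 k := gl2 0 1 1 0.

Lemma val_swap : val swap = mx2 0 1 1 0.
Proof. by rewrite val_gl2 // mulr0 mul1r sub0r unitrN unitr1. Qed.

Lemma heval_swap x y u : heval x y (sym_act swap u) = heval y x u.
Proof. by rewrite heval_act val_swap !mxE /= !mulr0 !mulr1 add0r addr0. Qed.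

Variable p : nat.
Hypotheses (char_p : p \in [pchar k]) (r_lt_p : (r < p)%N).

(** By counting roots: the dehomogenised form has degree below [p]. *)
Lemma sym_eq u v : (forall l : nat, heval 1 l%:R u = heval 1 l%:R v) -> u = v.
Proof.
move=> uv; apply: (can_inj dehomK).
apply: (eq_poly_on_nat char_p); rewrite ?(leq_trans (size_dehom _)) // => l.
by rewrite -!heval1E.
Qed.

(** A polynomial invariant under [y -> y + 1] is constant on the prime field,
    hence constant when its degree is below [p]. *)
Lemma unip_fixed u : sym_act (unip 1) u = u -> u = heval 1 0 u *: sym_xr k r.
Proof.
move=> Nu; apply: sym_eq => l; rewrite linearZ /= heval_xr expr1n mulr1.
elim: l => // l IHl.
by rewrite -IHl -[in RHS]Nu heval_unip mulr1 -natr1 addrC.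
Qed.

(** Dehomogenised, this is [pdiff_surj]: the vanishing of the coefficient of
    [y^r] leaves room for the degree to go up by one. *)
Lemma unip_diff_surj u : heval 0 1 u = 0 -> exists v, u = sym_act (unip 1) v - v.
Proof.
rewrite heval01E => u_r.
have [|q [qr qE]] := @pdiff_surj _ _ char_p r (dehom u) r_lt_p.
  apply/leq_sizeP => j; rewrite leq_eqVlt => /orP[/eqP<- //|rj].
  exact: (leq_sizeP _ _ (size_dehom u)).
exists (hsym q); apply: sym_eq => l; rewrite linearB /= heval_unip mulr1.
by rewrite !heval1_hsym // heval1E -qE horner_pdiff [1 + _]addrC.
Qed.

(** The unipotent translates of [y^r] dehomogenise to the powers of
    [translates_span]. *)
Lemma sym_span (P : Sym -> Prop) :
    (forall a u v, P u -> P v -> P (a *: u + v)) ->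
    (forall l : nat, P (sym_act (unip l%:R) (sym_act swap (sym_xr k r)))) ->
  forall u, P u.
Proof.
move=> Plin Pgen u; pose Q h := P (hsym h).
rewrite -[u]dehomK; apply: (translates_span char_p r_lt_p (P := Q)).
- move=> a q h Pq Ph; rewrite /Q.
  have -> : hsym (a *: q + h) = a *: hsym q + hsym h; last exact: Plin.
  apply: val_inj; rewrite linearP /= !val_hsym scaler_sumr -big_split /=.
  by apply: eq_bigr => i _; rewrite coefD coefZ scalerDl scalerA.
- move=> l; rewrite /Q.
  have <- : sym_act (unip l%:R) (sym_act swap (sym_xr k r)) = hsym (('X + l%:R) ^+ r).
    apply: sym_eq => j.
    rewrite heval_unip heval_swap heval_xr mul1r heval1_hsym.
      by rewrite -polyC_natr horner_exp hornerD hornerX hornerC addrC.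
    by rewrite -polyC_natr -(opprK _%:P) -polyCN size_exp_XsubC.
  exact: Pgen.
- exact: size_dehom.
Qed.

End SymmetricPower.

(** * Matrices given by their entries *)

Section Mx2.
Variable R : comUnitRingType.
Implicit Types (a b c d : R) (A : 'M[R]_2).

Lemma mx2E A : A = mx2 (A 0 0) (A 0 1) (A 1 0) (A 1 1).
Proof.
by apply/matrixP => -[[|[|//]] i2] [[|[|//]] j2]; rewrite mxE /=;
  congr (A _ _); apply: val_inj.
Qed.

Lemma mx2_mul a b c d a' b' c' d' :
  mx2 a b c d *m mx2 a' b' c' d' =
  mx2 (a * a' + b * c') (a * b' + b * d') (c * a' + d * c') (c * b' + d * d').
Proof.
apply/matrixP => i j; rewrite !mxE !big_ord_recl big_ord0 !mxE /= addr0.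
by case: ifP; case: ifP.
Qed.

Lemma mx2_inj a b c d a' b' c' d' : mx2 a b c d = mx2 a' b' c' d' ->
  [/\ a = a', b = b', c = c' & d = d'].
Proof.
move=> /matrixP e; move: (e 0 0) (e 0 1) (e 1 0) (e 1 1).
by rewrite !mxE.
Qed.

Lemma mx2_1 : mx2 1 0 0 1 = 1%:M :> 'M[R]_2.
Proof. by rewrite [RHS]mx2E !mxE. Qed.

End Mx2.

Lemma map_mx2 (R S : comUnitRingType) (f : R -> S) a b c d :
  map_mx f (mx2 a b c d) = mx2 (f a) (f b) (f c) (f d).
Proof. by apply/matrixP => i j; rewrite !mxE; case: ifP; case: ifP. Qed.

(* Unfolding these matrices in unification would lead into the construction of
   the fraction field. *)
#[local] Opaque gl2 mx_ppow mx_Pi mx_t mx_unip FracField.tofrac GL2_mul GL2_inv GL2_one.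

(** Group elements over [Q_p] are compared through their four entries only,
    so that conversion never has to unfold the fraction field. *)
Definition entries (R : comUnitRingType) (g : GL2 R) a b c d : Prop :=
  val g = mx2 a b c d.

Section Entries.
Variable R : comUnitRingType.
Implicit Types (a b c d : R) (g h : GL2 R).

Lemma entries_inj g h a b c d a' b' c' d' :
  entries g a b c d -> entries h a' b' c' d' ->
  a = a' -> b = b' -> c = c' -> d = d' -> g = h.
Proof.
by rewrite /entries => ge he ea eb ec ed; apply: val_inj; rewrite ge he ea eb ec ed.
Qed.

Lemma entries_eq g a b c d a' b' c' d' :
  entries g a b c d -> entries g a' b' c' d' ->
  [/\ a = a', b = b', c = c' & d = d'].
Proof. by rewrite /entries => -> /mx2_inj. Qed.

Lemma entries_eq_of g h a b c d a' b' c' d' : g = h ->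
  entries g a b c d -> entries h a' b' c' d' ->
  [/\ a = a', b = b', c = c' & d = d'].
Proof. by move=> ->; apply: entries_eq. Qed.

Lemma entriesM g h a b c d a' b' c' d' :
  entries g a b c d -> entries h a' b' c' d' ->
  entries (g * h)%g
    (a * a' + b * c') (a * b' + b * d') (c * a' + d * c') (c * b' + d * d').
Proof. by rewrite /entries GL2_valM => -> ->; rewrite mx2_mul. Qed.

Lemma entries_val g : entries g (val g 0 0) (val g 0 1) (val g 1 0) (val g 1 1).
Proof. exact: mx2E. Qed.

Lemma entries_val_eq g a b c d : entries g a b c d ->
  [/\ val g 0 0 = a, val g 0 1 = b, val g 1 0 = c & val g 1 1 = d].
Proof. by move=> ge; apply: entries_eq (entries_val g) ge. Qed.

Lemma entries1 : entries (1%g : GL2 R) 1 0 0 1.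
Proof. by rewrite /entries mx2_1. Qed.

Lemma entries_gl2 a b c d :
  a * d - b * c \is a GRing.unit -> entries (gl2 a b c d) a b c d.
Proof. exact: val_gl2. Qed.

Lemma entries_det g a b c d :
  entries g a b c d -> a * d - b * c \is a GRing.unit.
Proof. by move=> ge; have := valP g; rewrite unitmxE ge det_mx2. Qed.

Lemma det_entries g a b c d : entries g a b c d -> \det (val g) = a * d - b * c.
Proof. by move=> ->; rewrite det_mx2. Qed.

End Entries.

(** * Vertices of the tree *)

Section PadicMatrices.
Variables (p : nat) (p_pr : prime p).
Local Notation Zp := (padic_int p_pr).
Local Notation Qp := (padic p_pr).
Local Notation G := (GL2 Qp).
Local Notation red := (@padic_red p p_pr).
Local Notation incl := (@GL2_Zp_incl p p_pr).
Local Notation ppow := (mx_ppow p_pr).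
Local Notation Pi := (mx_Pi p_pr).
Implicit Types (z u : Zp) (g : G) (n m : nat).

Lemma padic_unit_red z : (z \is a GRing.unit) = (red z != 0).
Proof.
rewrite padic_unitE /padic_red; congr (~~ _); apply/eqP/eqP => [-> //|].
move/eqP; rewrite -(dvdz_pcharf (pchar_Fp p_pr)) => pz.
by rewrite -(residue_small z 1); apply/eqP; rewrite expn1; apply/eqP/dvdz_mod0P.
Qed.

Lemma red_p : red p%:R = 0.
Proof. by rewrite rmorph_nat pcharf0 // pchar_Fp. Qed.

Lemma red_pM z : red (p%:R * z) = 0.
Proof. by rewrite rmorphM /= red_p mul0r. Qed.

Lemma padic_nonunit z : z \isn't a GRing.unit -> exists z', z = p%:R * z'.
Proof.
rewrite padic_unitE negbK => /eqP /padic_dvdP[z' ->].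
by exists z'; rewrite expr1.
Qed.

Lemma padic_approx z m : exists n z', (n < p ^ m)%N /\ z = n%:R + p%:R ^+ m * z'.
Proof.
have z0 : 0 <= z m by rewrite -(residue_small z m) modz_ge0 // ppow_neq0.
have zE : z m = `|z m|%N by rewrite gez0_abs.
have [|z' zz'] := @padic_dvdP p p_pr (z - `|z m|%N%:R) m.
  rewrite residueD residueN residue_nat -zE.
  by rewrite residue_small -modzDmr modz_mod modzDmr subrr mod0z.
exists `|z m|%N, z'; rewrite -zz' addrC subrK; split=> //.
by rewrite -ltz_nat -zE -(residue_small z m) ltz_pmod // ppow_gt0.
Qed.

Lemma tofrac_p : p%:R%:F = p%:R :> Qp. Proof. exact: rmorph_nat. Qed.

Lemma padic_pX_neq0 (j : int) : (p%:R : Qp) ^ j != 0.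
Proof. by rewrite expfz_neq0 // padic_p_neq0. Qed.

Lemma tofrac_inj z z' : z%:F = z'%:F -> z = z'.
Proof. by move/eqP; rewrite tofrac_eq => /eqP. Qed.

Lemma ppow_unit (j : int) z z' : z \is a GRing.unit -> z' \is a GRing.unit ->
  p%:R ^ j * z%:F = z'%:F -> j = 0.
Proof.
case: j => [[//|n]|n] zu z'u.
  rewrite -exprnP -tofrac_p -tofracXn -tofracM => /tofrac_inj e.
  by move: z'u; rewrite -e padic_unit_red exprS -mulrA red_pM eqxx.
rewrite NegzE -invr_expz => /(congr1 (fun x => p%:R ^ n.+1 * x)).
rewrite mulrA mulfV ?padic_pX_neq0 // mul1r.
rewrite -exprnP -tofrac_p -tofracXn -tofracM => /tofrac_inj e.
by move: zu; rewrite e padic_unit_red exprS -mulrA red_pM eqxx.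
Qed.

Lemma padic_unit_part (a : Qp) : a != 0 ->
  exists (j : int) u, u \is a GRing.unit /\ a = p%:R ^ j * u%:F.
Proof.
move=> a0; have [m [z zE]] := padic_bounded a.
have z0 : z != 0.
  by rewrite -tofrac_eq0 -zE mulf_neq0 // (padic_pX_neq0 m).
have [n [u [uu uE]]] := padic_factor z0.
exists (n%:Z - m%:Z), u; split=> //.
apply: (mulfI (padic_pX_neq0 m)); rewrite [LHS]zE uE mulrA -expfzDr ?padic_p_neq0 //.
by rewrite addrC subrK tofracM tofracXn tofrac_p.
Qed.


Lemma entries_incl (A : GL2 Zp) a b c d :
  entries A a b c d -> entries (incl A) a%:F b%:F c%:F d%:F.
Proof. by rewrite /entries /= => ->; rewrite map_mx2. Qed.

Lemma entries_ppow (j : int) : entries (ppow j) (p%:R ^ j) 0 0 (p%:R ^ j).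
Proof. exact: val_mx_ppow. Qed.

Lemma entries_Pi : entries Pi 0 1 p%:R 0.
Proof. exact: val_mx_Pi. Qed.

Lemma inclM (A C : GL2 Zp) : incl (A * C)%g = (incl A * incl C)%g.
Proof. by apply: val_inj => /=; rewrite map_mxM. Qed.

Lemma incl1 : incl 1%g = 1%g.
Proof. by apply: val_inj => /=; rewrite map_mx1. Qed.

#[local] Opaque GL2_Zp_incl.

Lemma ppowM (i j : int) : (ppow i * ppow j)%g = ppow (i + j).
Proof.
apply: (entries_inj (entriesM (entries_ppow i) (entries_ppow j)) (entries_ppow _)).
- by rewrite mulr0 addr0 expfzDr // padic_p_neq0.
- by rewrite mulr0 mul0r addr0.
- by rewrite mulr0 mul0r addr0.
- by rewrite mulr0 add0r expfzDr // padic_p_neq0.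
Qed.

Lemma ppow0 : ppow 0 = 1%g.
Proof. exact: (entries_inj (entries_ppow 0) (entries1 _)). Qed.

Lemma ppow_center (j : int) g : (ppow j * g = g * ppow j)%g.
Proof.
by apply: (entries_inj (entriesM (entries_ppow j) (entries_val g))
  (entriesM (entries_val g) (entries_ppow j))); ring.
Qed.

Lemma GL2_center_scalar (z : G) : GL2_center z ->
  exists a : Qp, entries z a 0 0 a.
Proof.
move=> zc; pose x : G := gl2 1 1 0 1; pose y : G := gl2 1 0 1 1.
have xE : entries x 1 1 0 1 by apply: entries_gl2; rewrite mulr1 mulr0 subr0 unitr1.
have yE : entries y 1 0 1 1 by apply: entries_gl2; rewrite mulr1 mul0r subr0 unitr1.
have zx := entriesM (entries_val z) xE; rewrite zc in zx.
have zy := entriesM (entries_val z) yE; rewrite zc in zy.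
have [+ + _ _] := entries_eq zx (entriesM xE (entries_val z)).
have [+ _ _ _] := entries_eq zy (entriesM yE (entries_val z)).
move: (entries_val z); move: (val z 0 0) (val z 0 1) (val z 1 0) (val z 1 1).
move=> a b c d ze; rewrite !(mulr1, mulr0, mul0r, mul1r, addr0, add0r).
move=> ab ac abd; exists a.
have b0 : b = 0 by apply: (addrI a); rewrite ab addr0.
have c0 : c = 0 by apply: (addrI a); rewrite -ac addr0.
have ad : a = d by move: abd; rewrite b0 addr0 add0r.
by move: ze; rewrite b0 c0 -ad.
Qed.

(** A scalar is a power of [p] times a unit, and the unit is absorbed by the
    compact factor. *)
Lemma KZP g : KZ g <-> exists j A, g = (ppow j * incl A)%g.
Proof.
split=> [[A [z [zc ->]]]|[j [A ->]]].
  have [a zE] := GL2_center_scalar zc.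
  have a0 : a != 0.
    by have := entries_det zE; rewrite mulr0 subr0 unitfE mulf_eq0 orbb.
  have [j [u [uu uE]]] := padic_unit_part a0.
  exists j, (gl2 u 0 0 u * A)%g; rewrite inclM mulgA -zc; congr (_ * _)%g.
  have ue : entries (gl2 u 0 0 u) u 0 0 u.
    by apply: entries_gl2; rewrite mulr0 subr0 unitrM uu.
  apply: (entries_inj zE (entriesM (entries_ppow j) (entries_incl ue)));
  by rewrite ?uE ?rmorph0; ring.
exists A, (ppow j); split; last exact: ppow_center.
by move=> g'; apply: ppow_center.
Qed.

Lemma KZ_ppow j : KZ (ppow j).
Proof. by apply/KZP; exists j, 1%g; rewrite incl1 mulg1. Qed.

Lemma KZ_incl A : KZ (incl A).
Proof. by apply/KZP; exists 0, A; rewrite ppow0 mul1g. Qed.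

Lemma KZM g h : KZ g -> KZ h -> KZ (g * h)%g.
Proof.
move=> /KZP[i [A ->]] /KZP[j [C ->]]; apply/KZP; exists (i + j), (A * C)%g.
have := ppow_center j (incl A); have := ppowM i j; have := inclM A C.
move: (incl A) (incl C) (incl _) (ppow i) (ppow j) (ppow _) => a c ac x y xy.
by move=> -> <- e; rewrite -!mulgA (mulgA a) -e !mulgA.
Qed.

Lemma ppowV j : ((ppow j)^-1)%g = ppow (- j).
Proof. by apply: (mulgI (ppow j)); rewrite mulgV ppowM subrr ppow0. Qed.

Lemma inclV A : incl (A^-1)%g = ((incl A)^-1)%g.
Proof. by apply: (mulgI (incl A)); rewrite -inclM !mulgV incl1. Qed.

Lemma KZV g : KZ g -> KZ (g^-1)%g.
Proof.
move=> /KZP[j [A ->]]; rewrite invgM -inclV ppowV.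
by apply: KZM; [apply: KZ_incl|apply: KZ_ppow].
Qed.

(** Representatives of the vertices of the half of the tree that contains the
    base vertex [aff 0 0]; the distance to it is [n], and only [b] modulo
    [p ^ n] matters. *)
Definition aff n (b : Zp) : G := gl2 (p%:R ^+ n) b%:F 0 1.

Lemma entries_aff n b : entries (aff n b) (p%:R ^+ n) b%:F 0 1.
Proof.
apply: entries_gl2; rewrite mulr1 mulr0 subr0 unitfE.
exact: (padic_pX_neq0 n).
Qed.

Lemma affM n b m c : (aff n b * aff m c)%g = aff (n + m) (b + p%:R ^+ n * c).
Proof.
apply: (entries_inj (entriesM (entries_aff _ _) (entries_aff _ _)) (entries_aff _ _)).
- by rewrite mulr0 addr0 exprD.
- by rewrite mulr1 addrC tofracD tofracM tofracXn tofrac_p.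
- by rewrite mul0r mul1r add0r.
- by rewrite mul0r mul1r add0r.
Qed.

Definition zunip z : GL2 Zp := gl2 1 z 0 1.

Lemma entries_zunip z : entries (zunip z) 1 z 0 1.
Proof. by apply: entries_gl2; rewrite mulr1 mulr0 subr0 unitr1. Qed.

Lemma aff0 z : aff 0 z = incl (zunip z).
Proof.
apply: (entries_inj (entries_aff 0 z) (entries_incl (entries_zunip z)));
  by rewrite ?rmorph0 ?rmorph1 ?expr0.
Qed.

#[local] Opaque aff zunip.

(** Column operations bring a primitive bottom row to [(0, 1)], and the top row
    stays integral. *)
Lemma primitive_bottom g (x y z t : Zp) :
    entries g x%:F y%:F z%:F t%:F ->
    (z \is a GRing.unit) || (t \is a GRing.unit) ->
  exists n b (A : GL2 Zp), g = (aff n b * incl A)%g.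
Proof.
move=> ge; have xt0 : x * t - y * z != 0.
  have := entries_det ge; rewrite unitfE -!tofracM -tofracB tofrac_eq0.
  by [].
have [n [u [uu uE]]] := padic_factor xt0.
have eq1 v n1 b a c : p%:R ^+ n1 * a + b * c = v :> Zp ->
    v%:F = p%:R ^+ n1 * a%:F + b%:F * c%:F :> Qp.
  by move=> <-; rewrite tofracD !tofracM tofracXn tofrac_p.
have eq0 v a : v%:F = 0 * a + 1 * v%:F :> Qp by rewrite mul0r mul1r add0r.
case/orP=> [zu|tu].
  have Ae : entries (gl2 0 (- (u / z)) z t) 0 (- (u / z)) z t.
    by apply: entries_gl2; rewrite mul0r sub0r mulNr opprK divrK.
  exists n, (x / z), (gl2 0 (- (u / z)) z t).
  apply: (entries_inj ge (entriesM (entries_aff _ _) (entries_incl Ae))).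
  - by apply: eq1; rewrite mulr0 add0r divrK.
  - apply: eq1; rewrite mulrN mulrA -uE mulrBl -mulrA mulrK //; ring.
  - exact: eq0.
  - exact: eq0.
have Ae : entries (gl2 (u / t) 0 z t) (u / t) 0 z t.
  by apply: entries_gl2; rewrite mul0r subr0 divrK.
exists n, (y / t), (gl2 (u / t) 0 z t).
apply: (entries_inj ge (entriesM (entries_aff _ _) (entries_incl Ae))).
- by apply: eq1; rewrite mulrA -uE mulrBl mulrK //; ring.
- by apply: eq1; rewrite mulr0 add0r divrK.
- exact: eq0.
- exact: eq0.
Qed.

Lemma PiPi : (Pi * Pi)%g = ppow 1.
Proof.
by apply: (entries_inj (entriesM entries_Pi entries_Pi) (entries_ppow 1));
  rewrite ?expr1z; ring.
Qed.

Lemma mx_t_aff : mx_t p_pr = aff 1 0.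
Proof.
apply: (@entries_inj _ _ _ p%:R 0 0 1 _ _ _ _ _ (entries_aff 1 0)) => //.
exact: val_mx_t.
Qed.

Lemma mx_unip_aff b : mx_unip b = aff 0 b.
Proof.
by apply: (@entries_inj _ _ _ 1 b%:F 0 1 _ _ _ _ _ (entries_aff 0 b)) => //;
  exact: val_mx_unip.
Qed.

(** Reduction to a primitive lattice by dividing by [p], which must stop since
    the determinant is not divisible by [p ^ N]. *)
Lemma vertex_integral N g (x y z t : Zp) :
    entries g x%:F y%:F z%:F t%:F -> (x * t - y * z) N != 0 ->
  exists n b h, KZ h /\ (g = (aff n b * h)%g \/ g = (Pi * (aff n b * h))%g).
Proof.
elim: N g x y z t => [|N IHN] g x y z t ge.
  by rewrite -residue_small expn0 modz1.
move=> dN; have [zt|] := boolP ((z \is a GRing.unit) || (t \is a GRing.unit)).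
  have [n [b [A gE]]] := primitive_bottom ge zt.
  by exists n, b, (incl A); split; [exact: KZ_incl|left].
rewrite negb_or => /andP[/padic_nonunit[z' zE] /padic_nonunit[t' tE]].
have scal c c' : c = p%:R * c' -> c%:F = p%:R * c'%:F :> Qp.
  by move=> ->; rewrite tofracM tofrac_p.
have pp : p%:R * p%:R^-1 = 1 :> Qp by rewrite mulfV // padic_p_neq0.
have [xy|] := boolP ((x \is a GRing.unit) || (y \is a GRing.unit)).
  have he : entries (Pi^-1 * g)%g z'%:F t'%:F x%:F y%:F.
    have := entries_val (Pi^-1 * g)%g; set g' := (Pi^-1 * g)%g.
    move: (val g' 0 0) (val g' 0 1) (val g' 1 0) (val g' 1 1) => a b c d.
    rewrite /g' => he.
    have [<- <- + +] := entries_eq_of (mulVKg Pi g) (entriesM entries_Pi he) ge.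
    rewrite !mul0r !mul1r !add0r !addr0 (scal _ _ zE) (scal _ _ tE).
    by move=> /(mulfI (padic_p_neq0 p_pr)) <- /(mulfI (padic_p_neq0 p_pr)) <-.
  have [n [b [A gE]]] := primitive_bottom he xy.
  exists n, b, (incl A); split; first exact: KZ_incl.
  right; exact: (etrans (esym (mulVKg Pi g)) (congr1 (fun x => Pi * x)%g gE)).
rewrite negb_or => /andP[/padic_nonunit[x' xE] /padic_nonunit[y' yE]].
have he : entries (ppow (-1) * g)%g x'%:F y'%:F z'%:F t'%:F.
  have := entriesM (entries_ppow (-1)) ge.
  rewrite (scal _ _ xE) (scal _ _ yE) (scal _ _ zE) (scal _ _ tE).
  rewrite !mul0r !addr0 !add0r !mulrA exprN1 [_^-1 * _]mulrC pp !mul1r.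
  exact.
have [|n [b [h [hK hE]]]] := IHN _ _ _ _ _ he.
  apply: contraNneq dN => /padic_dvdP[w wE].
  have -> : x * t - y * z = p%:R ^+ N.+1 * (p%:R * w).
    by rewrite xE yE zE tE exprS -[RHS]mulrA [_ * (p%:R * w)]mulrCA -wE; ring.
  by rewrite residueM -natrX residue_nat modzz mul0r mod0z.
exists n, b, (ppow 1 * h)%g; split; first by apply: KZM => //; apply: KZ_ppow.
have -> : g = (ppow 1 * (ppow (-1) * g))%g by rewrite mulgA ppowM subrr ppow0 mul1g.
move: hE (ppow_center 1 (aff n b)) (ppow_center 1 Pi).
move: (ppow (-1) * g)%g (ppow 1) (aff n b) Pi => g' c a pi hE ca cpi.
by case: hE => ->; [left|right]; rewrite !mulgA ?cpi -?(mulgA pi) ca.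
Qed.

(** The two cases are the two halves of the tree left when the edge stabilised
    by [Pi] is removed. *)
Lemma vertexP g :
  exists n b h, KZ h /\ (g = (aff n b * h)%g \/ g = (Pi * (aff n b * h))%g).
Proof.
have [m [X XE]] := GL2_bounded g.
have he : entries (ppow m * g)%g (X 0 0)%:F (X 0 1)%:F (X 1 0)%:F (X 1 1)%:F.
  have := entriesM (entries_ppow m) (entries_val g).
  rewrite !mul0r !addr0 !add0r; have := XE; move/matrixP => e.
  by have := e 0 0; have := e 0 1; have := e 1 0; have := e 1 1;
    rewrite !mxE => <- <- <- <-.
have d0 : X 0 0 * X 1 1 - X 0 1 * X 1 0 != 0.
  by have := entries_det he; rewrite unitfE -!tofracM -tofracB tofrac_eq0.
have [N dN] := padic_neq0 d0.
have [n [b [h [hK hE]]]] := vertex_integral he dN.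
exists n, b, (ppow (- m%:Z) * h)%g; split; first by apply: KZM => //; apply: KZ_ppow.
have -> : g = (ppow (- m%:Z) * (ppow m * g))%g by rewrite mulgA ppowM addNr ppow0 mul1g.
move: hE (ppow_center (- m%:Z) (aff n b)) (ppow_center (- m%:Z) Pi).
move: (ppow m * g)%g (ppow (- _)) (aff n b) Pi => g' c a pi hE ca cpi.
by case: hE => ->; [left|right]; rewrite !mulgA ?cpi -?(mulgA pi) ca.
Qed.

(** Comparing bottom rows, the scalar is trivial and the compact factor is upper
    unipotent. *)
Lemma aff_KZ_eq n b m c h : KZ h -> (aff n b * h)%g = aff m c ->
  n = m /\ exists z, c = b + p%:R ^+ n * z /\ h = incl (zunip z).
Proof.
move=> /KZP[j [A ->]] e.
have Ae := entriesM (entries_ppow j) (entries_incl (entries_val A)).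
have [] := entries_eq_of (esym e) (entries_aff m c) (entriesM (entries_aff n b) Ae).
rewrite !mul0r !add0r !addr0 !mul1r => e00 e01 e10 e11.
have dA := entries_det (entries_val A).
move: (entries_val A) dA e00 e01 e10 e11.
move: (val A 0 0) (val A 0 1) (val A 1 0) (val A 1 1) => a' b' c' d' Aval dA.
move=> e00 e01 /esym/eqP; rewrite mulf_eq0 (negPf (padic_pX_neq0 j)) /=.
rewrite tofrac_eq0 => /eqP c0 /esym e11.
move: dA e00 e01; rewrite c0 mulr0 subr0 rmorph0 !mulr0 addr0 unitrM.
case/andP=> au du e00 e01.
have j0 : j = 0 by apply: (ppow_unit du (unitr1 _)); rewrite e11 rmorph1.
move: e00 e01 e11; rewrite j0 expr0z !mul1r => e00 e01 e11.
have d1 : d' = 1 by apply: tofrac_inj; rewrite e11 rmorph1.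
have mn : m%:Z - n%:Z = 0.
  apply: (ppow_unit (unitr1 _) au); rewrite rmorph1 mulr1.
  rewrite expfzDr ?padic_p_neq0 // -[p%:R ^ m]/(p%:R ^+ m) e00 -exprnN.
  by rewrite mulrC mulKf // (padic_pX_neq0 n).
have {mn} mn : n = m by apply/eqP; move/eqP: mn; rewrite subr_eq0 eqz_nat eq_sym.
split=> //; have a1 : a' = 1.
  apply: tofrac_inj; apply: (mulfI (padic_pX_neq0 n)).
  by rewrite -[LHS]e00 mn rmorph1 mulr1.
exists b'; split.
  apply: tofrac_inj; rewrite e01 d1 rmorph1 mulr1 addrC.
  by rewrite tofracD tofracM tofracXn tofrac_p.
rewrite ppow0 mul1g; congr incl.
apply: (entries_inj Aval (entries_zunip b')); by rewrite ?a1 ?c0 ?d1.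
Qed.

(** The bottom row of [Pi * aff m c] is divisible by [p] and its top row is
    primitive. On the left the bottom row is a power of [p] times a primitive
    row; that power must be positive, and then divides the top row as well. *)
Lemma aff_Pi_KZ n b m c h : KZ h -> (aff n b * h)%g <> (Pi * aff m c)%g.
Proof.
move=> /KZP[j [A ->]] e.
have Ae := entriesM (entries_ppow j) (entries_incl (entries_val A)).
have [_] := entries_eq_of (esym e) (entriesM entries_Pi (entries_aff m c))
  (entriesM (entries_aff n b) Ae).
rewrite !mul0r !add0r !addr0 !mul1r.
have := entries_det (entries_val A).
move: (val A 0 0) (val A 0 1) (val A 1 0) (val A 1 1) => a' b' c' d' dA.
case: j {e Ae} => [[|j]|j] e01 e10 e11.
- have c0 : red c' = 0.
    have -> : c' = p%:R * p%:R ^+ m; last by rewrite red_pM.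
    by apply: tofrac_inj; rewrite -[LHS]mul1r -[LHS]e10 tofracM tofracXn tofrac_p.
  have d0 : red d' = 0.
    have -> : d' = p%:R * c; last by rewrite red_pM.
    by apply: tofrac_inj; rewrite -[LHS]mul1r -[LHS]e11 tofracM tofrac_p.
  move: dA; rewrite padic_unit_red rmorphB !rmorphM /= c0 d0.
  by rewrite !mulr0 subrr eqxx.
- have : red 1 = 0.
    have -> : 1 = p%:R * (p%:R ^+ j * (p%:R ^+ n * b' + b * d')) :> Zp.
      apply: tofrac_inj; rewrite rmorph1 e01.
      rewrite !tofracM tofracD !tofracM !tofracXn !tofrac_p -exprnP exprS; ring.
    exact: red_pM.
  by rewrite rmorph1 => /eqP; rewrite oner_eq0.
- have pj x y : p%:R * x = p%:R ^ (Negz j) * y%:F :> Qp -> forall x', x'%:F = x ->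
      red y = 0.
    rewrite NegzE => e x' xx'.
    have -> : y = p%:R * (p%:R ^+ j.+1 * x'); last by rewrite red_pM.
    apply: tofrac_inj; rewrite !tofracM tofracXn tofrac_p xx' mulrCA e.
    by rewrite mulrA -[_ ^+ _]/(p%:R ^ j.+1) -expfzDr ?padic_p_neq0 // subrr mul1r.
  have c0 : red c' = 0.
    apply: (pj _ _ e10 (p%:R ^+ m)); by rewrite tofracXn tofrac_p.
  have d0 : red d' = 0 by apply: (pj _ _ e11 c).
  move: dA; rewrite padic_unit_red rmorphB !rmorphM /= c0 d0.
  by rewrite !mulr0 subrr eqxx.
Qed.

Definition zswap : GL2 Zp := gl2 0 1 1 0.

Lemma entries_zswap : entries zswap 0 1 1 0.
Proof. by apply: entries_gl2; rewrite mulr0 mul1r sub0r unitrN unitr1. Qed.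

Definition zlow z : GL2 Zp := gl2 1 0 (p%:R * z) 1.

Lemma entries_zlow z : entries (zlow z) 1 0 (p%:R * z) 1.
Proof. by apply: entries_gl2; rewrite mulr1 mul0r subr0 unitr1. Qed.

Lemma tofrac_pM z : (p%:R * z)%:F = p%:R * z%:F :> Qp.
Proof. by rewrite tofracM tofrac_p. Qed.

Lemma aff1_Pi : (aff 1 0 * Pi)%g = (ppow 1 * incl zswap)%g.
Proof.
by apply: (entries_inj (entriesM (entries_aff 1 0) entries_Pi)
  (entriesM (entries_ppow 1) (entries_incl entries_zswap)));
  rewrite ?rmorph0 ?rmorph1; ring.
Qed.

Lemma swap_aff1 : (incl zswap * aff 1 0)%g = Pi.
Proof.
by apply: (entries_inj (entriesM (entries_incl entries_zswap) (entries_aff 1 0))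
  entries_Pi); rewrite ?rmorph0 ?rmorph1; ring.
Qed.

Lemma aff0_mul_Pi z : (aff 0 z * Pi)%g = (Pi * incl (zlow z))%g.
Proof.
apply: (entries_inj (entriesM (entries_aff 0 z) entries_Pi)
  (entriesM entries_Pi (entries_incl (entries_zlow z))));
  rewrite ?rmorph0 ?rmorph1 ?tofrac_pM; ring.
Qed.

Lemma zlow_mul_Pi z : (incl (zlow z) * Pi)%g = (Pi * aff 0 z)%g.
Proof.
apply: (entries_inj (entriesM (entries_incl (entries_zlow z)) entries_Pi)
  (entriesM entries_Pi (entries_aff 0 z)));
  rewrite ?rmorph0 ?rmorph1 ?tofrac_pM; ring.
Qed.

Lemma unit_1p z : 1 + p%:R * z \is a GRing.unit.
Proof. by rewrite padic_unit_red rmorphD /= red_pM addr0 rmorph1 oner_eq0. Qed.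

(** On the coordinate [b] of the vertices a lower unipotent acts as a
    homography. *)
Lemma zlow_mul_aff n b : exists A a c d,
  [/\ (incl (zlow 1%R) * aff n b)%g = (aff n (b / (1 + p%:R * b))%R * incl A)%g
    & entries A (1 + p%:R * a) 0 (p%:R * c) (1 + p%:R * d)].
Proof.
have u := unit_1p b; set v := 1 + p%:R * b in u *.
have Ae : entries
    (gl2 (1 + p%:R * - (b / v)) 0 (p%:R * p%:R ^+ n) (1 + p%:R * b) : GL2 Zp)
    (1 + p%:R * - (b / v)) 0 (p%:R * p%:R ^+ n) (1 + p%:R * b).
  by apply: entries_gl2; rewrite mul0r subr0 unitrM !unit_1p.
exists (gl2 (1 + p%:R * - (b / v)) 0 (p%:R * p%:R ^+ n) (1 + p%:R * b)).
exists (- (b / v)), (p%:R ^+ n), b; split=> //.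
have bE : b%:F = (b / v)%:F * (1 + p%:R * b%:F) :> Qp.
  have -> : 1 + p%:R * b%:F = v%:F :> Qp by rewrite /v tofracD tofrac_pM rmorph1.
  by rewrite -tofracM divrK.
apply: (entries_inj (entriesM (entries_incl (entries_zlow 1)) (entries_aff n b))
  (entriesM (entries_aff n (b / v)) (entries_incl Ae))).
- rewrite tofracD !tofrac_pM tofracN rmorph0 rmorph1 tofracXn tofrac_p; ring.
- rewrite tofracD tofrac_pM rmorph0 rmorph1 -bE; ring.
- rewrite !tofrac_pM rmorph1 tofracXn tofrac_p; ring.
- rewrite tofracD !tofrac_pM !rmorph1; ring.
Qed.

(** The homography to second order, which determines it on the vertices at
    distance at most two. *)
Lemma low_aff_shift b : exists z,
  b / (1 + p%:R * b) = b - p%:R * b ^+ 2 + p%:R ^+ 2 * z.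
Proof.
have u := unit_1p b; exists (b ^+ 3 / (1 + p%:R * b)).
apply: (mulIr u); rewrite divrK // mulrDl !mulrA divrK //; ring.
Qed.

(** On the neighbours of the base vertex the Weyl element acts by inversion of
    the coordinate. *)
Lemma swap_aff nu : nu \is a GRing.unit ->
  exists A, (incl zswap * aff 1 nu)%g = (aff 1 (nu^-1)%R * incl A)%g /\
    entries A (- nu^-1) 0 p%:R nu.
Proof.
move=> u; have Ae : entries (gl2 (- nu^-1) 0 p%:R nu : GL2 Zp) (- nu^-1) 0 p%:R nu.
  by apply: entries_gl2; rewrite mul0r subr0 unitrM unitrN unitrV !u.
exists (gl2 (- nu^-1) 0 p%:R nu); split=> //.
have vF : nu^-1%:F * nu%:F = 1 :> Qp by rewrite -tofracM mulVr // rmorph1.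
apply: (entries_inj (entriesM (entries_incl entries_zswap) (entries_aff 1 nu))
  (entriesM (entries_aff 1 nu^-1) (entries_incl Ae))).
- rewrite tofracN tofrac_p rmorph0 rmorph1; ring.
- rewrite rmorph0 rmorph1 vF; ring.
- rewrite tofrac_p rmorph0 rmorph1; ring.
- rewrite rmorph0 rmorph1; ring.
Qed.

Lemma entries_unit_diag (A : GL2 Zp) a b c d : entries A a b (p%:R * c) d ->
  a \is a GRing.unit /\ d \is a GRing.unit.
Proof.
move=> /entries_det; rewrite padic_unit_red rmorphB !rmorphM /= red_p mul0r mulr0.
by rewrite subr0 mulf_eq0 negb_or -!padic_unit_red => /andP[].
Qed.

Lemma iwahoriP g : iwahori p_pr g <->
  exists A a b c d, g = incl A /\ entries A a b (p%:R * c) d.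
Proof.
split=> [[a [b [c [d [ua ud ge]]]]]|[A [a [b [c [d [-> Ae]]]]]]].
  have Ae : entries (gl2 a b (p%:R * c) d : GL2 Zp) a b (p%:R * c) d.
    apply: entries_gl2; rewrite padic_unit_red rmorphB !rmorphM /= red_p.
    rewrite mul0r mulr0 subr0 mulf_eq0 negb_or.
    by rewrite -!padic_unit_red ua ud.
  exists (gl2 a b (p%:R * c) d), a, b, c, d; split=> //.
  by apply: (entries_inj (ge : entries _ _ _ _ _) (entries_incl Ae)).
have [ua ud] := entries_unit_diag Ae.
by exists a, b, c, d; split=> //; exact: (entries_incl Ae).
Qed.

Lemma pro_p_iwahoriP g : pro_p_iwahori p_pr g <->
  exists A a b c d, g = incl A /\
    entries A (1 + p%:R * a) b (p%:R * c) (1 + p%:R * d).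
Proof.
split=> [[a [b [c [d ge]]]]|[A [a [b [c [d [-> Ae]]]]]]]; last first.
  by exists a, b, c, d; exact: (entries_incl Ae).
have Ae : entries (gl2 (1 + p%:R * a) b (p%:R * c) (1 + p%:R * d) : GL2 Zp)
    (1 + p%:R * a) b (p%:R * c) (1 + p%:R * d).
  apply: entries_gl2; rewrite padic_unit_red rmorphB !rmorphM /= red_p.
  by rewrite mul0r mulr0 subr0 mulf_eq0 negb_or -!padic_unit_red !unit_1p.
exists (gl2 (1 + p%:R * a) b (p%:R * c) (1 + p%:R * d)), a, b, c, d; split=> //.
by apply: (entries_inj (ge : entries _ _ _ _ _) (entries_incl Ae)).
Qed.

(** [Pi] normalises the Iwahori subgroup by exchanging the two diagonal
    entries and the two off-diagonal ones. *)
Lemma incl_Pi (A : GL2 Zp) a b c d : entries A a b (p%:R * c) d ->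
  exists A', (incl A * Pi)%g = (Pi * incl A')%g /\ entries A' d c (p%:R * b) a.
Proof.
move=> Ae; have Ae' : entries (gl2 d c (p%:R * b) a : GL2 Zp) d c (p%:R * b) a.
  apply: entries_gl2; have := entries_det Ae.
  by congr (_ \is a GRing.unit); ring.
exists (gl2 d c (p%:R * b) a); split=> //.
apply: (entries_inj (entriesM (entries_incl Ae) entries_Pi)
  (entriesM entries_Pi (entries_incl Ae'))); rewrite ?tofrac_pM; ring.
Qed.

(** The Iwahori subgroup keeps the top row integral and the bottom row
    primitive, hence preserves the half of the tree. *)
Lemma iwahori_aff (A : GL2 Zp) a b c d n e : entries A a b (p%:R * c) d ->
  exists m f A', (incl A * aff n e)%g = (aff m f * incl A')%g.
Proof.
move=> Ae; apply: (@primitive_bottom _ (a * p%:R ^+ n) (a * e + b)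
  (p%:R * c * p%:R ^+ n) (p%:R * c * e + d)); last first.
  rewrite [X in _ || X]padic_unit_red rmorphD !rmorphM /= red_p !mul0r add0r.
  by rewrite -padic_unit_red (entries_unit_diag Ae).2 orbT.
have := entriesM (entries_incl Ae) (entries_aff n e).
by rewrite !mulr0 !addr0 !mulr1 /entries => ->; congr mx2;
  rewrite ?tofracD ?tofracM ?tofracXn ?tofrac_p.
Qed.

Lemma det_incl (A : GL2 Zp) : \det (val (incl A)) = (\det (val A))%:F.
Proof.
rewrite (det_entries (entries_incl (entries_val A))).
by rewrite (det_entries (entries_val A)) tofracB !tofracM.
Qed.

Variables (k : fieldType) (iota : {rmorphism 'F_p -> k}).
Definition kred : Zp -> k := iota \o red.
HB.instance Definition _ := GRing.RMorphism.on kred.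

Lemma entries_kred (A : GL2 Zp) a b c d : entries A a b c d ->
  entries (GL2_Zp_red iota A) (kred a) (kred b) (kred c) (kred d).
Proof. by rewrite /entries /= => ->; rewrite map_mx2. Qed.

Lemma kred_pM z : kred (p%:R * z) = 0.
Proof. by rewrite /kred /= red_pM rmorph0. Qed.

Lemma char_k : p \in [pchar k].
Proof. exact: (rmorph_pchar iota (pchar_Fp p_pr)). Qed.

Lemma entries_unip (s : k) : entries (unip s) 1 s 0 1.
Proof. exact: val_unip. Qed.

Lemma red_zunip z : GL2_Zp_red iota (zunip z) = unip (kred z).
Proof.
by apply: (entries_inj (entries_kred (entries_zunip z)) (entries_unip _));
  rewrite ?rmorph0 ?rmorph1.
Qed.

Lemma red_zswap : GL2_Zp_red iota zswap = swap k.
Proof.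
by apply: (@entries_inj _ _ _ _ _ _ _ 0 1 1 0 (entries_kred entries_zswap));
  rewrite ?rmorph0 ?rmorph1 //; exact: val_swap.
Qed.

Lemma red_congruent1 (A : GL2 Zp) a c d :
  entries A (1 + p%:R * a) 0 (p%:R * c) (1 + p%:R * d) ->
  GL2_Zp_red iota A = 1%g.
Proof.
move=> Ae; apply: (entries_inj (entries_kred Ae) (entries1 _));
  by rewrite ?rmorphD /= ?kred_pM ?addr0 ?rmorph0 ?rmorph1.
Qed.

(** [x^r] is a highest weight vector: upper triangular matrices act on it
    through their upper left entry. *)
Lemma red_upper_xr (A : GL2 Zp) a b c d r : (r < p)%N ->
  entries A a b (p%:R * c) d ->
  sym_act (GL2_Zp_red iota A) (sym_xr k r) = kred a ^+ r *: sym_xr k r.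
Proof.
move=> rp Ae; have [e0 e1 e2 e3] := entries_val_eq (entries_kred Ae).
apply: (sym_eq char_k rp) => l; rewrite heval_act e0 e2 heval_xr linearZ /= heval_xr.
by rewrite kred_pM mulr0 addr0 mul1r expr1n mulr1.
Qed.

Lemma kred_unit z : z \is a GRing.unit -> kred z != 0.
Proof. by rewrite padic_unit_red /kred /= fmorph_eq0. Qed.

End PadicMatrices.

(** * Linear spans and finite sums *)

Section LinSpan.
Variables (k : fieldType) (V : lmodType k).
Implicit Types (X : set V) (P : set V).

Definition lin_closed P := P 0 /\ forall a u v, P u -> P v -> P (a *: u + v).

Lemma lin_closedD P u v : lin_closed P -> P u -> P v -> P (u + v).
Proof. by case=> _ Plin Pu Pv; rewrite -[u]scale1r; apply: Plin. Qed.

Lemma lin_closedZ P a u : lin_closed P -> P u -> P (a *: u).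
Proof. by case=> P0 Plin Pu; rewrite -[_ *: u]addr0; apply: Plin. Qed.

Lemma lin_closedB P u v : lin_closed P -> P u -> P v -> P (u - v).
Proof.
by move=> Pc Pu Pv; apply: lin_closedD => //; rewrite -scaleN1r; apply: lin_closedZ.
Qed.

Lemma lin_closed_sum P (I : Type) (s : seq I) (Q : pred I) (F : I -> V) :
  lin_closed P -> (forall i, Q i -> P (F i)) -> P (\sum_(i <- s | Q i) F i).
Proof.
move=> Pc PF; elim/big_rec: _ => [|i x Qi Px]; first by case: Pc.
by apply: lin_closedD => //; apply: PF.
Qed.

Lemma lin_span_closed X : lin_closed (lin_span X).
Proof.
split; first by exists 0%N, (fun=> 0), (fun=> 0); rewrite big_ord0; split=> // -[].
move=> a _ _ [n [c [x [xX ->]]]] [m [d [y [yX ->]]]].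
exists (n + m)%N,
  (fun i => match fintype.split i with inl j => a * c j | inr j => d j end),
  (fun i => match fintype.split i with inl j => x j | inr j => y j end); split.
  by move=> i; case: (fintype.split i).
rewrite big_split_ord scaler_sumr; congr (_ + _); apply: eq_bigr => i _.
  by rewrite (unsplitK (inl i)) scalerA.
by rewrite (unsplitK (inr i)).
Qed.

Lemma lin_span_sub X P : lin_closed P -> X `<=` P -> lin_span X `<=` P.
Proof.
move=> Pc XP _ [n [c [x [xX ->]]]]; apply: lin_closed_sum => // i _.
by apply: lin_closedZ => //; apply: XP.
Qed.

Lemma lin_span_gen X : X `<=` lin_span X.
Proof.
move=> x Xx; exists 1%N, (fun=> 1), (fun=> x); split=> //.
by rewrite big_ord1 scale1r.
Qed.
End LinSpan.

Lemma sum_cyclic (V : zmodType) n (F : nat -> V) :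
  F n = F 0%N -> \sum_(i < n) F i.+1 = \sum_(i < n) F i.
Proof.
case: n => [|n] Fn; first by rewrite !big_ord0.
by rewrite big_ord_recr [RHS]big_ord_recl /= Fn addrC.
Qed.

Lemma sum_digits (V : zmodType) m p (F : nat -> V) :
  \sum_(i < m * p) F i = \sum_(i < m) \sum_(j < p) F (i + m * j)%N.
Proof.
rewrite exchange_big /=; elim: p => [|p IHp]; first by rewrite muln0 !big_ord0.
rewrite mulnS addnC big_split_ord /= IHp big_ord_recr /=; congr (_ + _).
by apply: eq_bigr => i _; rewrite addnC.
Qed.

(** What the argument uses of the compact induction. The vertices of the tree are
    represented by [aff_ n b] and [Pi_ * aff_ n b]; [base u] is the function
    supported at the base vertex with value [u] there, [ev1] is the value at the
    base vertex, and [red] the reduction of scalars. In [T_base] only the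
    component beyond the edge stabilised by [Pi_] is prescribed; the
    coefficients [gamma] are then forced, by evaluation at the neighbours. *)
Record tree_action (k : fieldType) (r p : nat) (R : comNzRingType)
    (red : {rmorphism R -> k}) (G : groupType) (W : lmodType k) := TreeAction {
  act :> representation G W;
  aff_ : nat -> R -> G;
  Pi_ : G;
  sw_ : G;
  low_ : R -> G;
  base : {linear dhomog 2 k r -> W};
  ev1 : {linear W -> dhomog 2 k r};
  T_ : {linear W -> W};
  R_approx : forall (z : R) m,
    exists n z', (n < p ^ m)%N /\ z = n%:R + p%:R ^+ m * z';
  R_digits : forall i l n (z : R), (i < p ^ n)%N -> (l < p ^ n)%N ->
    i%:R = l%:R + p%:R ^+ n * z -> i = l;
  aff_M : forall n b m c, (aff_ n b * aff_ m c)%g = aff_ (n + m) (b + p%:R ^+ n * c);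
  aff_00 : aff_ 0 0 = 1%g;
  act_PiPi : forall w, act Pi_ (act Pi_ w) = w;
  act_affPi : forall w, act (aff_ 1 0) (act Pi_ w) = act sw_ w;
  aff0_Pi : forall z, (aff_ 0 z * Pi_)%g = (Pi_ * low_ z)%g;
  low_Pi : forall z, (low_ z * Pi_)%g = (Pi_ * aff_ 0 z)%g;
  aff0_base : forall z u, act (aff_ 0 z) (base u) = base (sym_act (unip (red z)) u);
  sw_base : forall u, act sw_ (base u) = base (sym_act (swap k) u);
  low_base : forall z u, act (low_ z) (base u) = base u;
  ev1_aff0 : forall z w, ev1 (act (aff_ 0 z) w) = sym_act (unip (red z)) (ev1 w);
  ev1_sw : forall w, ev1 (act sw_ w) = sym_act (swap k) (ev1 w);
  ev1_low : forall z w, ev1 (act (low_ z) w) = ev1 w;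
  ev1_base : forall u, ev1 (base u) = u;
  ev1_aff : forall n b m c u,
    ev1 (act ((aff_ n b)^-1 * aff_ m c)%g (base u)) != 0 ->
    n = m /\ exists z, c = b + p%:R ^+ n * z;
  ev1_Pi : forall n b m c u,
    ev1 (act ((aff_ n b)^-1 * (Pi_ * aff_ m c))%g (base u)) = 0;
  ev1_eq0 : forall w, (forall n b, ev1 (act (aff_ n b)^-1%g w) = 0) ->
    (forall n b, ev1 (act (aff_ n b)^-1%g (act Pi_ w)) = 0) -> w = 0;
  tree_span : forall P : set W, lin_closed P ->
    (forall n b u, P (act (aff_ n b) (base u))) ->
    (forall n b u, P (act Pi_ (act (aff_ n b) (base u)))) -> forall w, P w;
  low_aff : forall n b, exists z, forall u,
    act (low_ 1) (act (aff_ n b) (base u)) =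
    act (aff_ n (b - p%:R * b ^+ 2 + p%:R ^+ 2 * z)) (base u);
  T_act : forall g w, T_ (act g w) = act g (T_ w);
  T_base : forall u, exists gamma : nat -> k,
    T_ (base u) = heval 0 1 u *: act Pi_ (base (sym_xr k r)) +
      \sum_(nu < p) gamma nu *: act (aff_ 1 nu%:R) (base (sym_xr k r)) }.

(** * The Hecke operator on a tree *)

Section TreeAction.
Variables (k : fieldType) (r p : nat) (R : comNzRingType).
Variables (red : {rmorphism R -> k}) (G : groupType) (W : lmodType k).
Variable X : @tree_action k r p R red G W.
Hypotheses (p_pr : prime p) (char_p : p \in [pchar k]) (r_lt_p : (r < p)%N).
Local Notation Sym := (dhomog 2 k r).
Local Notation aff := (aff_ X).
Local Notation Pi := (Pi_ X).
Local Notation T := (T_ X).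
Local Notation low := (low_ X).
Local Notation ev1 := (ev1 X).
Local Notation base := (base X).
Local Notation xr := (sym_xr k r).
Local Notation yr := (sym_act (swap k) (sym_xr k r)).
Local Notation phi := (base xr).
Local Notation N s := (sym_act (unip s)).
Implicit Types (n m : nat) (b z : R) (u v : Sym) (w : W).

Lemma unip_add s t u : N s (N t u) = N (s + t) u.
Proof.
by apply: (sym_eq char_p r_lt_p) => l; rewrite !heval_unip !mul1r addrCA addrA.
Qed.

Lemma unip0 u : N 0 u = u.
Proof. by apply: (sym_eq char_p r_lt_p) => l; rewrite heval_unip mul1r add0r. Qed.

Lemma unip_xr s : N s xr = xr.
Proof. by apply: (sym_eq char_p r_lt_p) => l; rewrite heval_unip !heval_xr. Qed.

Lemma heval01_unip s u : heval 0 1 (N s u) = heval 0 1 u.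
Proof. by rewrite heval_unip mul0r add0r. Qed.

Lemma heval01_yr : heval 0 1 yr = 1.
Proof. by rewrite heval_swap heval_xr expr1n. Qed.

Lemma heval10_xr : heval 1 0 xr = 1.
Proof. by rewrite heval_xr expr1n. Qed.

Lemma xr_neq0 : xr != 0.
Proof.
by apply: contraTneq (oner_neq0 k) => x0; rewrite -heval10_xr x0 linear0 eqxx.
Qed.

Lemma scaled_xr_eq0 a : a *: xr = 0 -> a = 0.
Proof. by move/eqP; rewrite scaler_eq0 (negPf xr_neq0) orbF => /eqP. Qed.

Lemma natr_p0 : p%:R = 0 :> k. Proof. exact: pcharf0. Qed.

Definition vertex_fun n b u : W := X (aff n b) (base u).
Local Notation E := vertex_fun.

Lemma E_linear n b : linear (E n b).
Proof. by move=> a u v; rewrite /E !linearP. Qed.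

HB.instance Definition _ n b :=
  GRing.isLinear.Build k Sym W *:%R (E n b) (E_linear n b).

Lemma aff_E n b m c u : X (aff n b) (E m c u) = E (n + m) (b + p%:R ^+ n * c) u.
Proof. by rewrite /E -rep_actM aff_M. Qed.

Lemma aff0_E c m b u : X (aff 0 c) (E m b u) = E m (b + c) u.
Proof. by rewrite aff_E expr0 mul1r add0n addrC. Qed.

Lemma E_shift n b z u : E n (b + p%:R ^+ n * z) u = E n b (N (red z) u).
Proof. by rewrite -{1}[n]addn0 -aff_E /E aff0_base. Qed.

Lemma E00 u : E 0 0 u = base u.
Proof. by rewrite /E aff_00 rep_act1. Qed.

Definition vertex_value n b w : Sym := ev1 (X (aff n b)^-1%g w).
Local Notation ev := vertex_value.

Lemma ev_linear n b : linear (ev n b).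
Proof. by move=> a u v; rewrite /ev !linearP. Qed.

HB.instance Definition _ n b :=
  GRing.isLinear.Build k W Sym *:%R (ev n b) (ev_linear n b).

Lemma aff0V z : ((aff 0 z)^-1)%g = aff 0 (- z).
Proof.
by apply: (mulgI (aff 0 z)); rewrite mulgV aff_M expr0 mul1r subrr aff_00.
Qed.

Lemma ev00 w : ev 0 0 w = ev1 w.
Proof. by rewrite /ev aff_00 invg1 rep_act1. Qed.

Lemma ev_shift n b z w : ev n (b + p%:R ^+ n * z) w = N (- red z) (ev n b w).
Proof.
rewrite /ev -{1}[n]addn0 -aff_M invgM rep_actM aff0V ev1_aff0.
by rewrite rmorphN.
Qed.

Lemma ev_aff0 n b c w : ev n b (X (aff 0 c) w) = ev n (b - c) w.
Proof.
have e : aff n b = (aff 0 c * aff n (b - c))%g.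
  by rewrite aff_M expr0 mul1r add0n addrC subrK.
by rewrite /ev e -rep_actM invgM -mulgA mulVg mulg1.
Qed.

Lemma ev_E_same n b u : ev n b (E n b u) = u.
Proof. by rewrite /ev /E -rep_actM mulVg rep_act1 ev1_base. Qed.

Lemma ev_E_shift n b z u : ev n b (E n (b + p%:R ^+ n * z) u) = N (red z) u.
Proof. by rewrite E_shift ev_E_same. Qed.

Lemma ev00_E0 c u : ev 0 0 (E 0 c u) = N (red c) u.
Proof. by rewrite -[c in E 0 c]mul1r -(expr0 p%:R) -[_ * c]add0r ev_E_shift. Qed.

Lemma ev_E_neq n b m c u : ev n b (E m c u) != 0 ->
  n = m /\ exists z, c = b + p%:R ^+ n * z.
Proof. by rewrite /ev /E -rep_actM; apply: ev1_aff. Qed.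

Lemma ev_E_level n b m c u : n != m -> ev n b (E m c u) = 0.
Proof.
by move=> nm; apply: contraNeq nm => /ev_E_neq[-> _].
Qed.

Lemma ev_PiE n b m c u : ev n b (X Pi (E m c u)) = 0.
Proof. by rewrite /ev /E -[X Pi _]rep_actM -rep_actM ev1_Pi. Qed.

Lemma ev_eq0 w : (forall n b, ev n b w = 0) ->
  (forall n b, ev n b (X Pi w) = 0) -> w = 0.
Proof. exact: ev1_eq0. Qed.

(** The functions supported on the half of the tree on the side of the base
    vertex, when the edge from it to its image under [Pi] is removed. *)
Definition half_tree : set W := lin_span [set w | exists n b u, w = E n b u].
Local Notation half := half_tree.

Lemma half_closed : lin_closed half. Proof. exact: lin_span_closed. Qed.

Lemma half_E n b u : half (E n b u).
Proof. by apply: lin_span_gen; exists n, b, u. Qed.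

Lemma half_base u : half (base u). Proof. by rewrite -E00; apply: half_E. Qed.

Lemma half_ind (P : set W) : lin_closed P -> (forall n b u, P (E n b u)) ->
  forall w, half w -> P w.
Proof. by move=> Pc PE; apply: lin_span_sub => // _ [n [b [u ->]]]. Qed.

Lemma preim_closed (V : lmodType k) (P : set V) (f : {linear W -> V}) :
  lin_closed P -> lin_closed [set w | P (f w)].
Proof.
case=> P0 Plin; split=> [|a u v /= Pu Pv]; first by rewrite /= linear0.
by rewrite linearP; apply: Plin.
Qed.

Lemma zero_closed (V : lmodType k) : lin_closed [set v : V | v = 0].
Proof. by split=> // a u v -> ->; rewrite scaler0 addr0. Qed.

Lemma ev_Pi_half n b w : half w -> ev n b (X Pi w) = 0.
Proof.
move: w; apply: half_ind => [|m c u]; last exact: ev_PiE.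
apply: (@preim_closed _ [set v | v = 0] (ev n b \o X Pi)); exact: zero_closed.
Qed.

Lemma half_aff n b w : half w -> half (X (aff n b) w).
Proof.
move: w; apply: half_ind => [|m c u]; last by rewrite aff_E; apply: half_E.
exact: (@preim_closed _ half (X (aff n b)) half_closed).
Qed.

Lemma low_E n b : exists z, forall u,
  X (low 1) (E n b u) = E n (b - p%:R * b ^+ 2 + p%:R ^+ 2 * z) u.
Proof. exact: low_aff. Qed.

Lemma half_low w : half w -> half (X (low 1) w).
Proof.
move: w; apply: half_ind => [|m c u]; last first.
  by have [z ->] := low_E m c; apply: half_E.
exact: (@preim_closed _ half (X (low 1)) half_closed).
Qed.

Lemma tree_split w : exists a a', [/\ half a, half a' & w = a + X Pi a'].
Proof.
move: w; apply: (tree_span (t := X)).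
- split; first by exists 0, 0; split; rewrite ?linear0 ?addr0 //; case: half_closed.
  move=> c _ _ [a [a' [ha ha' ->]]] [b [b' [hb hb' ->]]].
  exists (c *: a + b), (c *: a' + b'); split; [| |by rewrite linearP scalerDr addrACA].
    by case: half_closed => _; apply.
  by case: half_closed => _; apply.
- by move=> n b u; exists (E n b u), 0; rewrite linear0 addr0; split;
    [exact: half_E|case: half_closed|].
- by move=> n b u; exists 0, (E n b u); rewrite add0r; split;
    [case: half_closed|exact: half_E|].
Qed.

Lemma halfP w : (forall n b, ev n b (X Pi w) = 0) -> half w.
Proof.
have [a [a' [ha ha' ->]]] := tree_split w => evw.
rewrite [a'](_ : _ = 0) ?linear0 ?addr0 //; apply: ev_eq0 => n b.
  by have := evw n b; rewrite linearD linearD /= act_PiPi (ev_Pi_half _ _ ha) add0r.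
exact: ev_Pi_half.
Qed.

Lemma half_eq0 w : half w -> (forall n b, ev n b w = 0) -> w = 0.
Proof. by move=> hw ew; apply: ev_eq0 => // n b; apply: ev_Pi_half. Qed.

Lemma half_Pi_eq0 w : half w -> half (X Pi w) -> w = 0.
Proof.
by move=> hw hPw; apply: half_eq0 => // n b; rewrite -[w](act_PiPi X) ev_Pi_half.
Qed.

Lemma finite_level w : exists L, forall n b, (L <= n)%N -> ev n b w = 0.
Proof.
have [a [a' [ha ha' ->]]] := tree_split w.
have [L aL] : exists L, forall n b, (L <= n)%N -> ev n b a = 0.
  move: a ha; apply: half_ind.
    split; first by exists 0%N => n b _; rewrite linear0.
    move=> c u v [L uL] [M vM]; exists (maxn L M) => n b.
    by rewrite geq_max => /andP[Ln Mn]; rewrite linearP /= uL ?vM ?scaler0 ?addr0.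
  move=> m c u; exists m.+1 => n b mn; apply: ev_E_level.
  by rewrite gtn_eqF.
by exists L => n b Ln; rewrite linearD /= aL // ev_Pi_half // addr0.
Qed.

Lemma Pi_phi_low z : X (low z) (X Pi phi) = X Pi phi.
Proof. by rewrite -rep_actM low_Pi rep_actM aff0_base unip_xr. Qed.

Lemma aff_Pi_phi n b :
  X (aff n b) (X Pi phi) = if n is n'.+1 then E n' b yr else X Pi phi.
Proof.
case: n => [|n]; first by rewrite -rep_actM aff0_Pi rep_actM low_base.
have -> : aff n.+1 b = (aff n b * aff 1 0)%g by rewrite aff_M mulr0 addr0 addn1.
by rewrite rep_actM act_affPi sw_base.
Qed.

Lemma T_E n b u : exists gamma : nat -> k,
  T (E n b u) = heval 0 1 u *: (if n is n'.+1 then E n' b yr else X Pi phi) +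
    \sum_(nu < p) gamma nu *: E n.+1 (b + p%:R ^+ n * nu%:R) xr.
Proof.
have [gamma Tu] := T_base X u; exists gamma.
rewrite /E T_act Tu linearD linearZ /= aff_Pi_phi linear_sum; congr (_ + _).
by apply: eq_bigr => nu _; rewrite linearZ /= -/(E 1 _ _) aff_E addn1.
Qed.

Lemma approx0 b : exists l, (l < p)%N /\ exists z, b = l%:R + p%:R ^+ 1 * z.
Proof.
have [l [z [lp bE]]] := R_approx X b 1.
by exists l; rewrite -[p]expn1; split=> //; exists z.
Qed.

Lemma red_natp : red p%:R = 0. Proof. by rewrite rmorph_nat natr_p0. Qed.

Lemma red_add_p b n z : red (b + p%:R ^+ n.+1 * z) = red b.
Proof. by rewrite rmorphD rmorphM rmorphXn /= red_natp exprS !mul0r addr0. Qed.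

(** Each neighbour of the base vertex contributes through a linear form on
    its value: this is the Hecke operator read at one vertex. *)
Lemma ev1_T w : ev1 (T w) =
  \sum_(mu < p) heval 0 1 (ev 1 mu%:R w) *: N mu%:R yr +
  heval 0 1 (ev1 (X Pi w)) *: xr.
Proof.
move: w; apply: (tree_span (t := X)).
- split=> [|a u v IHu IHv].
    rewrite !linear0 big1 ?scale0r ?addr0 // => mu _.
    by rewrite !linear0 scale0r.
  rewrite !linearP /= IHu IHv scalerDr scaler_sumr scalerDl addrACA; congr (_ + _).
    rewrite -big_split; apply: eq_bigr => mu _ /=.
    by rewrite !linearP /= scalerDl scalerA.
  by rewrite scalerA.
- move=> m c u; rewrite -/(E m c u); have [gamma ->] := T_E m c u.
  rewrite linearD linear_sum /= [X in _ + X]big1 ?addr0; last first.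
    by move=> nu _; rewrite linearZ /= -ev00 ev_E_level // scaler0.
  rewrite -[ev1 (X Pi _)]ev00 ev_PiE linear0 scale0r addr0 linearZ /=.
  case: m => [|m].
    rewrite -E00 -ev00 ev_PiE scaler0 big1 // => mu _.
    by rewrite ev_E_level // linear0 scale0r.
  rewrite -ev00; case: m => [|m]; last first.
    rewrite ev_E_level // scaler0 big1 // => mu _.
    by rewrite ev_E_level // linear0 scale0r.
  have [l [lp [z cE]]] := approx0 c.
  have rc : red c = l%:R by rewrite cE red_add_p rmorph_nat.
  have e1 : ev 1 l%:R (E 1 c u) = N (red z) u by rewrite cE ev_E_shift.
  rewrite ev00_E0 rc (bigD1 (Ordinal lp)) //= e1 heval01_unip big1 ?addr0 //.
  move=> i il; have [->|/ev_E_neq[_ [z' cE']]] := eqVneq (ev 1 i%:R (E 1 c u)) 0.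
    by rewrite linear0 scale0r.
  case/negP: il; apply/eqP/val_inj/(natr_inj_lt_char char_p) => //=.
  by rewrite -rc cE' red_add_p rmorph_nat.
- move=> m c u; rewrite -/(E m c u) T_act act_PiPi.
  rewrite big1 ?add0r => [|mu _]; last by rewrite ev_PiE linear0 scale0r.
  have [gamma ->] := T_E m c u.
  rewrite linearD linear_sum linearD linear_sum /= [X in _ + X]big1 ?addr0; last first.
    by move=> nu _; rewrite !linearZ /= -ev00 ev_PiE scaler0.
  rewrite !linearZ /=; case: m => [|m].
    by rewrite act_PiPi ev1_base -ev00 ev00_E0 heval01_unip.
  by rewrite -!ev00 ev_PiE ev_E_level // scaler0 linear0 scale0r.
Qed.

(** [ev1_T] moved to the other vertices. The parent of [aff n.+1 b] is seen
    through the coefficient of [x^r] and its children through that of [y^r],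
    because the Weyl element exchanges the two directions. *)
Lemma ev_T n b w : ev n b (T w) =
  \sum_(mu < p) heval 0 1 (ev n.+1 (b + p%:R ^+ n * mu%:R) w) *: N mu%:R yr +
  (if n is n'.+1 then heval 1 0 (ev n' b w) else heval 0 1 (ev 0 0 (X Pi w))) *: xr.
Proof.
rewrite /ev -T_act ev1_T; congr (_ + _ *: _).
  apply: eq_bigr => mu _; congr (heval _ _ _ *: _).
  by rewrite /ev -rep_actM -invgM aff_M addn1.
case: n => [|n].
  rewrite aff0V -rep_actM.
  have -> : (Pi * aff 0 (- b))%g = (low (- b) * Pi)%g by rewrite low_Pi.
  by rewrite rep_actM ev1_low aff_00 invg1 rep_act1.
have -> : aff n.+1 b = (aff n b * aff 1 0)%g by rewrite aff_M mulr0 addr0 addn1.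
rewrite invgM rep_actM; set x := X (aff n b)^-1%g w.
set y := X Pi _; have -> : x = X (sw_ X) y.
  by rewrite -act_affPi act_PiPi -rep_actM mulgV rep_act1.
by rewrite ev1_sw heval_swap.
Qed.

Lemma ev_determined n w : (forall b, heval 1 0 (ev n b w) = 0) ->
  forall b, ev n b w = 0.
Proof.
move=> ew b; apply: (sym_eq char_p r_lt_p) => l; rewrite linear0.
have := ew (b + p%:R ^+ n * - l%:R); rewrite ev_shift heval_unip.
by rewrite rmorphN opprK rmorph_nat mul1r addr0.
Qed.

(** The outward part of [T] is injective, so [T w] reaches strictly further than
    [w]. *)
Lemma level_T L w : (forall n b, (L <= n)%N -> ev n.+1 b (T w) = 0) ->
  forall n b, (L <= n)%N -> ev n b w = 0.
Proof.
move=> eT; have [L0 wL0] := finite_level w.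
suff main j : forall n b, (L <= n)%N -> (L0 <= n + j)%N -> ev n b w = 0.
  by move=> n b Ln; apply: (main L0) => //; rewrite leq_addl.
elim: j => [|j IHj] n b Ln; first by rewrite addn0; apply: wL0.
move=> L0n; move: b; apply: ev_determined => b; apply: scaled_xr_eq0.
have := eT n b Ln; rewrite ev_T big1 ?add0r // => mu _.
by rewrite IHj ?linear0 ?scale0r //; lia.
Qed.

Lemma ev_Sn_base n b u : ev n.+1 b (base u) = 0.
Proof. by rewrite -E00 ev_E_level. Qed.

Lemma ev_Pi_base n b u : ev n b (X Pi (base u)) = 0.
Proof. by rewrite -E00 ev_PiE. Qed.

Lemma ev1_phi : ev1 phi = xr. Proof. exact: ev1_base. Qed.

(** A combination of [phi] and [Pi phi] lives at the two ends of the central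
    edge, while [T] moves supports outwards. *)
Lemma phi_Pi_phi_indep a c f : a *: phi + c *: X Pi phi = T f -> a = 0 /\ c = 0.
Proof.
move=> Tf; have T_Pif : T (X Pi f) = a *: X Pi phi + c *: phi.
  by rewrite T_act -Tf linearD !linearZ /= act_PiPi.
have f0 : f = 0.
  apply: ev_eq0 => n b; apply: (@level_T 0) => // {}n {}b _.
    by rewrite -Tf linearD !linearZ /= ev_Sn_base ev_Pi_base !scaler0 addr0.
  by rewrite T_Pif linearD !linearZ /= ev_Sn_base ev_Pi_base !scaler0 addr0.
move: Tf T_Pif; rewrite f0 !linear0 => Tf T_Pif.
split; apply: scaled_xr_eq0.
  have := congr1 (ev 0 0) Tf; rewrite linear0 linearD !linearZ /=.
  by rewrite ev_Pi_base scaler0 addr0 ev00 ev1_phi.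
have := congr1 (ev 0 0) T_Pif; rewrite linear0 linearD !linearZ /=.
by rewrite ev_Pi_base scaler0 add0r ev00 ev1_phi.
Qed.

(** Only the edge between the two halves lets [T] leave a half, and it does so
    along [Pi phi]. *)
Lemma T_half w : half w -> exists a c, half a /\ T w = a + c *: X Pi phi.
Proof.
move: w; apply: half_ind.
  split; first by exists 0, 0; rewrite !linear0 scale0r addr0; case: half_closed.
  move=> d u v /= [a [c [ha Tu]]] [a' [c' [ha' Tv]]].
  exists (d *: a + a'), (d * c + c'); split; first by case: half_closed => _; apply.
  by rewrite linearP /= Tu Tv scalerDr scalerDl scalerA addrACA.
move=> n b u; have [gamma ->] := T_E n b u.
have hs : half (\sum_(nu < p) gamma nu *: E n.+1 (b + p%:R ^+ n * nu%:R) xr).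
  apply: (lin_closed_sum _ half_closed) => nu _.
  by apply: (lin_closedZ _ half_closed); apply: half_E.
case: n hs => [|n] hs.
  by eexists; exists (heval 0 1 u); split; [exact: hs|rewrite addrC].
exists (heval 0 1 u *: E n b yr + \sum_(nu < p)
  gamma nu *: E n.+2 (b + p%:R ^+ n.+1 * nu%:R) xr), 0; rewrite scale0r addr0.
split=> //; apply: (lin_closedD half_closed) => //.
by apply: (lin_closedZ _ half_closed); apply: half_E.
Qed.

(** Beyond the central edge, [T f] only sees the coefficient of [y^r] at the base
    vertex. *)
Lemma half_T f : half (T f) -> half f /\ heval 0 1 (ev 0 0 f) = 0.
Proof.
move=> hT; have hf : half f.
  apply: halfP => n b; apply: (@level_T 0) => // {}n {}b _.
  by rewrite T_act ev_Pi_half.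
split=> //; apply: scaled_xr_eq0.
have := ev_Pi_half 0 0 hT; rewrite -T_act ev_T act_PiPi big1 ?add0r // => mu _.
by rewrite ev_Pi_half // linear0 scale0r.
Qed.

(** Up to a scalar, the only linear form on the functions at distance [n] that is
    invariant under [aff 0 1]. *)
Definition level_trace n w : k := \sum_(b < p ^ n) heval 0 1 (ev n b%:R w).
Local Notation Lam := level_trace.

Lemma Lam_aff0 n w : Lam n (X (aff 0 1) w) = Lam n w.
Proof.
pose F (b : nat) := heval 0 1 (ev n (b%:R - 1) w).
rewrite /Lam; transitivity (\sum_(b < p ^ n) F b).
  by apply: eq_bigr => b _; rewrite ev_aff0.
rewrite -sum_cyclic.
  by apply: eq_bigr => b _; rewrite /F -natr1 addrK.
rewrite /F natrX addrC -{1}[p%:R ^+ n]mulr1 ev_shift heval01_unip.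
by rewrite add0r.
Qed.

Lemma heval_deg0 x y u : r = 0%N -> heval x y u = heval 1 0 u.
Proof.
move=> r0; rewrite -[u](dehomK) !heval_hsym; apply: eq_bigr => i _.
have i0 : (i : nat) = 0%N.
  apply/eqP; rewrite -leqn0; have := ltn_ord i; rewrite ltnS => ir.
  by apply: leq_trans ir _; rewrite r0.
have xr0 (c : k) : c ^+ r = 1 by rewrite r0 expr0.
by rewrite i0 subn0 !xr0 !expr0.
Qed.

Lemma heval01_xr : r != 0%N -> heval 0 1 xr = 0.
Proof. by rewrite heval_xr expr0n => /negPf ->. Qed.

(** The trace does not see what [T] carries outwards: these values are multiples
    of [x^r], whose coefficient of [y^r] vanishes unless [r = 0], and when
    [r = 0] each of them occurs [p] times. *)
Lemma Lam_T n f : half f -> Lam n (T f) = Lam n.+1 f.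
Proof.
move=> hf; rewrite /Lam.
under eq_bigr => b _ do rewrite ev_T linearD linear_sum /=.
rewrite big_split /= [X in _ + X](_ : _ = 0) ?addr0.
  rewrite expnSr (sum_digits _ _ (fun l => heval 0 1 (ev n.+1 l%:R f))).
  apply: eq_bigr => b _; apply: eq_bigr => mu _.
  rewrite linearZ /= heval01_unip heval01_yr mulr1.
  by rewrite natrD natrM natrX.
case: n => [|n].
  by rewrite big1 // => b _; rewrite ev_Pi_half // linear0 scale0r linear0.
under eq_bigr => b _ do rewrite linearZ /=.
rewrite -mulr_suml; have [r0|r0] := eqVneq r 0%N; last by rewrite heval01_xr // mulr0.
rewrite expnSr (sum_digits _ _ (fun l => heval 1 0 (ev n l%:R f))) exchange_big /=.
rewrite (eq_bigr (fun=> \sum_(b < p ^ n) heval 1 0 (ev n b%:R f))).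
  by rewrite sumr_const card_ord -[_ *+ p]mulr_natr natr_p0 mulr0 mul0r.
move=> j _; apply: eq_bigr => i _.
rewrite natrD natrM natrX ev_shift heval_unip heval_deg0 // .
Qed.

Definition tree_level n : set W := lin_span [set w | exists b u, w = E n b u].

Lemma level_ind n (P : set W) : lin_closed P -> (forall b u, P (E n b u)) ->
  forall w, tree_level n w -> P w.
Proof. by move=> Pc PE; apply: lin_span_sub => // _ [b [u ->]]. Qed.

Lemma level_closed n : lin_closed (tree_level n). Proof. exact: lin_span_closed. Qed.

Lemma level_E n b u : tree_level n (E n b u).
Proof. by apply: lin_span_gen; exists b, u. Qed.

Lemma half_level n w : tree_level n w -> half w.
Proof. by apply: (level_ind half_closed) => b u; apply: half_E. Qed.

Lemma ev_level n m b w : tree_level n w -> m != n -> ev m b w = 0.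
Proof.
move=> lw mn; move: w lw; apply: level_ind => [|c u]; last exact: ev_E_level.
exact: (@preim_closed _ [set v | v = 0] (ev m b) (@zero_closed _)).
Qed.

Definition level_sum n (g : nat -> Sym) : W := \sum_(b < p ^ n) E n b%:R (g b).

Lemma level_sum_in_level n g : tree_level n (level_sum n g).
Proof. by apply: (lin_closed_sum _ (level_closed n)) => b _; apply: level_E. Qed.

Lemma ev_level_sum_nat n g l : (l < p ^ n)%N -> ev n l%:R (level_sum n g) = g l.
Proof.
move=> lp; rewrite linear_sum (bigD1 (Ordinal lp)) //= ev_E_same.
rewrite big1 ?addr0 // => i il.
have [//|/ev_E_neq[_ [z iE]]] := eqVneq (ev n l%:R (E n i%:R (g i))) 0.
case/negP: il; apply/eqP/val_inj => /=.
exact: (R_digits X _ _ iE).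
Qed.

Lemma ev_level_sum n w b : ev n b (level_sum n (fun l => ev n l%:R w)) = ev n b w.
Proof.
have [l [z [lp ->]]] := R_approx X b n.
by rewrite !ev_shift ev_level_sum_nat.
Qed.

(** [aff 0 1] acts on each level as a single Jordan block. Modulo the image of
    [aff 0 1 - 1] all the values can be moved to the vertex [aff n 0], and going
    once around the level acts there by the unipotent. *)
Lemma level_diff_surj n (g : nat -> Sym) : \sum_(b < p ^ n) heval 0 1 (g b) = 0 ->
  exists h, tree_level n h /\ X (aff 0 1) h - h = level_sum n g.
Proof.
move=> g0; pose D : set W := [set w | exists h, tree_level n h /\ X (aff 0 1) h - h = w].
have Dc : lin_closed D.
  split; first by exists 0; rewrite linear0 subr0; split=> //; case: (level_closed n).
  move=> a _ _ [h [lh <-]] [h' [lh' <-]]; exists (a *: h + h'); split.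
    by case: (level_closed n) => _; apply.
  by rewrite linearP scalerBr opprD addrACA.
have shift (l : nat) u : D (E n l%:R u - E n 0 u).
  elim: l => [|l IHl]; first by rewrite subrr; case: Dc.
  rewrite -(subrK (E n l%:R u) (E n l.+1%:R u)) -addrA; apply: (lin_closedD Dc) => //.
  by exists (E n l%:R u); split; [exact: level_E|rewrite aff0_E natr1].
have [v vE] : exists v, \sum_(b < p ^ n) g b = N 1 v - v.
  by apply: (unip_diff_surj char_p r_lt_p); rewrite linear_sum.
have -> : level_sum n g = \sum_(b < p ^ n) (E n b%:R (g b) - E n 0 (g b)) +
    (E n (p ^ n)%:R v - E n 0 v).
  rewrite sumrB -addrA -[LHS]addr0; congr (_ + _).
  rewrite natrX -[p%:R ^+ n]mulr1 -[p%:R ^+ n * 1]add0r E_shift rmorph1.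
  by rewrite -linearB /= -vE [E n 0 _]linear_sum addNr.
by apply: (lin_closedD Dc) => //; apply: (lin_closed_sum _ Dc) => b _.
Qed.

Variables (V : lmodType k) (pr : {linear W -> V}).
Hypothesis pr_ker : forall w, pr w = 0 <-> exists f, w = T f.

Lemma pr_T f : pr (T f) = 0. Proof. by apply/pr_ker; exists f. Qed.

(** This is the space of invariants of the pro-p Iwahori subgroup; see
    [invariants_soc]. *)
Definition soc : set V := [set v | exists a c, v = a *: pr phi + c *: pr (X Pi phi)].

Lemma soc_closed : lin_closed soc.
Proof.
split; first by exists 0, 0; rewrite !scale0r addr0.
move=> e _ _ [a [c ->]] [a' [c' ->]]; exists (e * a + a'), (e * c + c').
by rewrite scalerDr !scalerA !scalerDl addrACA.
Qed.

Lemma soc_phi : soc (pr phi).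
Proof. by exists 1, 0; rewrite scale1r scale0r addr0. Qed.

Lemma soc_Pi_phi : soc (pr (X Pi phi)).
Proof. by exists 0, 1; rewrite scale1r scale0r add0r. Qed.

(** If [a - Pi a' = T f], cut [f] along the central edge: by [T_half], the two
    sides of the equation only interact through [phi] and [Pi phi]. *)
Lemma half_inter a a' : half a -> half a' -> pr a = pr (X Pi a') -> soc (pr a).
Proof.
move=> ha ha' e; have [f fE] : exists f, a - X Pi a' = T f.
  by apply/pr_ker; rewrite linearB /= e subrr.
have [f0 [f1 [hf0 hf1 fD]]] := tree_split f.
have [b [c [hb Tf0]]] := T_half hf0; have [b' [c' [hb' Tf1]]] := T_half hf1.
have z : a - b - c' *: phi = 0.
  apply: half_Pi_eq0.
    apply: (lin_closedB half_closed); first exact: (lin_closedB half_closed).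
    by apply: (lin_closedZ _ half_closed); apply: half_base.
  have -> : X Pi (a - b - c' *: phi) = a' + b' + c *: phi.
    rewrite -[RHS](act_PiPi X); congr (X Pi _).
    have -> : X Pi (a' + b' + c *: phi) = X Pi a' + X Pi b' + c *: X Pi phi.
      by rewrite !linearD linearZ.
    have ePi : X Pi (b' + c' *: X Pi phi) = X Pi b' + c' *: phi.
      by rewrite linearD linearZ /= act_PiPi.
    move: fE; rewrite fD linearD /= T_act Tf0 Tf1 ePi.
    move=> /eqP; rewrite subr_eq => /eqP ->; apply/eqP; rewrite !subr_eq; apply/eqP.
    by rewrite [LHS](AC (2*2*1) (5*3*2*4*1)).
  apply: (lin_closedD half_closed); first exact: (lin_closedD half_closed).
  by apply: (lin_closedZ _ half_closed); apply: half_base.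
have -> : a = b + c' *: phi.
  by apply/eqP; rewrite -subr_eq0 opprD addrA z.
exists c', (- c); rewrite linearD linearZ /= addrC; congr (_ + _).
have := pr_T f0; rewrite Tf0 linearD linearZ /= => /eqP.
by rewrite addr_eq0 scaleNr => /eqP.
Qed.

Lemma aff01_Pi_phi : X (aff 0 1) (X Pi phi) = X Pi phi.
Proof. by rewrite aff_Pi_phi. Qed.

Lemma aff01_phi : X (aff 0 1) phi = phi.
Proof. by rewrite aff0_base unip_xr. Qed.

(** Going once around the level, the common value is its own translate under the
    unipotent, hence a multiple of [x^r]. *)
Lemma constant_ev n w : (forall b, ev n (b - 1) w = ev n b w) ->
  exists c, forall b, ev n b w = c *: xr.
Proof.
move=> ew; have enat (l : nat) : ev n l%:R w = ev n 0 w.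
  by elim: l => // l <-; rewrite -natr1 -ew addrK.
have fix1 : N 1 (ev n 0 w) = ev n 0 w.
  have := ev_shift n 0 1 w; rewrite add0r mulr1 -natrX enat rmorph1.
  by move=> {1}->; rewrite unip_add subrr unip0.
exists (heval 1 0 (ev n 0 w)) => b.
have [l [z [_ ->]]] := R_approx X b n.
rewrite ev_shift enat {1}(unip_fixed char_p r_lt_p fix1).
by rewrite linearZ /= unip_xr.
Qed.

Lemma Lam_fixed n a f : half f -> heval 0 1 (ev 0 0 f) = 0 ->
  X (aff 0 1) a - a = T f -> Lam n f = 0.
Proof.
case: n => [|n] hf f0 Tf; first by rewrite /Lam expn0 big_ord1.
rewrite -Lam_T // -Tf /Lam; under eq_bigr do rewrite linearB linearB /=.
by rewrite sumrB -/(Lam _ _) -/(Lam _ _) Lam_aff0 subrr.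
Qed.

(** Descent on the level. By [Lam_fixed] the top component of [f] has trace zero,
    so it is the image under [aff 0 1 - 1] of some [h]; the top component of
    [a - T h] is then constant, equal to a multiple of [x^r], and so is the top
    component of [T h'] for a suitable constant [h']. Subtracting both lowers the
    level. At the base vertex, a fixed value is a multiple of [x^r]. *)
Lemma fixed_half_level n a f : half a -> (forall m b, (n < m)%N -> ev m b a = 0) ->
  X (aff 0 1) a - a = T f -> soc (pr a).
Proof.
elim: n a f => [|n IHn] a f ha ea Tf.
  have ef m b : ev m.+1 b (T f) = 0 by rewrite -Tf linearB /= ev_aff0 !ea // subrr.
  have hTf : half (T f).
    by rewrite -Tf; apply: (lin_closedB half_closed) => //; apply: half_aff.
  have [hf _] := half_T hTf.
  have f0 : f = 0 by apply: half_eq0 => // m b; apply: (@level_T 0).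
  have [b|c ec] := @constant_ev 0 a.
    by apply/eqP; rewrite -subr_eq0 -ev_aff0 -linearB /= Tf f0 !linear0.
  have -> : a = c *: phi.
    apply/eqP; rewrite -subr_eq0; apply/eqP; apply: half_eq0.
      apply: (lin_closedB half_closed) => //.
      by apply: (lin_closedZ _ half_closed); apply: half_base.
    move=> [|m] b; last by rewrite linearB linearZ /= ea // ev_Sn_base scaler0 subr0.
    rewrite linearB linearZ /= ec -E00 -[b]mulr1 -[b * 1]add0r mulrC -(expr0 p%:R).
    by rewrite ev_shift ev_E_same unip_xr subrr.
  by rewrite linearZ; apply: (lin_closedZ _ soc_closed); apply: soc_phi.
have hTf : half (T f).
  by rewrite -Tf; apply: (lin_closedB half_closed) => //; apply: half_aff.
have [hf cf0] := half_T hTf.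
have ef m b : (n < m)%N -> ev m b f = 0.
  move=> nm; apply: (@level_T n.+1) => // {nm} m' {}b nm.
  by rewrite -Tf linearB /= ev_aff0 !ea // subrr.
have Lf := Lam_fixed n hf cf0 Tf.
have [h [lh hE]] := @level_diff_surj n (fun l => ev n l%:R f) Lf.
have ev_a1 b : ev n.+1 (b - 1) (a - T h) = ev n.+1 b (a - T h).
  apply/eqP; rewrite -subr_eq0 -ev_aff0 -linearB /=.
  have -> : X (aff 0 1) (a - T h) - (a - T h) =
      T (f - level_sum n (fun l => ev n l%:R f)).
    have e1 : T (f - (X (aff 0 1) h - h)) = T f - (X (aff 0 1) (T h) - T h).
      by rewrite linearB [T (_ - h)]linearB /= T_act.
    by rewrite -hE e1 -Tf linearB !opprB [LHS](AC (2*2) ((1*4)*(3*2))).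
  rewrite ev_T big1 ?add0r /= => [|mu _].
    by rewrite linearB /= ev_level_sum subrr linear0 scale0r.
  rewrite linearB /= ef // (ev_level _ (level_sum_in_level _ _)) ?subr0 ?linear0 ?scale0r //.
  by rewrite neq_ltn ltnS leqnSn orbT.
have [c ec] := constant_ev ev_a1.
pose h' := c *: level_sum n (fun=> xr); pose H := h + h'.
have eh' b : ev n b h' = c *: xr.
  have [l [z [lp ->]]] := R_approx X b n.
  by rewrite linearZ /= ev_shift ev_level_sum_nat // unip_xr.
have lH : tree_level n H.
  apply: (lin_closedD (level_closed n)) => //.
  by apply: (lin_closedZ _ (level_closed n)); apply: level_sum_in_level.
have lh' : tree_level n h'.
  by apply: (lin_closedZ _ (level_closed n)); apply: level_sum_in_level.
have [a' [d [ha' TH]]] := T_half (half_level lH).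
have aE : a - a' = a - T H + d *: X Pi phi by rewrite TH opprD addrA addrNK.
have pra : pr a = pr (a - a') - d *: pr (X Pi phi).
  by rewrite aE linearD linearB linearZ /= pr_T subr0 addrK.
rewrite pra; apply: (lin_closedB soc_closed); last first.
  by apply: (lin_closedZ _ soc_closed); apply: soc_Pi_phi.
apply: (IHn _ (f - (X (aff 0 1) H - H))); first exact: (lin_closedB half_closed).
  move=> m b nm; rewrite aE linearD linearZ /= ev_Pi_base scaler0 addr0.
  have [mn|mn] := eqVneq m n.+1.
    have -> : a - T H = a - T h - T h' by rewrite /H linearD opprD addrA.
    rewrite mn linearB /= ec ev_T big1 ?add0r ?eh' => [|mu _].
      by rewrite [heval 1 0 _]linearZ /= heval10_xr mulr1 subrr.
    by rewrite (ev_level _ lh') ?linear0 ?scale0r // neq_ltn ltnS leqnSn orbT.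
  rewrite linearB /= ea ?sub0r; last first.
    by rewrite ltn_neqAle eq_sym mn.
  case: m nm mn => // m nm mn; rewrite ev_T big1 ?add0r => [|mu _].
    by rewrite (ev_level _ lH) ?linear0 ?scale0r ?oppr0 //; apply: contraNneq mn => ->.
  by rewrite (ev_level _ lH) ?linear0 ?scale0r //; lia.
have -> : T (f - (X (aff 0 1) H - H)) = T f - (X (aff 0 1) (T H) - T H).
  by rewrite linearB [T (_ - H)]linearB /= T_act.
have -> : X (aff 0 1) (a - a') = X (aff 0 1) a - X (aff 0 1) (T H) + d *: X Pi phi.
  by rewrite aE linearD linearB linearZ /= aff01_Pi_phi.
by rewrite aE opprD addrACA subrr addr0 -Tf !opprB [LHS](AC (2*2) ((1*4)*(3*2))).
Qed.

Lemma fixed_half a f : half a -> X (aff 0 1) a - a = T f -> soc (pr a).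
Proof.
move=> ha; have [L aL] := finite_level a.
by apply: (@fixed_half_level L) => // m b Lm; apply: aL; apply: ltnW.
Qed.

Lemma ev0_base b v : ev 0 b (base v) = N (- red b) v.
Proof. by have := ev_shift 0 0 b (base v); rewrite add0r expr0 mul1r ev00 ev1_base. Qed.

Lemma T_base_coef v : T (base v) = heval 0 1 v *: X Pi phi +
  \sum_(nu < p) heval 1 (- nu%:R) v *: E 1 nu%:R xr.
Proof.
have [gamma Tv] := T_base X v; rewrite Tv; congr (_ + _).
apply: eq_bigr => nu _; congr (_ *: _).
have := ev_T 1 nu%:R (base v); rewrite big1 ?add0r => [|mu _]; last first.
  by rewrite ev_Sn_base linear0 scale0r.
rewrite ev0_base rmorph_nat heval_unip mul1r addr0 Tv linearD linearZ /=.
rewrite ev_Pi_base scaler0 add0r.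
rewrite linear_sum (bigD1 nu) //= linearZ /= ev_E_same big1 ?addr0.
  move=> /eqP; rewrite -subr_eq0 -scalerBl => /eqP/scaled_xr_eq0/eqP.
  by rewrite subr_eq0 => /eqP.
move=> i inu; rewrite linearZ /=.
have [->|/ev_E_neq[_ [z iE]]] := eqVneq (ev 1 nu%:R (E 1 i%:R xr)) 0.
  by rewrite scaler0.
by case/negP: inu; apply/eqP/val_inj; apply: (R_digits X _ _ iE); rewrite expn1.
Qed.

Lemma E1_p u : E 1 p%:R u = E 1 0 (N 1 u).
Proof. by rewrite -(rmorph1 red) -E_shift add0r mulr1. Qed.

Lemma E_xr_shift n b z : E n (b + p%:R ^+ n * z) xr = E n b xr.
Proof. by rewrite E_shift unip_xr. Qed.

Lemma telescope_aff01 n b u :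
  X (aff 0 1) (\sum_(l < n) E 1 (b + l%:R) u) - \sum_(l < n) E 1 (b + l%:R) u =
  E 1 (b + n%:R) u - E 1 b u.
Proof.
rewrite linear_sum -sumrB /=.
under eq_bigr => l _ do rewrite aff0_E -addrA natr1.
by rewrite -(big_mkord xpredT (fun l => E 1 (b + l.+1%:R) u - E 1 (b + l%:R) u))
  telescope_sumr // addr0.
Qed.

Lemma low_E1_xr b : X (low 1) (E 1 b xr) = E 1 b xr.
Proof.
have [z ->] := low_E 1 b; have -> : b - p%:R * b ^+ 2 + p%:R ^+ 2 * z =
  b + p%:R ^+ 1 * (- b ^+ 2 + p%:R * z) by ring.
exact: E_xr_shift.
Qed.

(** The form [x^(r-1) y], on which unipotents act by adding multiples of
    [x^r]. *)
Definition sym_xy : Sym := hsym r 'X.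

Lemma unip_sym_xy s : (0 < r)%N -> N s sym_xy = sym_xy + s *: xr.
Proof.
move=> r0; apply: (sym_eq char_p r_lt_p) => l.
have sX : (size ('X : {poly k}) <= r.+1)%N by rewrite size_polyX.
rewrite heval_unip linearD linearZ /= !heval1_hsym // !hornerX heval_xr.
by rewrite mul1r expr1n mulr1 addrC.
Qed.

Definition over_line (y : V) : set W := [set w | exists c, pr w = c *: y].

Lemma over_line_closed (y : V) : lin_closed (over_line y).
Proof.
split; first by exists 0; rewrite linear0 scale0r.
move=> a u v [c uE] [d vE]; exists (a * c + d).
by rewrite linearP /= uE vE scalerDl scalerA.
Qed.

(** When [r = p - 1] every function on the prime field comes from a form. For the
    indicator of one point, [T (base v)] relates a single neighbour of the base
    vertex to [Pi phi]. *)
Lemma pr_E1_xr b : r = p.-1 -> pr (E 1 b xr) = pr (X Pi phi).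
Proof.
move=> rp; have [l [lp [z ->]]] := approx0 b; rewrite E_xr_shift.
have p1 := prime_gt1 p_pr; have r0 : (0 < r)%N by rewrite rp; lia.
(* By Fermat's little theorem, [q] is the indicator of [- l] on the prime
   field. *)
pose q : {poly k} := 1 - ('X + l%:R%:P) ^+ r.
have sq : size (('X + l%:R%:P) ^+ r : {poly k}) = r.+1.
  by rewrite -(opprK l%:R%:P) -polyCN size_exp_XsubC.
have qs : (size q <= r.+1)%N.
  by rewrite (leq_trans (size_polyD _ _)) // geq_max size_poly1 size_polyN sq leqnn.
have := pr_T (base (hsym r q)); rewrite T_base_coef heval01_hsym.
rewrite (bigD1 (Ordinal lp)) //= big1 ?addr0 => [|i il]; last first.
  rewrite heval1_hsym // /q !hornerE [X in 1 - X](_ : _ = 1) ?subrr ?scale0r //.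
  have x0 : - i%:R + l%:R != 0 :> k.
    rewrite addrC subr_eq0; apply: contraNneq il => il.
    by apply/eqP/val_inj/(natr_inj_lt_char char_p); rewrite //= il.
  apply: (mulfI x0); rewrite mulr1 -exprS rp prednK ?prime_gt0 //.
  have -> : - i%:R + l%:R = (p - i + l)%:R :> k.
    by rewrite natrD natrB ?natr_p0 ?sub0r // ltnW.
  exact: (pFrobenius_aut_nat char_p).
have -> : q`_r = -1.
  have lc : ('X + l%:R%:P) ^+ r \is @monic k.
    by rewrite -(opprK l%:R%:P) -polyCN monic_exp // monicXsubC.
  move: lc; rewrite monicE lead_coefE sq /= => /eqP lc.
  by rewrite coefB coef1 lc gtn_eqF // sub0r.
rewrite heval1_hsym // /q !hornerE addNr expr0n gtn_eqF //= subr0 scale1r scaleN1r.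
by rewrite linearD linearN /= => /eqP; rewrite addrC subr_eq0 => /eqP.
Qed.

(** Under [aff 0 1] alone, the image of the half is the sum of two uniserial
    modules, with socles spanned by [phi] and [Pi phi]. Such a [w] lifts a
    generator of the second layer of the one with socle [y]. *)
Definition second_layer (y : V) (d : k) (w : W) : Prop :=
  [/\ half w, pr (X (aff 0 1) w - w) = y & pr (X (low 1) w - w) = d *: y].

(** For [r < p - 1], the neighbours are weighted by [(-l)^(r+1)]: the differences
    of these weights are the values of a form of degree [r], so that [T] turns
    them into a multiple of [Pi phi]. For [r = p - 1], the sum over the
    neighbours of the functions with value [x^(r-1) y] telescopes to a single
    neighbour, to which [pr_E1_xr] applies. *)
Lemma second_layer_odd :
  exists w d, second_layer (pr (X Pi phi)) d w /\ (r = 0%N -> d = 0).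
Proof.
have hsum (c : nat -> k) u : half (\sum_(l < p) c l *: E 1 l%:R u).
  apply: (lin_closed_sum _ half_closed) => l _.
  by apply: (lin_closedZ _ half_closed); apply: half_E.
have [rp|rp] := eqVneq r p.-1.
  have p1 := prime_gt1 p_pr; have r0 : (0 < r)%N by rewrite rp; lia.
  pose w := \sum_(l < p) E 1 (0 + l%:R) sym_xy.
  have [d dE] : over_line (pr (X Pi phi)) (X (low 1) w - w).
    rewrite /w linear_sum -sumrB.
    apply: (lin_closed_sum _ (over_line_closed _)) => l _ /=.
    have [z ->] := low_E 1 (0 + l%:R); rewrite add0r; set b := l%:R.
    have -> : b - p%:R * b ^+ 2 + p%:R ^+ 2 * z =
      b + p%:R ^+ 1 * (- b ^+ 2 + p%:R * z) by ring.
    rewrite E_shift unip_sym_xy // [E 1 b _]linearD linearZ /= addrAC subrr add0r.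
    by eexists; rewrite linearZ /= pr_E1_xr.
  exists w, d; split; last by move=> r1; rewrite r1 in r0.
  split=> //.
    rewrite /w; have := hsum (fun=> 1) sym_xy.
    by under eq_bigr do rewrite scale1r -[_%:R]add0r.
  rewrite telescope_aff01 add0r E1_p unip_sym_xy //.
  by rewrite [E 1 0 _]linearD scale1r /= addrAC subrr add0r pr_E1_xr.
have r1p : (r.+1 < p)%N by have := prime_gt0 p_pr; move/eqP: rp; lia.
pose w := \sum_(l < p) (- l%:R) ^+ r.+1 *: E 1 l%:R xr.
have c0 : - r.+1%:R != 0 :> k by rewrite oppr_eq0 (natr_neq0_lt_char char_p).
exists ((- r.+1%:R)^-1 *: w), 0; split=> //; split.
- by apply: (lin_closedZ _ half_closed); apply: (hsum (fun l => (- l%:R) ^+ r.+1)).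
- pose q : {poly k} := pdiff 'X^(r.+1); pose v := hsym r q.
  have qs : (size q <= r.+1)%N by rewrite size_pdiff // size_polyXn.
  have qr : q`_r = r.+1%:R.
    by rewrite coef_pdiff_top ?size_polyXn // coefXn eqxx mulr1.
  have wE : X (aff 0 1) w - w = T (base v) - r.+1%:R *: X Pi phi.
    rewrite T_base_coef heval01_hsym qr [RHS]addrAC subrr add0r.
    pose F l := (- l%:R + 1) ^+ r.+1 *: E 1 l%:R xr.
    have -> : X (aff 0 1) w = \sum_(l < p) F l.
      rewrite -sum_cyclic; last first.
        by rewrite /F natr_p0 oppr0 E1_p unip_xr.
      rewrite linear_sum; apply: eq_bigr => l _ /=.
      rewrite /F linearZ /= aff0_E natr1; congr (_ ^+ _ *: _).
      by rewrite -natr1 opprD addrNK.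
    rewrite -sumrB; apply: eq_bigr => l _.
    by rewrite -scalerBl heval1_hsym // horner_pdiff !hornerXn.
  rewrite linearZ /= -scalerBr linearZ /= wE linearB linearZ /= pr_T sub0r.
  by rewrite -scaleNr scalerA mulVf // scale1r.
- rewrite linearZ /= -scalerBr scale0r; apply/eqP; rewrite linearZ /= scaler_eq0.
  apply/orP; right; rewrite linear_sum -sumrB big1 ?linear0 // => l _ /=.
  by rewrite linearZ /= low_E1_xr subrr.
Qed.

(** For [r > 0] the value [x^(r-1) y] at the base vertex will do. For [r = 0], the
    vertices [l + p m] at distance two are weighted by their second digit [m];
    adding 1 changes the weights only through the carry, and the resulting sum
    over the children of a neighbour is a value of [T] up to [phi]. *)
Lemma second_layer_even :
  exists w d, second_layer (pr phi) d w /\ (r != 0%N -> d = 0).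
Proof.
have [r0|r0] := posnP r; last first.
  exists (base sym_xy), 0; split=> //; split.
  - exact: half_base.
  - rewrite aff0_base rmorph1 unip_sym_xy // scale1r [base _]linearD /=.
    by rewrite addrAC subrr add0r.
  - by rewrite low_base subrr linear0 scale0r.
have xr1 (c : k) : c ^+ r = 1 by rewrite r0 expr0.
have yrE : yr = xr.
  by apply: (sym_eq char_p r_lt_p) => l; rewrite heval_swap !heval_xr !xr1.
have S b : pr (\sum_(m < p) E 2 (b + p%:R * m%:R) xr) = - pr phi.
  have := pr_T (E 1 b xr); rewrite T_act T_base_coef linearD linearZ linear_sum /=.
  rewrite heval_xr xr1 scale1r aff_Pi_phi yrE.
  have -> : E 0 b xr = phi.
    by rewrite -[b]mul1r -(expr0 p%:R) -[_ * b]add0r E_xr_shift E00.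
  rewrite linearD /= addrC => /eqP; rewrite addr_eq0 => /eqP <-.
  congr (pr _); apply: eq_bigr => m _.
  by rewrite heval_xr xr1 scale1r -/(E 1 _ _) aff_E expr1.
pose D b := \sum_(m < p) m%:R *: E 2 (b + p%:R * m%:R) xr.
have Dp b : pr (D (b + p%:R)) = pr (D b) + pr phi.
  pose F m := (m%:R - 1) *: E 2 (b + p%:R * m%:R) xr.
  have -> : D (b + p%:R) = \sum_(m < p) F m.
    rewrite -sum_cyclic; last first.
      rewrite /F natr_p0 mulr0 addr0 -expr2; congr (_ *: _).
      by rewrite -[p%:R ^+ 2]mulr1 E_xr_shift.
    apply: eq_bigr => m _; rewrite /F -natr1 addrK; congr (_ *: E _ _ _).
    rewrite -natr1; ring.
  have -> : \sum_(m < p) F m = D b - \sum_(m < p) E 2 (b + p%:R * m%:R) xr.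
    by rewrite -sumrB; apply: eq_bigr => m _; rewrite /F scalerBl scale1r.
  by rewrite linearB /= S opprK.
have Dpn b n : pr (D (b + p%:R * n%:R)) = pr (D b) + n%:R *: pr phi.
  elim: n => [|n IHn]; first by rewrite mulr0 scale0r !addr0.
  by rewrite -natr1 mulrDr mulr1 addrA Dp IHn -natr1 scalerDl scale1r addrA.
pose w := \sum_(l < p) D l%:R.
have Dhalf b : half (D b).
  apply: (lin_closed_sum _ half_closed) => m _.
  by apply: (lin_closedZ _ half_closed); apply: half_E.
have lowD (l : nat) : X (low 1) (D l%:R) = D (l%:R - p%:R * l%:R ^+ 2).
  rewrite linear_sum; apply: eq_bigr => m _ /=; rewrite linearZ /=; congr (_ *: _).
  have [z ->] := low_E 2 (l%:R + p%:R * m%:R).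
  set b := l%:R; set c := m%:R.
  have -> : b + p%:R * c - p%:R * (b + p%:R * c) ^+ 2 + p%:R ^+ 2 * z =
     b - p%:R * b ^+ 2 + p%:R * c + p%:R ^+ 2 *
       (z - 2%:R * b * c - p%:R * c ^+ 2) by ring.
  exact: E_xr_shift.
have [d dE] : over_line (pr phi) (X (low 1) w - w).
  rewrite /w linear_sum -sumrB; apply: (lin_closed_sum _ (over_line_closed _)) => l _ /=.
  exists (- (l ^ 2)%:R); rewrite lowD linearB /=.
  have := Dpn (l%:R - p%:R * l%:R ^+ 2) (l ^ 2)%N; rewrite natrX subrK => ->.
  by rewrite opprD addrA subrr sub0r natrX scaleNr.
exists w, d; split=> //.
split=> //; first exact: (lin_closed_sum _ half_closed).
have -> : X (aff 0 1) w - w = D (0 + p%:R) - D 0.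
  rewrite /w linear_sum -sumrB /= add0r.
  have := telescope_sumr (fun l => D l%:R) (leq0n p); rewrite big_mkord /= => <-.
  apply: eq_bigr => l _.
  congr (_ - _); rewrite linear_sum; apply: eq_bigr => m _ /=.
  by rewrite linearZ /= aff0_E addrAC natr1.
by rewrite linearB /= Dp addrAC subrr add0r.
Qed.

Lemma pr_act g x y : pr x = pr y -> pr (X g x) = pr (X g y).
Proof.
move=> xy; have [f fE] : exists f, x - y = T f.
  by apply/pr_ker; rewrite linearB /= xy subrr.
by apply/eqP; rewrite -subr_eq0 -!linearB /= fE -T_act pr_T.
Qed.

Lemma soc_fixed y g : X g phi = phi -> X g (X Pi phi) = X Pi phi ->
  soc (pr y) -> pr (X g y) = pr y.
Proof.
move=> gphi gPi [c [c' yE]].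
have yE' : pr y = pr (c *: phi + c' *: X Pi phi) by rewrite yE linearD !linearZ.
by rewrite (pr_act g yE') linearD !linearZ /= gphi gPi yE'.
Qed.

Lemma act_diff2 g a c x y : X g (a *: x + c *: y) - (a *: x + c *: y) =
  a *: (X g x - x) + c *: (X g y - y).
Proof. by rewrite linearD !linearZ /= opprD addrACA -!scalerBr. Qed.

Lemma pr_soc_indep a c : a *: pr phi + c *: pr (X Pi phi) = 0 -> a = 0 /\ c = 0.
Proof.
move=> e; have /pr_ker[f fE] : pr (a *: phi + c *: X Pi phi) = 0.
  by rewrite linearD !linearZ.
exact: phi_Pi_phi_indep fE.
Qed.

(** Vectors fixed by [aff 0 1] and by its conjugate under [Pi] lie in the
    socle: writing [w = a + Pi a'], both [a] and [a'] are fixed modulo the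
    socle, and the resulting four coefficients satisfy a linear system whose
    only solution is zero because [d * d' = 0]. *)
Lemma unipotent_invariants w : pr (X (aff 0 1) w) = pr w ->
  pr (X (low 1) w) = pr w -> soc (pr w).
Proof.
have [e [d [[he ue le] d0]]] := second_layer_even.
have [o [d' [[ho uo lo] d'0]]] := second_layer_odd.
have dd' : d * d' = 0.
  by have [/d'0 ->|/d0 ->] := eqVneq r 0%N; rewrite ?mul0r ?mulr0.
have low_conj x : X (aff 0 1) (X Pi x) = X Pi (X (low 1) x).
  by rewrite -!rep_actM aff0_Pi.
(* The defect of invariance of [a] is opposite to that of [Pi a'], so it lies in
   the intersection of the two halves. *)
have comp a a' : half a -> half a' ->
    pr (X (aff 0 1) (a + X Pi a')) = pr (a + X Pi a') ->
  exists s t, soc (pr (a - s *: e - t *: o)).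
  move=> ha ha' fix_aa'.
  have [s [t st]] : soc (pr (X (aff 0 1) a - a)).
    apply: (@half_inter _ (a' - X (low 1) a')).
    - by apply: (lin_closedB half_closed) => //; apply: half_aff.
    - by apply: (lin_closedB half_closed) => //; apply: half_low.
    rewrite !linearB /=; apply/eqP; rewrite subr_eq addrAC eq_sym subr_eq addrC.
    by rewrite -low_conj -!linearD /= fix_aa' eqxx.
  exists s, t; have [f fE] : exists f,
      X (aff 0 1) (a - s *: e - t *: o) - (a - s *: e - t *: o) = T f.
    apply/pr_ker.
    have -> : X (aff 0 1) (a - s *: e - t *: o) - (a - s *: e - t *: o) =
      (X (aff 0 1) a - a) - s *: (X (aff 0 1) e - e) - t *: (X (aff 0 1) o - o).
      rewrite [X _ (_ - t *: o)]linearB /= [X _ (a - _)]linearB /=.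
      rewrite [X _ (s *: e)]linearZ /= [X _ (t *: o)]linearZ /= !scalerBr !opprD !opprK.
      by rewrite [LHS](AC (3*3) ((1*4)*(2*5)*(3*6))).
    by rewrite 2!linearB !linearZ /= ue uo st !scalerN -addrA -opprD subrr.
  apply: fixed_half fE.
  apply: (lin_closedB half_closed); last exact: (lin_closedZ _ half_closed).
  by apply: (lin_closedB half_closed) => //; exact: (lin_closedZ _ half_closed).
have [a [a' [ha ha' ->]]] := tree_split w => uw lw.
have uPw : pr (X (aff 0 1) (a' + X Pi a)) = pr (a' + X Pi a).
  have e1 : X Pi (a + X Pi a') = a' + X Pi a by rewrite linearD /= act_PiPi addrC.
  by rewrite -e1 low_conj; apply: pr_act.
have [s [t st]] := comp _ _ ha ha' uw; have [s' [t' st']] := comp _ _ ha' ha uPw.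
pose x := s *: e + t *: o + X Pi (s' *: e + t' *: o).
have prx : soc (pr (a + X Pi a' - x)).
  have -> : a + X Pi a' - x = (a - s *: e - t *: o) + X Pi (a' - s' *: e - t' *: o).
    rewrite /x -[_ - t' *: o]addrA -opprD [X Pi (a' - _)]linearB /= opprD addrACA.
    by congr (_ + _); rewrite opprD addrA.
  rewrite linearD; apply: (lin_closedD soc_closed) => //=.
  have [c [c' stc]] := st'.
  rewrite (_ : pr (X Pi _) = pr (X Pi (c *: phi + c' *: X Pi phi))).
    exists c', c; by rewrite linearD !linearZ /= act_PiPi linearD !linearZ addrC.
  by apply: pr_act; rewrite stc linearD !linearZ.
(* [y] is fixed only if the coefficients of the independent classes of [phi] and
   [Pi phi] in [aff 0 1 * y - y] vanish. *)
have coefs c1 c2 c3 c4 : let y := c1 *: e + c2 *: o + X Pi (c3 *: e + c4 *: o) in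
    pr (X (aff 0 1) y) = pr y -> c1 + c4 * d' = 0 /\ c2 + c3 * d = 0.
  move=> y uy; apply: pr_soc_indep.
  have Pe : pr (X Pi (X (low 1) e - e)) = d *: pr (X Pi phi).
    by rewrite -linearZ -linearZ /=; apply: pr_act; rewrite le linearZ.
  have Po : pr (X Pi (X (low 1) o - o)) = d' *: pr phi.
    rewrite -[phi](act_PiPi X) -linearZ -[d' *: X Pi _]linearZ /=.
    by apply: pr_act; rewrite lo linearZ.
  have yE : X (aff 0 1) y - y = c1 *: (X (aff 0 1) e - e) + c2 *: (X (aff 0 1) o - o)
      + (c3 *: X Pi (X (low 1) e - e) + c4 *: X Pi (X (low 1) o - o)).
    rewrite linearD /= low_conj opprD addrACA act_diff2; congr (_ + _).
    by rewrite -linearB /= act_diff2 linearD !linearZ.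
  have : pr (X (aff 0 1) y - y) = 0 by rewrite linearB /= uy subrr.
  rewrite yE linearD linearD [pr (c3 *: _ + _)]linearD !linearZ /= ue uo Pe Po.
  by rewrite !scalerA [X in _ + X]addrC addrACA -!scalerDl.
have ux : pr (X (aff 0 1) x) = pr x.
  have := soc_fixed aff01_phi aff01_Pi_phi prx; rewrite !linearB /= uw.
  by move=> /addrI/oppr_inj.
have [e1 e2] := coefs _ _ _ _ ux.
have uPx : pr (X (aff 0 1) (s' *: e + t' *: o + X Pi (s *: e + t *: o))) =
    pr (s' *: e + t' *: o + X Pi (s *: e + t *: o)).
  have -> : s' *: e + t' *: o + X Pi (s *: e + t *: o) = X Pi x.
    by rewrite /x [X Pi (_ + _ + X Pi _)]linearD /= act_PiPi addrC.
  have := soc_fixed (low_base _ _ _) (Pi_phi_low 1) prx; rewrite !linearB /= lw.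
  by move=> /addrI/oppr_inj lx; rewrite low_conj; apply: pr_act.
have [e3 e4] := coefs _ _ _ _ uPx.
have s0 : s = 0.
  have -> : s = (s + t' * d') - (t' + s * d) * d' + s * (d * d') by ring.
  by rewrite e1 e4 dd' mul0r mulr0 subrr addr0.
have s'0 : s' = 0.
  have -> : s' = (s' + t * d') - (t + s' * d) * d' + s' * (d * d') by ring.
  by rewrite e3 e2 dd' mul0r mulr0 subrr addr0.
have t0 : t = 0 by move: e2; rewrite s'0 mul0r addr0.
have t'0 : t' = 0 by move: e4; rewrite s0 mul0r addr0.
have x0 : x = 0 by rewrite /x s0 s'0 t0 t'0 !scale0r ?addr0 linear0 addr0.
by move: prx; rewrite x0 subr0.
Qed.

Hypothesis pr_surj : forall y, exists w, y = pr w.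
Variables (rho : representation G V) (chi : G -> k) (I I1 Pos : set G).
Hypothesis rho_pr : forall g w, rho g (pr w) = chi g *: pr (X g w).
Hypothesis chi_neq0 : forall g, chi g != 0.
Hypothesis PosP : forall g, Pos g <-> exists n b, g = aff n b.
Hypothesis I1_chi : forall h, I1 h -> chi h = 1.
Hypothesis I1_phi : forall h, I1 h -> X h phi = phi /\ X h (X Pi phi) = X Pi phi.
Hypothesis I1_aff01 : I1 (aff 0 1).
Hypothesis I1_low : I1 (low 1).
Hypothesis I_phi : forall h, I h ->
  (exists c, X h phi = c *: phi) /\ (exists c, X h (X Pi phi) = c *: X Pi phi).
Hypothesis I_E : forall h n b u, I h -> exists m c v, X h (E n b u) = E m c v.
Hypothesis I_Pi : forall h, I h -> exists2 h', I h' & (h * Pi = Pi * h')%g.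

Lemma invariants_soc : rep_invariants rho I1 = soc.
Proof.
apply/seteqP; split=> y.
  move=> yI; have [w yw] := pr_surj y; rewrite yw; apply: unipotent_invariants.
    by have := yI _ I1_aff01; rewrite yw rho_pr (I1_chi I1_aff01) scale1r; exact.
  by have := yI _ I1_low; rewrite yw rho_pr (I1_chi I1_low) scale1r; exact.
move=> [a [c ->]] h hI1; have [hphi hPi] := I1_phi hI1.
by rewrite linearD !linearZ /= !rho_pr (I1_chi hI1) !scale1r hphi hPi.
Qed.

Lemma Pi_phi_half : exists a, half a /\ pr a = pr (X Pi phi).
Proof.
pose a := \sum_(nu < p) heval 1 (- nu%:R) yr *: E 1 nu%:R xr.
have ha : half a.
  apply: (lin_closed_sum _ half_closed) => nu _.
  by apply: (lin_closedZ _ half_closed); apply: half_E.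
exists (- a); split; first by rewrite -scaleN1r; apply: (lin_closedZ _ half_closed).
have := pr_T (base yr); rewrite T_base_coef heval01_yr scale1r -/a linearD linearN /=.
by move/eqP; rewrite addr_eq0 => /eqP ->.
Qed.

Definition half_image : set V := [set y | exists a, half a /\ y = pr a].

Lemma half_image_closed : lin_closed half_image.
Proof.
split; first by exists 0; rewrite linear0; split=> //; case: half_closed.
move=> c _ _ [a [ha ->]] [a' [ha' ->]]; exists (c *: a + a'); rewrite linearP.
by split=> //; case: half_closed => _; apply.
Qed.

Lemma soc_half_image : soc `<=` half_image.
Proof.
move=> _ [a [c ->]]; apply: (lin_closedD half_image_closed).
  apply: (lin_closedZ _ half_image_closed); exists phi; split=> //; exact: half_base.
apply: (lin_closedZ _ half_image_closed).
by have [b [hb <-]] := Pi_phi_half; exists b.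
Qed.

Local Notation M := (lin_span [set rho g y | g in Pos & y in rep_invariants rho I1]).

(** Every value at every vertex of the half is reached from [Pi phi]:
    [aff n.+1 b] moves [Pi phi] to the vertex [aff n b], with value a translate
    of [y^r], and those translates span the symmetric power. *)
Lemma span_half_image : M = half_image.
Proof.
rewrite invariants_soc; apply/seteqP; split.
  apply: lin_span_sub; first exact: half_image_closed.
  move=> _ [_ /PosP[n [b ->]] [_ [a [c ->]] <-]].
  rewrite -!linearZ -linearD rho_pr; apply: (lin_closedZ _ half_image_closed).
  rewrite linearD !linearZ /= linearD !linearZ /=; apply: (lin_closedD half_image_closed).
    apply: (lin_closedZ _ half_image_closed); exists (E n b xr).
    by split=> //; apply: half_E.
  apply: (lin_closedZ _ half_image_closed); rewrite aff_Pi_phi; case: n => [|n].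
    exact: soc_half_image soc_Pi_phi.
  by exists (E n b yr); split=> //; apply: half_E.
move=> _ [a [ha ->]]; move: a ha; apply: half_ind.
  exact: (preim_closed _ (lin_span_closed _)).
move=> n b u; move: u; apply: (sym_span char_p r_lt_p).
  move=> a u v Mu Mv; rewrite /= !linearP.
  by case: (lin_span_closed [set rho g y | g in Pos & y in soc]) => _; apply.
move=> l; rewrite /= -(rmorph_nat red) -E_shift.
set c := b + _; have -> : pr (E n c yr) =
    (chi (aff n.+1 c))^-1 *: rho (aff n.+1 c) (pr (X Pi phi)).
  by rewrite rho_pr scalerA mulVf // scale1r aff_Pi_phi.
apply: (lin_closedZ _ (lin_span_closed _)); apply: lin_span_gen.
exists (aff n.+1 c); first by apply/PosP; exists n.+1, c.
by exists (pr (X Pi phi)) => //; exact: soc_Pi_phi.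
Qed.

Lemma half_image_stable : rep_stable rho I half_image.
Proof.
move=> h _ hI [a [ha ->]]; rewrite rho_pr; apply: (lin_closedZ _ half_image_closed).
move: a ha; apply: half_ind => [|n b u].
  exact: (@preim_closed _ half_image (pr \o X h) half_image_closed).
by have [m [c [v ->]]] := I_E n b u hI; exists (E m c v); split=> //; apply: half_E.
Qed.

Local Notation PiM := [set rho Pi y | y in half_image].

Lemma rho_Pi_half a : half a -> PiM (pr (X Pi a)).
Proof.
move=> ha; exists ((chi Pi)^-1 *: pr a).
  by apply: (lin_closedZ _ half_image_closed); exists a.
by rewrite linearZ /= rho_pr scalerA mulVf // scale1r.
Qed.

Lemma rho_Pi_image y : PiM y -> exists a, half a /\ y = pr (X Pi a).
Proof.
move=> [_ [a [ha ->]] <-]; exists (chi Pi *: a); split.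
  exact: (lin_closedZ _ half_closed).
by rewrite rho_pr !linearZ.
Qed.

(** The classes of [phi] and [Pi phi] lie in both halves, since [T] relates
    [Pi phi] to functions supported on the half of [phi]. *)
Lemma half_image_inter : half_image `&` PiM = soc.
Proof.
apply/seteqP; split=> [y [[a [ha ->]] /rho_Pi_image[a' [ha' e]]]|y sy].
  exact: half_inter e.
split; first exact: soc_half_image.
have [a [c yE]] := sy; have [b [hb bE]] := Pi_phi_half.
have -> : y = pr (X Pi (a *: b + c *: phi)).
  have -> : X Pi (a *: b + c *: phi) = a *: X Pi b + c *: X Pi phi.
    by rewrite linearD !linearZ.
  by rewrite yE linearD !linearZ /= (pr_act Pi bE) act_PiPi.
apply: rho_Pi_half; apply: (lin_closedD half_closed).
  exact: (lin_closedZ _ half_closed).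
by apply: (lin_closedZ _ half_closed); apply: half_base.
Qed.

Lemma PiM_closed : lin_closed PiM.
Proof.
split; first by exists 0; rewrite ?linear0 //; case: half_image_closed.
move=> c _ _ [y My <-] [z Mz <-]; exists (c *: y + z); last by rewrite linearP.
by case: half_image_closed => _; apply.
Qed.

Theorem half_tree_exact_sequence : rep_stable rho I M /\
  short_exact rho (rep_sum rho rho) rho I
    (rep_invariants rho I1) (M `*` [set rho Pi y | y in M]) setT
    (fun y => (y, y)) (fun yz => yz.1 - yz.2).
Proof.
rewrite span_half_image invariants_soc; split; first exact: half_image_stable.
have PiM_stable : rep_stable rho I PiM.
  move=> h _ hI [y My <-]; have [h' h'I e] := I_Pi hI.
  exists (rho h' y); first exact: half_image_stable.
  by rewrite -!rep_actM e.
have [s0 slin] := soc_closed; have [m0 mlin] := half_image_closed.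
have [p0 plin] := PiM_closed.
split.
- split; [split=> //|split=> //|by split].
  + move=> h _ hI [a [c ->]]; have [[d hphi] [d' hPi]] := I_phi hI.
    rewrite linearD !linearZ /= !rho_pr hphi hPi !linearZ /= !scalerA.
    by exists (chi h * d * a), (chi h * d' * c).
  + by move=> a [u1 u2] [v1 v2] [/= ? ?] [/= ? ?]; split; [apply: mlin|apply: plin].
  + by move=> h [u1 u2] hI [/= ? ?]; split; [apply: half_image_stable|apply: PiM_stable].
- split; split=> //.
  + by move=> y; rewrite -half_image_inter.
  + by move=> a [u1 u2] [v1 v2] _ _ /=; rewrite scalerBr opprD addrACA.
  + by move=> h [u1 u2] _ _ /=; rewrite linearB.
- by move=> y z _ _ [].
- apply/seteqP; split=> [_ [y sy <-]|[y z] [[/= My Mz]]].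
    by rewrite -half_image_inter in sy; case: sy => ? ?; split=> //=; rewrite subrr.
  move=> /eqP; rewrite subr_eq0 => /eqP yz; exists y; last by rewrite -yz.
  by rewrite -half_image_inter; split=> //; rewrite yz.
- apply/seteqP; split=> // y _; have [w ->] := pr_surj y.
  have [a [a' [ha ha' ->]]] := tree_split w.
  exists (pr a, pr (X Pi (- a'))); last by rewrite /= !linearN opprK linearD.
  split; first by exists a.
  by apply: rho_Pi_half; rewrite -scaleN1r; apply: (lin_closedZ _ half_closed).
Qed.
End TreeAction.

#[local] Opaque zlow zswap.

(** * The compact induction as functions on the tree *)

(* Compactness in terms of open covers is used for pointed spaces. *)
HB.instance Definition _ (p : nat) (p_pr : prime p) :=
  isPointed.Build (GL2 (padic p_pr)) (1%g : GL2 (padic p_pr)).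

Section CompactInductionTree.
Variables (p : nat) (p_pr : prime p) (k : fieldType).
Variables (iota : {rmorphism 'F_p -> k}) (r : nat).
Hypothesis r_lt_p : (r < p)%N.
Local Notation Zp := (padic_int p_pr).
Local Notation G := (GL2 (padic p_pr)).
Local Notation Sym := (dhomog 2 k r).
Local Notation W := (cInd p_pr iota r).
Local Notation X := (cInd_rep p_pr iota r).
Local Notation incl := (@GL2_Zp_incl p p_pr).
Local Notation ppow := (mx_ppow p_pr).
Local Notation Pi := (mx_Pi p_pr).
Local Notation aff := (@aff p p_pr).
Local Notation redK := (@GL2_Zp_red p p_pr k iota).
Local Notation xr := (sym_xr k r).
Implicit Types (f w : W) (g h : G) (u : Sym) (A : GL2 Zp).

Lemma cInd_equivariant f j A g :
  f (ppow j * incl A * g)%g = sym_act (redK A) (f g).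
Proof. by have /cInd_predP[e _ _] := valP f; apply: e. Qed.

Lemma cInd_incl f A g : f (incl A * g)%g = sym_act (redK A) (f g).
Proof. by rewrite -(cInd_equivariant f 0) ppow0 mul1g. Qed.

Lemma redK1 : redK 1%g = 1%g.
Proof. by apply: val_inj => /=; rewrite map_mx1. Qed.

Lemma cInd_ppow f j g : f (ppow j * g)%g = f g.
Proof.
by rewrite -[RHS](sym_act1 (f g)) -redK1 -(cInd_equivariant f j) incl1 mulg1.
Qed.

Lemma act_ppow j f : X (ppow j) f = f.
Proof.
apply: val_inj; apply: funext => g /=.
by rewrite -[(g * _)%g]ppow_center cInd_ppow.
Qed.

Definition cInd_at1 f : Sym := f 1%g.

Lemma cInd_at1_linear : linear cInd_at1. Proof. by []. Qed.

HB.instance Definition _ :=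
  GRing.isLinear.Build k W Sym *:%R cInd_at1 cInd_at1_linear.

Lemma cInd_at1_act g f : cInd_at1 (X g f) = f g.
Proof. by rewrite /cInd_at1 /= mul1g. Qed.

Lemma act_incl1 A f : X (incl A) f 1%g = sym_act (redK A) (f 1%g).
Proof. by rewrite /= mul1g -[incl A]mulg1 cInd_incl. Qed.

Definition at_base f : Prop := forall g, f g != 0 -> KZ g.

Lemma at_base_inj f f' : at_base f -> at_base f' -> f 1%g = f' 1%g -> f = f'.
Proof.
move=> bf bf' e; apply: val_inj; apply: funext => g /=.
have [/KZP[j [A ->]]|gK] := pselect (KZ g).
  by rewrite -[(_ * _)%g]mulg1 !cInd_equivariant e.
have z f0 : at_base f0 -> f0 g = 0.
  by move=> b0; apply/eqP/negPn/negP => /b0.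
by rewrite (z f) ?(z f').
Qed.

Lemma at_base_linear a f f' : at_base f -> at_base f' -> at_base (a *: f + f').
Proof.
move=> bf bf' g; have -> : (a *: f + f') g = a *: f g + f' g by [].
have [f0|f0 _] := eqVneq (f g) 0; last exact: bf.
by rewrite f0 scaler0 add0r; apply: bf'.
Qed.

Lemma at_base_incl A f : at_base f -> at_base (X (incl A) f).
Proof.
move=> bf g /= /bf gA.
have -> : g = (g * incl A * (incl A)^-1)%g by rewrite mulgK.
by apply: KZM => //; apply: KZV; apply: KZ_incl.
Qed.

Variables (phi : W).
Hypothesis phi_gen : is_generator phi.

Lemma at_base_phi : at_base phi.
Proof. by move=> g g0; case: phi_gen => <- _. Qed.

(** The translates of [phi] under the maximal compact subgroup realise every
    value at the base vertex, since those of [x^r] span the symmetric power. *)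
Lemma base_exists u : exists f, at_base f /\ f 1%g = u.
Proof.
move: u; apply: (sym_span (char_k p_pr iota) r_lt_p).
  move=> a _ _ [f [bf <-]] [f' [bf' <-]]; exists (a *: f + f').
  by split=> //; apply: at_base_linear.
move=> l; exists (X (incl (zunip (l%:R : Zp))) (X (incl (zswap p_pr)) phi)); split.
  by do 2!apply: at_base_incl; apply: at_base_phi.
have phi1 : phi 1%g = xr by case: phi_gen.
rewrite act_incl1 act_incl1 phi1.
have := red_zunip iota (l%:R : Zp); rewrite rmorph_nat => e1.
exact: (etrans (congr1 (fun a => sym_act a _) e1)
  (congr1 (fun b => sym_act _ (sym_act b xr)) (red_zswap p_pr iota))).
Qed.

Definition basefun u : W := projT1 (cid (base_exists u)).

Lemma at_base_basefun u : at_base (basefun u).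
Proof. by rewrite /basefun; case: cid => f []. Qed.

Lemma basefun1 u : basefun u 1%g = u.
Proof. by rewrite /basefun; case: cid => f []. Qed.

Lemma basefun_linear : linear basefun.
Proof.
move=> a u v; apply: at_base_inj; first exact: at_base_basefun.
  by apply: at_base_linear; apply: at_base_basefun.
have -> : (a *: basefun u + basefun v) 1%g = a *: basefun u 1%g + basefun v 1%g by [].
by rewrite !basefun1.
Qed.

HB.instance Definition _ :=
  GRing.isLinear.Build k Sym W *:%R basefun basefun_linear.

Lemma phiE : phi = basefun xr.
Proof.
apply: at_base_inj; [exact: at_base_phi|exact: at_base_basefun|].
by rewrite basefun1; case: phi_gen.
Qed.

Lemma incl_basefun A u : X (incl A) (basefun u) = basefun (sym_act (redK A) u).
Proof.
apply: at_base_inj; [|exact: at_base_basefun|].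
  by apply: at_base_incl; apply: at_base_basefun.
by rewrite act_incl1 !basefun1.
Qed.

Lemma KZ_basefun h u : KZ h -> exists v, X h (basefun u) = basefun v.
Proof.
move=> /KZP[j [A ->]]; exists (sym_act (redK A) u).
by rewrite rep_actM act_ppow incl_basefun.
Qed.

Lemma act_PiPi_cInd w : X Pi (X Pi w) = w.
Proof. by rewrite -rep_actM; have -> := PiPi p_pr; rewrite act_ppow. Qed.

(** A matrix close to [c] is [1 + p M] times [c], because the inverse of [c] has
    bounded denominators. *)
Lemma incl_near (c h : G) m (Y : 'M[Zp]_2) :
  p%:R ^+ m *: val (c^-1)%g = map_mx (@FracField.tofrac _) Y ->
  padic_near m.+1 c h -> exists A, h = (incl A * c)%g.
Proof.
move=> YE [Z hE]; set F := @FracField.tofrac _ in YE hE.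
pose M := 1%:M + p%:R *: (Z *m Y).
have vh : val (h * c^-1)%g = map_mx F M.
  have vc : val c *m val (c^-1)%g = 1%:M by rewrite -GL2_valM mulgV.
  rewrite GL2_valM hE mulmxDl vc map_mxD map_mx1 map_mxZ map_mxM -YE /=; congr (_ + _).
  by rewrite -scalemxAl -scalemxAr scalerA exprS rmorph_nat.
have uM : M \in unitmx.
  rewrite unitmxE padic_unit_red -det_map_mx map_mxD map_mx1 map_mxZ rmorph_nat.
  by rewrite pcharf0 ?pchar_Fp // scale0r addr0 det1 oner_eq0.
exists (exist _ M uM).
have <- : (h * c^-1)%g = incl (exist _ M uM) by apply: val_inj; rewrite vh.
by rewrite mulgVK.
Qed.

Lemma KZ_coset_open x : open [set c : G | KZ (c * x^-1)%g].
Proof.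
move=> c /= cx; have [m [Y YE]] := GL2_bounded (c^-1)%g.
exists m.+1 => h /(incl_near YE)[A ->] /=.
by rewrite -mulgA; apply: KZM => //; apply: KZ_incl.
Qed.

Lemma GL2_center_KZ (z : G) : GL2_center z -> KZ z.
Proof. by move=> zc; exists 1%g, z; split=> //; rewrite incl1 mul1g. Qed.

(** The cosets are open, so finitely many of them cover a support that is compact
    modulo the centre. *)
Lemma finite_support w : exists s : seq G,
  forall g, w g != 0 -> exists2 x, x \in s & KZ (g * x^-1)%g.
Proof.
have /cInd_predP[_ _ [C cC sup]] := valP w.
have {}cC : cover_compact C by rewrite -compact_cover.
have [x _|c Cc|D _ CD] := cC G C (fun x => [set c : G | KZ (c * x^-1)%g]).
- exact: KZ_coset_open.
- exists c; first exact: Cc; rewrite /= mulgV.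
  by apply/KZP; exists 0, 1%g; rewrite ppow0 incl1 mulg1.
exists (finmap.enum_fset D) => g /sup[c [z [Cc zc ->]]].
have [x /= xD cx] := CD c Cc; exists x => //.
by rewrite -mulgA; apply: KZM => //; apply: GL2_center_KZ.
Qed.

(** The restriction of a function to one coset is a translate of a function
    supported at the base vertex; these restrictions are subtracted one by
    one. *)
Lemma cInd_span_translates (P : set W) : lin_closed P ->
  (forall g u, P (X g (basefun u))) -> forall w, P w.
Proof.
move=> Pc Pgen w; have [s] := finite_support w.
elim: s w => [|x s IHs] w ws.
  have -> : w = 0; last by case: Pc.
  apply: val_inj; apply: funext => g /=; apply/eqP/negPn/negP => /ws[//].
pose y := X (x^-1)%g (basefun (w x)).
rewrite -(subrK y w); apply: (lin_closedD Pc); last exact: Pgen.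
apply: IHs => g wyg.
have wyE : (w - y) g = w g - y g by [].
have gx : ~ KZ (g * x^-1)%g.
  move=> /KZP[j [A gA]]; case/eqP: wyg; rewrite wyE /y /=.
  have -> : g = (g * x^-1 * x)%g by rewrite mulgVK.
  move: gA; set h := (g * x^-1)%g; rewrite mulgK => ->.
  by rewrite cInd_equivariant -[(_ * incl A)%g]mulg1 cInd_equivariant basefun1 subrr.
have y0 : y g = 0 by apply/eqP/negPn/negP => /at_base_basefun.
have [|z] := ws g; first by move: wyg; rewrite wyE y0 subr0.
by rewrite inE => /orP[/eqP-> //|zs gz]; exists z.
Qed.

Lemma cInd_tree_span (P : set W) : lin_closed P ->
  (forall n b u, P (X (aff n b) (basefun u))) ->
  (forall n b u, P (X Pi (X (aff n b) (basefun u)))) -> forall w, P w.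
Proof.
move=> Pc Paff PPi; apply: (cInd_span_translates Pc) => g u.
have [n [b [h [hK [->|->]]]]] := vertexP g; have [v hv] := KZ_basefun u hK.
  by rewrite rep_actM hv.
by rewrite rep_actM rep_actM hv.
Qed.

Lemma KZ_value0 w h g : KZ h -> w g = 0 -> w (h^-1 * g)%g = 0.
Proof.
move=> /KZV/KZP[j [A ->]] wg; rewrite cInd_equivariant wg.
by rewrite linear0.
Qed.

Lemma cInd_tree_eq0 w : (forall n b, cInd_at1 (X (aff n b)^-1%g w) = 0) ->
  (forall n b, cInd_at1 (X (aff n b)^-1%g (X Pi w)) = 0) -> w = 0.
Proof.
move=> w1 w2; apply: val_inj; apply: funext => g /=.
have [n [b [h [hK]]]] := vertexP (g^-1)%g.
have PiV f : X Pi f = X (Pi^-1)%g f.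
  by rewrite -{2}[f]act_PiPi_cInd -rep_actM mulVg rep_act1.
case=> gE.
  have {}gE : g = (h^-1 * (aff n b)^-1)%g by rewrite -invgM -gE invgK.
  rewrite gE; apply: KZ_value0 => //.
  exact: (etrans (esym (cInd_at1_act _ w)) (w1 n b)).
have {}gE : g = (h^-1 * ((aff n b)^-1 * Pi^-1))%g.
  by rewrite mulgA -invgM -invgM -gE invgK.
rewrite gE; apply: KZ_value0 => //.
rewrite -(cInd_at1_act _ w) rep_actM.
exact: (etrans (congr1 (fun y => cInd_at1 (X _ y)) (esym (PiV w))) (w2 n b)).
Qed.

#[local] Opaque cInd_rep.

Variable T : rep_hom X X.
Hypothesis T_hecke : is_hecke phi T.

Lemma act_eq g h f : g = h -> X g f = X h f. Proof. by move->. Qed.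

Lemma act_mul g h gh f : (g * h)%g = gh -> X g (X h f) = X gh f.
Proof. by move=> <-; rewrite rep_actM. Qed.

Lemma kred_padic_eq (z z' : Zp) : kred iota z = kred iota z' ->
  exists y, z = z' + p%:R * y.
Proof.
move=> /eqP; rewrite -subr_eq0 -rmorphB => zz'.
have [|y yE] := @padic_nonunit p p_pr (z - z').
  by apply: contraTN zz' => /(kred_unit iota).
by exists y; rewrite -yE addrC subrK.
Qed.

Lemma aff0_phi z : X (aff 0 z) phi = phi.
Proof.
rewrite phiE; apply: (etrans (act_eq _ (aff0 z))); rewrite incl_basefun.
congr basefun; apply: (etrans (congr1 (fun a => sym_act a xr) (red_zunip iota z))).
exact: (unip_xr (char_k p_pr iota) r_lt_p).
Qed.

Lemma aff1_phi (z z' : Zp) : kred iota z = kred iota z' ->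
  X (aff 1 z) phi = X (aff 1 z') phi.
Proof.
move=> /kred_padic_eq[y ->].
have e : (aff 1 z' * aff 0 y)%g = aff 1 (z' + p%:R * y) by rewrite affM expr1.
exact: (etrans (esym (act_mul _ e)) (congr1 (X _) (aff0_phi y))).
Qed.

(** The functions supported on the neighbours of the base vertex in its half
    of the tree, with the values occurring in [T phi]. *)
Definition children : set W := [set f | exists gamma : nat -> k,
  f = \sum_(nu < p) gamma nu *: X (aff 1 nu%:R) phi].

Lemma children_closed : lin_closed children.
Proof.
split; first by exists (fun=> 0); rewrite big1 // => nu _; rewrite scale0r.
move=> a _ _ [c ->] [d ->]; exists (fun nu => a * c nu + d nu).
rewrite scaler_sumr -big_split; apply: eq_bigr => nu _ /=.
by rewrite scalerDl scalerA.
Qed.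

Lemma children_aff1 z : children (X (aff 1 z) phi).
Proof.
have [n [z' [np zE]]] := padic_approx z 1; rewrite expn1 in np.
exists (fun nu => (nu == n)%:R).
rewrite (bigD1 (Ordinal np)) //= eqxx scale1r big1 ?addr0 => [|i].
  by apply: aff1_phi; rewrite zE expr1 rmorphD /= kred_pM addr0.
by rewrite -val_eqE /= => /negPf ->; rewrite scale0r.
Qed.

Lemma children_unip z f : children f -> children (X (aff 0 z) f).
Proof.
move=> [c ->]; rewrite linear_sum; apply: (lin_closed_sum _ children_closed) => nu _.
rewrite linearZ; apply: (lin_closedZ _ children_closed) => /=.
have e : (aff 0 z * aff 1 nu%:R)%g = aff 1 (z + nu%:R).
  by rewrite affM expr0 mul1r.
by rewrite (act_mul phi e); apply: children_aff1.
Qed.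

Lemma swap_Pi_phi : X (incl (zswap p_pr)) (X Pi phi) = X (aff 1 0) phi.
Proof.
have e : (incl (zswap p_pr) * Pi)%g = aff 1 0.
  have := swap_aff1 p_pr; have ss : (zswap p_pr * zswap p_pr)%g = 1%g.
    by apply: (entries_inj (entriesM (entries_zswap p_pr) (entries_zswap p_pr))
      (entries1 _)); ring.
  move=> <-; rewrite mulgA -inclM.
  by apply: (etrans (congr1 (fun A => (incl A * _)%g) ss)); rewrite incl1 mul1g.
exact: act_mul.
Qed.

Lemma swap_children z : z \is a GRing.unit ->
  children (X (incl (zswap p_pr)) (X (aff 1 z) phi)).
Proof.
move=> /swap_aff[A [e Ae]].
have Ae' : entries A (- z^-1) 0 (p%:R * 1) z by rewrite mulr1.
have -> : X (incl (zswap p_pr)) (X (aff 1 z) phi) =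
    kred iota (- z^-1) ^+ r *: X (aff 1 z^-1) phi.
  apply: (etrans (act_mul _ e)); rewrite rep_actM phiE incl_basefun.
  apply: (etrans (congr1 (fun u => X _ (basefun u)) (red_upper_xr iota r_lt_p Ae'))).
  by rewrite [basefun _]linearZ linearZ.
by apply: (lin_closedZ _ children_closed); apply: children_aff1.
Qed.

Lemma red_teichmuller (l : 'F_p) : padic_red (teichmuller p_pr l) = l.
Proof.
rewrite /padic_red /teichmuller mk_padicE (intr_modp p_pr) expn1 rmorphXn /=.
exact: (etrans (pFrobenius_aut_nat (pchar_Fp p_pr) l) (natr_Zp l)).
Qed.

(** [T phi] is the sum over the neighbours in the half of the base vertex,
    plus [Pi phi] when [r = 0]. Moving it by the Weyl element turns exactly one
    neighbour, the one at [0], into [Pi phi]. *)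
Lemma swap_T_phi :
  children (X (incl (zswap p_pr)) (T phi) - X Pi phi).
Proof.
have unip_t l : X (mx_unip (teichmuller p_pr l) * mx_t p_pr)%g phi =
    X (aff 1 (teichmuller p_pr l)) phi.
  apply: act_eq; have e : (aff 0 (teichmuller p_pr l) * aff 1 0)%g =
      aff 1 (teichmuller p_pr l) by rewrite affM mulr0 addr0.
  exact: (etrans (congr2 (fun x y : G => (x * y)%g) (mx_unip_aff _) (mx_t_aff p_pr)) e).
set s := X (incl (zswap p_pr)).
have TE : T phi = (if r == 0%N then X Pi phi else 0) +
    \sum_(l : 'F_p) X (aff 1 (teichmuller p_pr l)) phi.
  by rewrite [LHS]T_hecke; congr (_ + _); apply: eq_bigr => l _; apply: unip_t.
have [f0 [y [f1 [-> sf0 sy sf1]]]] : exists f0 y f1, [/\ T phi = f0 + (y + f1),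
    children (s f0), s y = X Pi phi & children (s f1)].
  exists (if r == 0%N then X Pi phi else 0), (X (aff 1 (teichmuller p_pr 0)) phi).
  exists (\sum_(l : 'F_p | l != 0) X (aff 1 (teichmuller p_pr l)) phi); split.
  - by rewrite TE; congr (_ + _); exact: (bigD1 0).
  - case: ifP => _; last by rewrite /s linear0; case: children_closed.
    by rewrite /s swap_Pi_phi; apply: children_aff1.
  - have e : X (aff 1 (teichmuller p_pr 0)) phi = X (aff 1 0) phi.
      by apply: aff1_phi; rewrite /kred /= red_teichmuller !rmorph0.
    exact: (etrans (congr1 s e) (act_mul _ (swap_aff1 p_pr))).
  - rewrite /s linear_sum; apply: (lin_closed_sum _ children_closed) => l l0.
    by apply: swap_children; rewrite padic_unit_red red_teichmuller.
have -> : s (f0 + (y + f1)) = s f0 + (s y + s f1) by rewrite /s !linearD.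
rewrite sy addrCA addrAC subrr add0r; exact: (lin_closedD children_closed).
Qed.

Lemma T_basefun u : exists gamma : nat -> k,
  T (basefun u) = heval 0 1 u *: X Pi (basefun xr) +
    \sum_(nu < p) gamma nu *: X (aff 1 nu%:R) (basefun xr).
Proof.
suff [gamma TE] : children (T (basefun u) - heval 0 1 u *: X Pi phi).
  by exists gamma; rewrite -phiE -TE addrC subrK.
move: u; apply: (sym_span (char_k p_pr iota) r_lt_p) => [a u v cu cv|l].
  have -> : T (basefun (a *: u + v)) - heval 0 1 (a *: u + v) *: X Pi phi =
      a *: (T (basefun u) - heval 0 1 u *: X Pi phi) +
      (T (basefun v) - heval 0 1 v *: X Pi phi).
    rewrite [basefun _]linearP [T _]linearP [heval _ _ _]linearP /= scalerBr scalerDl.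
    by rewrite opprD addrACA scalerA.
  by case: children_closed => _; apply.
rewrite heval_unip heval_swap heval_xr mul0r add0r expr1n scale1r.
have -> : basefun (sym_act (unip l%:R) (sym_act (swap k) xr)) =
    X (aff 0 (l%:R : Zp)) (X (incl (zswap p_pr)) phi).
  apply/esym; apply: (etrans (act_eq _ (aff0 _))); rewrite phiE.
  apply: (etrans (congr1 (X _) (incl_basefun _ _))).
  apply: (etrans (incl_basefun _ _)); congr basefun.
  have := red_zunip iota (l%:R : Zp); rewrite rmorph_nat => e1.
  exact: (etrans (congr1 (fun a => sym_act a _) e1)
    (congr1 (fun b => sym_act _ (sym_act b xr)) (red_zswap p_pr iota))).
rewrite rep_homP rep_homP.
have e : X (aff 0 (l%:R : Zp)) (X Pi phi) = X Pi phi.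
  apply: (etrans (act_mul _ (aff0_mul_Pi _))); rewrite rep_actM; congr (X Pi _).
  rewrite phiE incl_basefun; congr basefun.
  have low1 : redK (zlow l%:R) = 1%g.
    apply: (@red_congruent1 _ _ _ _ _ 0 l%:R 0); rewrite mulr0 addr0.
    exact: entries_zlow.
  exact: (etrans (congr1 (fun a => sym_act a xr) low1) (sym_act1 _)).
have e' : X (aff 0 (l%:R : Zp)) (X (incl (zswap p_pr)) (T phi) - X Pi phi) =
    X (aff 0 (l%:R : Zp)) (X (incl (zswap p_pr)) (T phi)) - X Pi phi.
  exact: (etrans (linearB _ _ _) (congr1 (fun y => _ - y) e)).
exact: (eq_ind _ children (children_unip _ swap_T_phi) _ e').
Qed.

Lemma padic_digits i l n (z : Zp) : (i < p ^ n)%N -> (l < p ^ n)%N ->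
  i%:R = l%:R + p%:R ^+ n * z -> i = l.
Proof.
move=> ip lp /(congr1 (fun x : Zp => x n)); rewrite residueD residueM -natrX.
rewrite !residue_nat modzz mul0r mod0z addr0 modz_mod !modz_nat !modn_small //.
by case.
Qed.

Lemma aff00 : aff 0 0 = 1%g.
Proof.
by apply: (entries_inj (entries_aff 0 0) (entries1 _)); rewrite ?rmorph0 ?expr0.
Qed.

Lemma act_aff_Pi w : X (aff 1 0) (X Pi w) = X (incl (zswap p_pr)) w.
Proof.
by apply: (etrans (act_mul _ (aff1_Pi p_pr))); rewrite rep_actM act_ppow.
Qed.

Lemma aff0_basefun z u :
  X (aff 0 z) (basefun u) = basefun (sym_act (unip (kred iota z)) u).
Proof.
apply: (etrans (act_eq _ (aff0 z))); rewrite incl_basefun; congr basefun.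
exact: (congr1 (fun a => sym_act a u) (red_zunip iota z)).
Qed.

Lemma swap_basefun u :
  X (incl (zswap p_pr)) (basefun u) = basefun (sym_act (swap k) u).
Proof.
rewrite incl_basefun; congr basefun.
exact: (congr1 (fun a => sym_act a u) (red_zswap p_pr iota)).
Qed.

Lemma red_zlow z : redK (zlow z) = 1%g.
Proof.
apply: (@red_congruent1 _ _ _ _ _ 0 z 0); rewrite mulr0 addr0.
exact: entries_zlow.
Qed.

Lemma low_basefun z u : X (incl (zlow z)) (basefun u) = basefun u.
Proof.
rewrite incl_basefun; congr basefun.
exact: (etrans (congr1 (fun a => sym_act a u) (red_zlow z)) (sym_act1 _)).
Qed.

Lemma at1_incl A w : cInd_at1 (X (incl A) w) = sym_act (redK A) (cInd_at1 w).
Proof. exact: act_incl1. Qed.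

Lemma at1_aff0 z w :
  cInd_at1 (X (aff 0 z) w) = sym_act (unip (kred iota z)) (cInd_at1 w).
Proof.
apply: (etrans (congr1 cInd_at1 (act_eq _ (aff0 z)))); rewrite at1_incl.
exact: (congr1 (fun a => sym_act a _) (red_zunip iota z)).
Qed.

Lemma at1_swap w :
  cInd_at1 (X (incl (zswap p_pr)) w) = sym_act (swap k) (cInd_at1 w).
Proof.
rewrite at1_incl.
exact: (congr1 (fun a => sym_act a _) (red_zswap p_pr iota)).
Qed.

Lemma at1_low z w : cInd_at1 (X (incl (zlow z)) w) = cInd_at1 w.
Proof.
rewrite at1_incl.
exact: (etrans (congr1 (fun a => sym_act a _) (red_zlow z)) (sym_act1 _)).
Qed.

Lemma at1_aff n b m c u :
  cInd_at1 (X ((aff n b)^-1 * aff m c)%g (basefun u)) != 0 ->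
  n = m /\ exists z, c = b + p%:R ^+ n * z.
Proof.
rewrite cInd_at1_act => /at_base_basefun hK.
have [-> [z [-> _]]] := aff_KZ_eq hK (mulVKg (aff n b) (aff m c)).
by split=> //; exists z.
Qed.

Lemma at1_Pi n b m c u :
  cInd_at1 (X ((aff n b)^-1 * (Pi * aff m c))%g (basefun u)) = 0.
Proof.
rewrite cInd_at1_act; apply/eqP/negPn/negP => /at_base_basefun hK.
exact: (aff_Pi_KZ hK (mulVKg (aff n b) (Pi * aff m c)%g)).
Qed.

Lemma low_aff_basefun n b : exists z, forall u,
  X (incl (zlow 1)) (X (aff n b) (basefun u)) =
  X (aff n (b - p%:R * b ^+ 2 + p%:R ^+ 2 * z)) (basefun u).
Proof.
have [z bz] := low_aff_shift b; exists z => u; rewrite -bz.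
have [A [a [c [d [e Ae]]]]] := zlow_mul_aff n b.
apply: (etrans (act_mul _ e)); rewrite rep_actM incl_basefun; congr (X _ (basefun _)).
exact: (etrans (congr1 (fun a => sym_act a _) (red_congruent1 iota Ae)) (sym_act1 _)).
Qed.

Definition cInd_tree : @tree_action k r p Zp (kred iota) G W :=
  @TreeAction k r p Zp (kred iota) G W X aff Pi (incl (zswap p_pr))
    (fun z => incl (zlow z)) basefun cInd_at1 T (@padic_approx p p_pr)
    padic_digits (@affM p p_pr) aff00 act_PiPi_cInd act_aff_Pi
    (@aff0_mul_Pi p p_pr) (@zlow_mul_Pi p p_pr) aff0_basefun swap_basefun
    low_basefun at1_aff0 at1_swap at1_low basefun1 at1_aff at1_Pi cInd_tree_eq0
    cInd_tree_span low_aff_basefun (rep_homP T) T_basefun.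

End CompactInductionTree.

(** * Smooth characters on principal units *)

Section SmoothCharacter.
Variables (p : nat) (p_pr : prime p) (k : fieldType).
Variable iota : {rmorphism 'F_p -> k}.
Variable eta : smooth_character p_pr k.
Local Notation Zp := (padic_int p_pr).

Lemma char_neq0 (a : padic p_pr) : a != 0 -> eta a != 0.
Proof.
move=> a0; apply: contra_eq_neq (char1 eta) => ea.
by rewrite -(mulfV a0) charM ?invr_eq0 // ea mul0r eq_sym oner_neq0.
Qed.

(** The cofactor of [u - 1] in [u ^ p - 1] is a sum of [p] terms congruent to 1,
    hence divisible by [p]. *)
Lemma pow_p_1p n (x : Zp) :
  exists y, (1 + p%:R ^+ n.+1 * x) ^+ p = 1 + p%:R ^+ n.+2 * y.
Proof.
set u := 1 + _; have red_u : padic_red u = 1.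
  by rewrite rmorphD /= exprS -mulrA red_pM rmorph1 addr0.
have [|y yE] := @padic_nonunit p p_pr (\sum_(i < p) u ^+ (p.-1 - i) * 1 ^+ i).
  rewrite padic_unit_red negbK rmorph_sum /=.
  under eq_bigr => i _ do rewrite expr1n mulr1 rmorphXn /= red_u expr1n.
  by rewrite sumr_const card_ord pcharf0 // pchar_Fp.
exists (x * y); have -> : u ^+ p = (u ^+ p - 1 ^+ p) + 1 by rewrite expr1n subrK.
have u1 : u - 1 = p%:R ^+ n.+1 * x by rewrite /u addrAC subrr add0r.
by rewrite subrXX yE u1 !exprS; ring.
Qed.

(** A smooth character of [1 + p Z_p] has p-power order, hence is trivial in
    characteristic [p]. *)
Lemma char_1p (x : Zp) : eta (1 + p%:R * x)%:F = 1.
Proof.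
have [n etan] := char_smooth eta.
have pow m : exists y, (1 + p%:R * x) ^+ (p ^ m) = 1 + p%:R ^+ m.+1 * y.
  elim: m => [|m [y IHm]]; first by exists x; rewrite expr1.
  by rewrite expnSr exprM IHm; apply: pow_p_1p.
have u0 m : ((1 + p%:R * x) ^+ m)%:F != 0.
  rewrite tofrac_eq0 expf_neq0 //.
  by have := unit_1p x; apply: contraTneq => ->; rewrite unitr0.
have etaX m : eta ((1 + p%:R * x) ^+ m)%:F = eta (1 + p%:R * x)%:F ^+ m.
  elim: m => [|m IHm]; first by rewrite !expr0 rmorph1 char1.
  by rewrite !exprS tofracM charM ?u0 // ?IHm // -[_ + _]expr1 u0.
have [y yE] := pow n.
have : eta (1 + p%:R * x)%:F ^+ (p ^ n) = 1.
  rewrite -etaX yE -(etan y); congr (eta _).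
  by rewrite tofracD tofracM tofracXn rmorph1 tofrac_p.
move: (eta _); elim: n {etan y yE} => [|n IHn] e; first by rewrite expr1.
rewrite expnSr exprM => e1; apply: IHn.
apply: (fmorph_inj (pFrobenius_aut (char_k p_pr iota))).
by rewrite rmorph1.
Qed.

End SmoothCharacter.

(** * The Iwahori subgroup and the exact sequence *)

Section IwahoriAction.
Variables (p : nat) (p_pr : prime p) (k : fieldType).
Variables (iota : {rmorphism 'F_p -> k}) (r : nat).
Hypothesis r_lt_p : (r < p)%N.
Local Notation Zp := (padic_int p_pr).
Local Notation G := (GL2 (padic p_pr)).
Local Notation X := (cInd_rep p_pr iota r).
Local Notation incl := (@GL2_Zp_incl p p_pr).
Local Notation Pi := (mx_Pi p_pr).
Local Notation aff := (@aff p p_pr).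
Variable phi : cInd p_pr iota r.
Hypothesis phi_gen : is_generator phi.
Local Notation base := (basefun r_lt_p phi_gen).
Local Notation xr := (sym_xr k r).

Lemma incl_upper_base (A : GL2 Zp) a b c d : entries A a b (p%:R * c) d ->
  X (incl A) (base xr) = kred iota a ^+ r *: base xr.
Proof.
move=> Ae; rewrite incl_basefun.
by apply: (etrans (congr1 base (red_upper_xr iota r_lt_p Ae))); rewrite linearZ.
Qed.

Lemma incl_upper_Pi_base (A : GL2 Zp) a b c d : entries A a b (p%:R * c) d ->
  X (incl A) (X Pi (base xr)) = kred iota d ^+ r *: X Pi (base xr).
Proof.
move=> /incl_Pi[A' [e Ae']]; apply: (etrans (act_mul _ e)).
by rewrite rep_actM (incl_upper_base Ae') linearZ.
Qed.

Lemma iwahori_base_lines g : iwahori p_pr g ->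
  (exists c, X g (base xr) = c *: base xr) /\
  (exists c, X g (X Pi (base xr)) = c *: X Pi (base xr)).
Proof.
move=> /iwahoriP[A [a [b [c [d [-> Ae]]]]]]; split.
  by exists (kred iota a ^+ r); apply: incl_upper_base Ae.
by exists (kred iota d ^+ r); apply: incl_upper_Pi_base Ae.
Qed.

Lemma kred_1p (x : Zp) : kred iota (1 + p%:R * x) = 1.
Proof. by rewrite rmorphD /= kred_pM addr0 rmorph1. Qed.

Lemma pro_p_iwahori_fixed g : pro_p_iwahori p_pr g ->
  X g (base xr) = base xr /\ X g (X Pi (base xr)) = X Pi (base xr).
Proof.
move=> /pro_p_iwahoriP[A [a [b [c [d [-> Ae]]]]]].
rewrite (incl_upper_base Ae) (incl_upper_Pi_base Ae).
by rewrite !kred_1p !expr1n !scale1r.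
Qed.

Lemma iwahori_vertex g n b u : iwahori p_pr g ->
  exists m c v, X g (X (aff n b) (base u)) = X (aff m c) (base v).
Proof.
move=> /iwahoriP[A [a [b' [c [d [-> Ae]]]]]].
have [m [f [A' e]]] := iwahori_aff n b Ae; exists m, f.
exists (sym_act (GL2_Zp_red iota A') u); apply: (etrans (act_mul _ e)).
by rewrite rep_actM incl_basefun.
Qed.

Lemma iwahori_Pi g : iwahori p_pr g ->
  exists2 h, iwahori p_pr h & (g * Pi = Pi * h)%g.
Proof.
move=> /iwahoriP[A [a [b [c [d [-> Ae]]]]]]; have [A' [e Ae']] := incl_Pi Ae.
by exists (incl A') => //; apply/iwahoriP; exists A', d, c, b, a.
Qed.

Lemma pos_monoidP g : pos_monoid p_pr g <-> exists n b, g = aff n b.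
Proof.
split=> [[n [b gE]]|[n [b ->]]]; exists n, b; last exact: entries_aff.
exact: (entries_inj (gE : entries _ _ _ _ _) (entries_aff n b)).
Qed.

Lemma pro_p_iwahori_unip : pro_p_iwahori p_pr (aff 0 1).
Proof.
apply/pro_p_iwahoriP; exists (zunip 1), 0, 1, 0, 0; split; first exact: aff0.
by rewrite !mulr0 !addr0; exact: entries_zunip.
Qed.

Lemma pro_p_iwahori_low : pro_p_iwahori p_pr (incl (zlow 1)).
Proof.
apply/pro_p_iwahoriP; exists (zlow 1), 0, 0, 1, 0; split=> //.
by rewrite !mulr0 !addr0; exact: entries_zlow.
Qed.

Lemma char_pro_p_iwahori (eta : smooth_character p_pr k) g :
  pro_p_iwahori p_pr g -> eta (\det (val g)) = 1.
Proof.
move=> /pro_p_iwahoriP[A [a [b [c [d [-> Ae]]]]]].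
rewrite det_incl (det_entries Ae).
have -> : (1 + p%:R * a) * (1 + p%:R * d) - b * (p%:R * c) =
  1 + p%:R * (a + d + p%:R * a * d - b * c) by ring.
exact: (char_1p iota).
Qed.

End IwahoriAction.

Theorem theorem1p2 (p : nat) (p_pr : prime p) (k : closedFieldType)
    (iota : {rmorphism 'F_p -> k}) (k_algebraic : integralRange iota)
    (V : lmodType k) (rho : representation (GL2 (padic p_pr)) V)
    (rho_supersingular : supersingular iota rho) :
  let I := iwahori p_pr in
  let I1 := pro_p_iwahori p_pr in
  let M := lin_span [set rho g v | g in pos_monoid p_pr & v in rep_invariants rho I1] in
  let PiM := [set rho (mx_Pi p_pr) v | v in M] in
  rep_stable rho I M /\
  short_exact rho (rep_sum rho rho) rho I
    (rep_invariants rho I1) (M `*` PiM) setT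
    (fun v => (v, v)) (fun vw => vw.1 - vw.2).
Proof.
have [r [phi [T [eta [rp phi_gen T_hecke [f [psi fK psiK]]]]]]] := rho_supersingular.
have r_lt_p : (r < p)%N by have := prime_gt0 p_pr; lia.
have psi_lin : linear psi.
  by move=> a x y; apply: (can_inj fK); rewrite linearP /= !psiK.
pose psiL : {linear coker T -> V} :=
  HB.pack psi (GRing.isLinear.Build k (coker T) V *:%R psi psi_lin).
pose pr : {linear cInd p_pr iota r -> V} := psiL \o coker_proj T.
have pr_ker w : pr w = 0 <-> exists h, w = T h.
  split=> [w0|[h ->]].
    have : coker_proj T w = coker_proj T 0.
      by rewrite linear0 -[LHS]psiK [psi _]w0 linear0.
    by move/coker_projP => [h]; rewrite subr0 => ->; exists h.
  have e : coker_proj T (T h) = coker_proj T 0.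
    by apply/coker_projP; exists h; rewrite subr0.
  exact: (etrans (congr1 psi e) (linear0 pr)).
have pr_surj y : exists w, y = pr w.
  have [w wE] := coker_proj_surj (f y); exists w.
  exact: (etrans (esym (fK y)) (congr1 psi wE)).
pose chi (g : GL2 (padic p_pr)) := eta (\det (val g)).
have rho_pr g w : rho g (pr w) = chi g *: pr (cInd_rep p_pr iota r g w).
  have e : pi0_rep T eta g (coker_proj T w) =
      chi g *: coker_proj T (cInd_rep p_pr iota r g w).
    exact: (congr1 (fun y => _ *: y) (coker_actE T g w)).
  apply: (can_inj fK); apply: (etrans (rep_homP f g (pr w))).
  apply: (etrans (congr1 (pi0_rep T eta g) (psiK _))); apply: (etrans e).
  apply/esym; rewrite linearZ; exact: (congr1 (fun y => chi g *: y) (psiK _)).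
have chi_neq0 g : chi g != 0.
  by apply: char_neq0; have := valP g; rewrite unitmxE unitfE.
exact: (@half_tree_exact_sequence k r p (padic_int p_pr) (kred iota)
  (GL2 (padic p_pr)) (cInd p_pr iota r) (cInd_tree r_lt_p phi_gen T_hecke)
  p_pr (char_k p_pr iota) r_lt_p V pr pr_ker pr_surj rho chi
  (iwahori p_pr) (pro_p_iwahori p_pr) (pos_monoid p_pr) rho_pr chi_neq0
  (@pos_monoidP p p_pr) (@char_pro_p_iwahori p p_pr k iota eta)
  (@pro_p_iwahori_fixed p p_pr k iota r r_lt_p phi phi_gen)
  (pro_p_iwahori_unip p_pr) (pro_p_iwahori_low p_pr)
  (@iwahori_base_lines p p_pr k iota r r_lt_p phi phi_gen)
  (@iwahori_vertex p p_pr k iota r r_lt_p phi phi_gen)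
  (@iwahori_Pi p p_pr)).
Qed.
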